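(* Consider local holomorphic surfaces $S\subset\mathbb{C}^3_{x,y,u}$ with nowhere vanishing Hessian in branch $B_3$, i.e. with $G_{3,0}\equiv0\equiv G_{0,3}$ (see context). **(a)** In the branch $B_{3\cdot1}$ where $G_{3,0}\equiv G_{0,3}\equiv0\neq G_{2,2}$, there exists (up to $A(3)$-equivalence) a single surface $$u=xy+\frac{x^2y^2}{4}+\sum_{j+k\geqslant5}I_{j,k}\,\frac{x^j}{j!}\frac{y^k}{k!},$$ with uniquely determined $I_{j,k}\in\mathbb{C}$, which is automatically homogeneous, having $3$-dimensional affine symmetry algebra generated by $$e_1:=-x\,\partial_x+y\,\partial_y,\qquad e_2:=(u-2)\,\partial_x-2y\,\partial_u,\qquad e_3:=(u-2)\,\partial_y-2x\,\partial_u,$$ with structure $\cong\mathfrak{sl}(2,\mathbb{C})$ given by $[e_1,e_2]=e_2$, $[e_1,e_3]=-e_3$, $[e_2,e_3]=-2e_1$. A closed form is $$u=2-2\sqrt{1-xy}.$$ **(b)** In the branch $B_{3\cdot2}$ where $G_{3,0}\equiv G_{0,3}\equiv G_{2,2}\equiv0$, the normal form is the basic quadric $$u=xy,$$ having $4$-dimensional affine symmetry algebra generated by $$e_1:=-x\,\partial_x+y\,\partial_y,\qquad e_2:=x\,\partial_x+u\,\partial_u,\qquad e_3:=\partial_x+y\,\partial_u,\qquad e_4:=\partial_y+x\,\partial_u,$$ with solvable Lie structure whose nonzero brackets are $[e_1,e_3]=e_3$, $[e_1,e_4]=-e_4$, $[e_2,e_3]=-e_3$.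
   Context: $A(3)$ is the group of affine transformations $w\mapsto Mw+b$ of $\mathbb{C}^3_{x,y,u}$, $M\in GL(3,\mathbb{C})$, $b\in\mathbb{C}^3$. All surfaces are local holomorphic graphs $S=\{u=F(x,y)\}$ with $F_{xx}F_{yy}-F_{xy}^2$ nowhere zero, and equivalence is local equivalence (of germs) under $A(3)$. The affine symmetry algebra of $S$ is the Lie algebra of affine vector fields (coefficients polynomials of degree $\le1$ in $x,y,u$) tangent to $S$; $S$ is homogeneous if these span the tangent plane of $S$ at each point. For each $p\in S$ some affine map sends $p$ to $0$ and the germ of $S$ at $p$ to a graph $u=xy+G_{3,0}\frac{x^3}{6}+G_{0,3}\frac{y^3}{6}+\sum_{j+k\ge4}G_{j,k}\frac{x^j}{j!}\frac{y^k}{k!}$, unique up to bi-dilations $(x,y,u)\mapsto(\mu x,\lambda y,\mu\lambda u)$, $\lambda,\mu\in\mathbb{C}^*$, and the swap $x\leftrightarrow y$; each $G_{j,k}$ is rescaled by bi-dilations, so its vanishing (up to the swap) is well defined. Branch $B_3$: $G_{3,0}\equiv0\equiv G_{0,3}$ identically on $S$. Within $B_3$, branch $B_{3\cdot1}$ means $G_{2,2}\neq0$ at every point (one then normalizes $G_{2,2}=1$, the $I_{j,k}$ being the resulting coefficients), and branch $B_{3\cdot2}$ means $G_{2,2}\equiv0$ identically on $S$. *)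

(* Defs.v *)
From HB Require Import structures.
From mathcomp Require Import all_boot all_order all_algebra.
From mathcomp Require Import all_classical all_reals all_analysis.
From mathcomp.real_closed Require Export complex.
Set Implicit Arguments.
Unset Strict Implicit.
Unset Printing Implicit Defensive.
Import Order.TTheory GRing.Theory Num.Theory.
Import numFieldNormedType.Exports.
Local Open Scope classical_set_scope.
Local Open Scope ring_scope.

(* R[i] as a numClosedFieldType: in this form it carries the normed topology
   of MathComp-Analysis, so that [differentiable] and ['D_v f] below are
   complex differentiability and complex directional derivatives. *)
Definition Cplx (R : realType) : numClosedFieldType := R[i].

Definition ix : 'I_3 := @Ordinal 3 0 isT.
Definition iy : 'I_3 := @Ordinal 3 1 isT.
Definition iu : 'I_3 := @Ordinal 3 2 isT.

Section Surfaces.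
Variable R : realType.
Notation C := (Cplx R).

Definition pt (x y u : C) : 'cV[C]_3 := \col_(i < 3) [:: x; y; u]`_i.

Record surface := Surface { dom : set (C * C); fn : C * C -> C }.

Definition hessian (F : C * C -> C) (z : C * C) : C :=
  'D_(1, 0) ('D_(1, 0) F) z * 'D_(0, 1) ('D_(0, 1) F) z
  - ('D_(1, 0) ('D_(0, 1) F) z) ^+ 2.

Definition local_surface (S : surface) : Prop :=
  [/\ open (dom S),
      forall z, dom S z -> differentiable (fn S) z
    & forall z, dom S z -> hessian (fn S) z != 0].

Definition graph_pt (S : surface) (z : C * C) : 'cV[C]_3 :=
  pt z.1 z.2 (fn S z).

Definition graph (S : surface) : set 'cV[C]_3 :=
  [set w | exists2 z, dom S z & w = graph_pt S z].

(* A pair (M, b) stands both for the affine map w |-> M w + b and for the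
   affine vector field whose value at w is M w + b. *)
Notation affine := ('M[C]_3 * 'cV[C]_3)%type.

Definition aeval (A : affine) (w : 'cV[C]_3) : 'cV[C]_3 := A.1 *m w + A.2.

(* The germs (S, p) and (T, q) are equivalent under A(3). *)
Definition germ_equiv (S : surface) (p : 'cV[C]_3)
    (T : surface) (q : 'cV[C]_3) : Prop :=
  exists A : affine,
    [/\ A.1 \in unitmx, aeval A p = q
      & \forall w \near p, graph S w <-> graph T (aeval A w)].

(* Near the origin, f(x,y) is the sum of the absolutely convergent series
   \sum_{j,k} G_{j,k} x^j/j! y^k/k!. *)
Definition has_expansion (f : C * C -> C) (G : nat -> nat -> C) : Prop :=
  exists2 r : C, 0 < r & forall x y : C, `|x| < r -> `|y| < r ->
    let t (j k : nat) := G j k * (x ^+ j / j`!%:R) * (y ^+ k / k`!%:R) in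
    (exists B : C, forall n, \sum_(j < n) \sum_(k < n) `|t j k| <= B) /\
    \sum_(j < n) \sum_(k < n) t j k @[n --> \oo] --> f (x, y).

Definition normalized (G : nat -> nat -> C) : Prop :=
  forall j k : nat, (j + k <= 3)%N ->
    (j, k) != (3, 0)%N -> (j, k) != (0, 3)%N ->
    G j k = ((j, k) == (1, 1)%N)%:R.

(* An affine map sends p to 0 and the germ of S at p to the graph
   u = xy + G_{3,0} x^3/6 + G_{0,3} y^3/6 + \sum_{j+k >= 4} G_{j,k} .... *)
Definition normal_form (S : surface) (p : 'cV[C]_3) (G : nat -> nat -> C) :
    Prop :=
  normalized G /\
  exists T : surface,
    [/\ local_surface T, dom T (0, 0), has_expansion (fn T) G
      & germ_equiv S p T 0].

(* As G is unique up to bi-dilations and the swap, the choice of the normal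
   form at p does not matter in the next two definitions. *)
Definition branch_B3_1 (S : surface) : Prop :=
  local_surface S /\
  forall p, graph S p -> exists G,
    [/\ normal_form S p G, G 3%N 0%N = 0, G 0%N 3%N = 0 & G 2%N 2%N != 0].

Definition branch_B3_2 (S : surface) : Prop :=
  local_surface S /\
  forall p, graph S p -> exists G,
    [/\ normal_form S p G, G 3%N 0%N = 0, G 0%N 3%N = 0 & G 2%N 2%N = 0].

Definition tangent (S : surface) (z : C * C) (v : 'cV[C]_3) : Prop :=
  'D_(v ix 0, v iy 0) (fn S) z = v iu 0.

Definition affine_symmetry (S : surface) (X : affine) : Prop :=
  forall z, dom S z -> tangent S z (aeval X (graph_pt S z)).

Definition symmetry_algebra (S : surface) (L : {vspace affine}) : Prop :=
  forall X, affine_symmetry S X <-> X \in L.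

(* The affine symmetries form a linear space, so the span of their values at a
   point is the set of these values. *)
Definition homogeneous (S : surface) : Prop :=
  forall z, dom S z -> forall v, tangent S z v ->
    exists2 X, affine_symmetry S X & aeval X (graph_pt S z) = v.

(* The bracket [X, Y] = X(Y) - Y(X) of vector fields: for X = Mw + b and
   Y = Nw + c it is w |-> N (Mw + b) - M (Nw + c). *)
Definition bracket (X Y : affine) : affine :=
  (Y.1 *m X.1 - X.1 *m Y.1, Y.1 *m X.2 - X.1 *m Y.2).

(* [vf i] is the field \partial_i, and [lvf i j] is w_i \partial_j. *)
Definition vf (i : 'I_3) : affine := (0, delta_mx i 0).
Definition lvf (i j : 'I_3) : affine := (delta_mx j i, 0).

Definition derived (L : {vspace affine}) : {vspace affine} :=
  <<[seq bracket X Y | X <- vbasis L, Y <- vbasis L]>>%VS.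

Definition solvable_algebra (L : {vspace affine}) : Prop :=
  exists n, iter n derived L = 0%VS.

Definition isomorphic_sl2 (L : {vspace affine}) : Prop :=
  exists phi : {linear affine -> 'M[C]_2},
    [/\ {in L &, injective phi},
        forall N : 'M[C]_2, \tr N = 0 <-> exists2 X, X \in L & phi X = N
      & {in L &, forall X Y,
          phi (bracket X Y) = phi X *m phi Y - phi Y *m phi X}].

(* [sqrtc] is the principal square root on R[i]; [sqrtC] would not do, since
   its branch cut is the positive real axis. *)
Definition sqrt_fn (z : C * C) : C := 2 - 2 * (sqrtc (1 - z.1 * z.2) : C).

Definition quadric_fn (z : C * C) : C := z.1 * z.2.

End Surfaces.

(* Main.v *)
Require Import Defs.
From HB Require Import structures.
From mathcomp Require Import all_boot all_order all_algebra.
From mathcomp Require Import all_classical all_reals all_analysis.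
From mathcomp Require Import ring lra zify.
Set Implicit Arguments.
Unset Strict Implicit.
Unset Printing Implicit Defensive.
Import Order.TTheory GRing.Theory Num.Theory.
Import numFieldNormedType.Exports.
Local Open Scope classical_set_scope.
Local Open Scope ring_scope.

(** A normal form without cubic terms at a point means that the surface has contact of third
    order there with a quadric. In terms of a defining function [F], the cubic form [D^3 F] at
    that point is then the product of the quadratic form [D^2 F] by a linear form. Eliminating
    the linear form leaves two equations in the derivatives of order 2 and 3 ([apolar_pde]):
      (4 F_xy^2 - F_xx F_yy) F_xxx = 3 F_xx (2 F_xy F_xxy - F_xx F_xyy)
    and its image under the swap of [x] and [y]. On a surface of branch B3 they hold at every
    point ([near_apolar_pde]).

    Put the base point in normal form, so that [F_xx] and [F_yy] vanish at 0 and [F_xy] is 1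
    there. Then the equations express [F_xxx] and [F_yyy] by terms of smaller degree, and
    determine recursively each coefficient [G j k] with [j >= 3] or [k >= 3]. Since those with
    [j, k <= 2] are fixed except for [G 2 2], a normal form in branch B3 is determined by the
    number [G 2 2] ([solves_pde_uniq], [normal_form_uniq]), and a dilation turns a nonzero
    [G 2 2] into 1.

    It remains to exhibit a surface of branch B3 with [G 2 2 = 1] and one with [G 2 2 = 0]. The
    first is [u = 2 - 2 sqrt (1 - x y)], a piece of the quadric [(u - 2)^2 + 4 x y = 4]; the second
    is the paraboloid [u = x y]. Both belong to branch B3 because affine maps that preserve
    the quadric carry any of their points to the origin: minus a reflection of the quadratic
    form in the first case ([sqrt_germ]), a translation in the second ([quadric_germ]).

    Normal forms come with convergent double series, and all the analysis rests on
    these: [dfn] is the termwise derivative, and [taylor] expands it at a point near 0 with a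
    uniform remainder. Functions are then compared along the lines [t |-> (t, t y)] by their
    order of vanishing in [t] ([ord_ge]); an identity that holds for all [y] gives back the
    coefficients of the double series.

    The symmetry algebras are found in the same way. Tangency of an affine vector field along
    the lines through 0 gives equations on its twelve coefficients ([sqrt_symmetry],
    [quadric_symmetry]). *)

(** * Orders of vanishing in one variable *)
Section OrdGe.
Variable K : numFieldType.
Implicit Types (g h : K -> K) (s : nat -> K).

(** The punctured neighbourhood makes division by [t] harmless. *)
Definition ord_ge (n : nat) g :=
  exists2 B, 0 <= B & \forall t \near 0^', `|g t| <= B * `|t| ^+ n.

Lemma ord_ge_near n g h :
  (\forall t \near 0^', g t = h t) -> ord_ge n g -> ord_ge n h.
Proof.
move=> gh [B B0 Bg]; exists B => //.
by near=> t; rewrite -(near gh t) //; near: t.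
Unshelve. all: by end_near. Qed.

Lemma ord_ge_ext n g h : g =1 h -> ord_ge n g -> ord_ge n h.
Proof. by move=> gh; apply: ord_ge_near; apply: nearW. Qed.

Lemma ord_geD n g h : ord_ge n g -> ord_ge n h -> ord_ge n (fun t => g t + h t).
Proof.
move=> [B B0 Bg] [D D0 Dh]; exists (B + D); first exact: addr_ge0.
near=> t; rewrite mulrDl (le_trans (ler_normD _ _))// lerD//; near: t => //.
Unshelve. all: by end_near. Qed.

Lemma ord_geM m n g h : ord_ge m g -> ord_ge n h -> ord_ge (m + n) (fun t => g t * h t).
Proof.
move=> [B B0 Bg] [D D0 Dh]; exists (B * D); first exact: mulr_ge0.
near=> t; rewrite normrM exprD mulrACA ler_pM//; near: t => //.
Unshelve. all: by end_near. Qed.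

Lemma near0_le1 : \forall t \near (0 : K)^', `|t| <= 1.
Proof.
have /nbhs_dnbhs : nbhs (0 : K) [set t | `|t| <= 1].
  apply/nbhs_ballP; exists 1 => //= t; rewrite /ball /= sub0r normrN => /ltW //.
by [].
Qed.

Lemma ord_ge_leq m n g : (m <= n)%N -> ord_ge n g -> ord_ge m g.
Proof.
move=> mn [B B0 Bg]; exists B => //.
near=> t; apply: le_trans (_ : B * `|t| ^+ n <= _); first by near: t.
by rewrite ler_wpM2l// ler_wiXn2l//; near: t; exact: near0_le1.
Unshelve. all: by end_near. Qed.

Lemma ord_ge_cst c : ord_ge 0 (fun=> c).
Proof. by exists `|c| => //; apply: nearW => t; rewrite expr0 mulr1. Qed.

Lemma ord_ge_pow n : ord_ge n (fun t => t ^+ n).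
Proof. by exists 1 => //; apply: nearW => t; rewrite mul1r normrX. Qed.

Lemma ord_ge0 n : ord_ge n (fun=> 0).
Proof. by exists 0 => //; apply: nearW => t; rewrite normr0 mul0r. Qed.

Lemma ord_geMl n g c : ord_ge n g -> ord_ge n (fun t => c * g t).
Proof. by move=> Og; have := ord_geM (ord_ge_cst c) Og. Qed.

Lemma ord_geN n g : ord_ge n g -> ord_ge n (fun t => - g t).
Proof. by move=> /(ord_geMl (-1)); apply: ord_ge_ext => t; rewrite mulN1r. Qed.

Lemma ord_geB n g h : ord_ge n g -> ord_ge n h -> ord_ge n (fun t => g t - h t).
Proof. by move=> Og Oh; apply: ord_geD => //; apply: ord_geN. Qed.

Lemma ord_ge_sum n m (g : nat -> K -> K) :
  (forall i, (i < m)%N -> ord_ge n (g i)) -> ord_ge n (fun t => \sum_(i < m) g i t).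
Proof.
elim: m => [_|m IH Og].
  by apply: ord_ge_ext (ord_ge0 n) => t; rewrite big_ord0.
apply: (@ord_ge_ext _ (fun t => \sum_(i < m) g i t + g m t)).
  by move=> t; rewrite big_ord_recr.
by apply: ord_geD; [apply: IH => i im; apply: Og; rewrite ltnS ltnW|apply: Og].
Qed.

Lemma ord_ge_div n g : ord_ge n.+1 (fun t => t * g t) -> ord_ge n g.
Proof.
move=> [B B0 Bg]; exists B => //; near=> t.
have t0 : 0 < `|t| by rewrite normr_gt0; near: t; exact: nbhs_dnbhs_neq.
rewrite -(ler_pM2l t0) mulrCA -exprS -normrM.
by near: t.
Unshelve. all: by end_near. Qed.

Lemma ord_ge_cst_eq0 c : ord_ge 1 (fun=> c) -> c = 0.
Proof.
move=> [B B0 Bg]; apply/eqP/negPn/negP => c0.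
have c0' : 0 < `|c| by rewrite normr_gt0.
have B1 : 0 < B + 1 by rewrite ltr_wpDl.
near (0 : K)^' => t.
have t0 : 0 < `|t| by rewrite normr_gt0; near: t; exact: nbhs_dnbhs_neq.
have : `|c| < `|c|.
  apply: (@le_lt_trans _ _ (B * `|t|)); first by rewrite -[`|t|]expr1; near: t.
  apply: (@lt_trans _ _ ((B + 1) * `|t|)); first by rewrite ltr_pM2r// ltrDl.
  rewrite -ltr_pdivlMl// mulrC.
  near: t; apply: nbhs_dnbhs; apply/nbhs_ballP; exists (`|c| / (B + 1)) => /=.
    by rewrite divr_gt0.
  by move=> t; rewrite /ball /= sub0r normrN.
by rewrite ltxx.
Unshelve. all: by end_near. Qed.

(** The constant term is the limit at 0; once it vanishes, division by [t] lowers the degree. *)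
Lemma ord_ge_poly_eq0 n s :
  ord_ge n (fun t => \sum_(i < n) s i * t ^+ i) -> forall i, (i < n)%N -> s i = 0.
Proof.
elim: n s => [//|n IH] s Os.
have s0 : s 0%N = 0.
  apply: ord_ge_cst_eq0.
  apply: (@ord_ge_ext _ (fun t => \sum_(i < n.+1) s i * t ^+ i
                               - t * \sum_(i < n) s i.+1 * t ^+ i)).
    move=> t; rewrite big_ord_recl expr0 mulr1 mulr_sumr -addrA -sumrB big1 ?addr0//.
    by move=> i _; rewrite /bump /= exprS mulrCA subrr.
  apply: ord_geB; first exact: ord_ge_leq Os.
  rewrite -[1%N]addn0; apply: ord_geM; first by apply: ord_ge_ext (ord_ge_pow 1) => t.
  apply: (@ord_ge_sum _ _ (fun i t => s i.+1 * t ^+ i)) => i _.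
  by apply: ord_geMl; apply: ord_ge_leq (ord_ge_pow i).
move=> [//|i] ni; apply: (IH (fun i => s i.+1)) => //.
apply: ord_ge_div; apply: ord_ge_ext Os => t.
rewrite big_ord_recl s0 mul0r add0r mulr_sumr; apply: eq_bigr => j _.
by rewrite /bump /= exprS mulrCA.
Qed.

Definition expands g s := forall n, ord_ge n (fun t => g t - \sum_(i < n) s i * t ^+ i).

End OrdGe.

(** * Convergence of double series *)
Section Complete.
Variable R : realType.
Notation C := (Cplx R).

(** Both [b] and [x + b] are nondecreasing and bounded. *)
Lemma real_cvg_of_dominated_steps (x b : nat -> R) (B : R) :
  (forall n, `|x n.+1 - x n| <= b n.+1 - b n) -> (forall n, b n <= B) ->
  exists l : R, x n @[n --> \oo] --> l.
Proof.
move=> xb bB.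
have bnd : {homo b : m n / (m <= n)%N >-> m <= n}.
  by apply/nondecreasing_seqP => n; have := xb n; have := normr_ge0 (x n.+1 - x n); lra.
have cb : cvgn b.
  apply: nondecreasing_is_cvgn => //; exists B => _ [n _ <-]; exact: bB.
pose y n := x n + b n.
have cy : cvgn y.
  apply: nondecreasing_is_cvgn.
    apply/nondecreasing_seqP => n; have := xb n; rewrite ler_norml /y; lra.
  exists (x 0%N - b 0%N + B + B) => _ [n _ <-].
  suff : x n - x 0%N <= b n - b 0%N by rewrite /y; have := bB n; lra.
  elim: n => [|n]; first by rewrite !subrr.
  have := xb n; rewrite ler_norml; lra.
exists (limn y - limn b).
have -> : (fun n => x n) = (fun n => y n - b n) by apply/funext => n; rewrite /y; ring.
exact: cvgB.
Qed.

Lemma normC_le_Re_Im (x : C) : `|x| <= (`|complex.Re x| + `|complex.Im x|)%:C%C.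
Proof.
rewrite {1}[x]complexE (le_trans (ler_normD _ _))// rmorphD /= lerD//.
  by rewrite normc_def /= expr0n addr0 sqrtr_sqr.
rewrite normrM.
have -> : `|'i%C : C| = 1 by rewrite normc_def /= expr0n add0r expr1n sqrtr1.
by rewrite mul1r normc_def /= expr0n addr0 sqrtr_sqr.
Qed.

Lemma cvgC_of_Re_Im (u : nat -> C) (a b : R) :
  complex.Re (u n) @[n --> \oo] --> a -> complex.Im (u n) @[n --> \oo] --> b ->
  u n @[n --> \oo] --> (Complex a b : C).
Proof.
move=> ca cb; apply/cvgrPdist_lt => e e0.
have eE : e = (complex.Re e)%:C%C by rewrite RRe_real// ger0_real// ltW.
have e0' : 0 < complex.Re e by move: e0; rewrite ltcE => /andP[].
near=> n; apply: le_lt_trans (normC_le_Re_Im _) _.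
rewrite eE ltcR (splitr (complex.Re e)) ltrD//.
  have -> : complex.Re (Complex a b - u n) = a - complex.Re (u n) by case: (u n).
  by near: n; move/cvgrPdist_lt : ca; apply; rewrite divr_gt0.
have -> : complex.Im (Complex a b - u n) = b - complex.Im (u n) by case: (u n).
by near: n; move/cvgrPdist_lt : cb; apply; rewrite divr_gt0.
Unshelve. all: by end_near. Qed.

Lemma Re_le (x y : C) : x <= y -> complex.Re x <= complex.Re y.
Proof. by rewrite lecE => /andP[]. Qed.

Lemma norm_Re (x : C) : `|complex.Re x| <= complex.Re `|x|.
Proof. by have /Re_le := normc_ge_Re x. Qed.

Lemma norm_Im (x : C) : `|complex.Im x| <= complex.Re `|x|.
Proof.
have := norm_Re ('i%C * x); rewrite normrM.
have -> : `|'i%C : C| = 1 by rewrite normc_def /= expr0n add0r expr1n sqrtr1.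
rewrite mul1r; suff -> : complex.Re ('i%C * x) = - complex.Im x by rewrite normrN.
by rewrite mulrC ReiNIm.
Qed.

Lemma cvg_of_dominated_steps (u b : nat -> C) (B : C) :
  (forall n, `|u n.+1 - u n| <= b n.+1 - b n) -> (forall n, b n <= B) ->
  exists l : C, u n @[n --> \oo] --> l.
Proof.
move=> ub bB.
have Rb n : complex.Re (b n) <= complex.Re B by apply: Re_le.
have ReB (x y : C) : complex.Re (x - y) = complex.Re x - complex.Re y.
  by case: x y => [? ?] [? ?].
have ImB (x y : C) : complex.Im (x - y) = complex.Im x - complex.Im y.
  by case: x y => [? ?] [? ?].
have [a ca] : exists a : R, complex.Re (u n) @[n --> \oo] --> a.
  apply: real_cvg_of_dominated_steps Rb => n.
  by rewrite -!ReB (le_trans (norm_Re _))// Re_le.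
have [c cc] : exists a : R, complex.Im (u n) @[n --> \oo] --> a.
  apply: real_cvg_of_dominated_steps Rb => n.
  by rewrite -ReB -ImB (le_trans (norm_Im _))// Re_le.
by exists (Complex a c); exact: cvgC_of_Re_Im.
Qed.

(** Passing from one square to the next adds an L-shaped layer, whose sum is bounded by
    the increment of the bounded sequence of absolute sums. *)
Lemma cvg_square_sums (t : nat -> nat -> C) (B : C) :
  (forall n, \sum_(j < n) \sum_(k < n) `|t j k| <= B) ->
  exists l : C, \sum_(j < n) \sum_(k < n) t j k @[n --> \oo] --> l.
Proof.
move=> tB.
have step (V : zmodType) (s : nat -> nat -> V) n :
    \sum_(j < n.+1) \sum_(k < n.+1) s j k - \sum_(j < n) \sum_(k < n) s j k
    = \sum_(j < n) s j n + \sum_(k < n.+1) s n k.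
  rewrite big_ord_recr /=.
  under eq_bigr do rewrite big_ord_recr /=.
  by rewrite big_split /=; apply/eqP; rewrite subr_eq -addrA addrC.
apply: cvg_of_dominated_steps tB => n.
rewrite (step _ t) (step _ (fun j k => `|t j k|)) (le_trans (ler_normD _ _))//.
by apply: lerD; apply: ler_norm_sum.
Qed.

End Complete.

Lemma cvg_norm_le (K : numFieldType) (u : nat -> K) (l c : K) :
  u n @[n --> \oo] --> l -> (forall n, `|u n| <= c) -> `|l| <= c.
Proof.
move=> ul uc.
have cr : c \is Num.real by rewrite ger0_real// (le_trans _ (uc 0%N)).
have [//|cl] := real_leP (normr_real l) cr.
move/cvgrPdist_lt : ul => /(_ (`|l| - c)); rewrite subr_gt0 => /(_ cl) [N _ /(_ N (leqnn N))] /=.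
move=> luN; suff : `|l| < `|l| - c + c by rewrite subrK ltxx.
by rewrite -{1}(subrK (u N) l) (le_lt_trans (ler_normD _ _))// ltr_leD.
Qed.

Lemma cvg_sum_ord (K : numFieldType) m (u : nat -> nat -> K) (l : nat -> K) :
  (forall i, u i n @[n --> \oo] --> l i) ->
  \sum_(i < m) u i n @[n --> \oo] --> \sum_(i < m) l i.
Proof.
move=> ul; elim: m => [|m IH].
  rewrite big_ord0 (_ : (fun n => _) = fun=> 0); first exact: cvg_cst.
  by apply/funext => n; rewrite big_ord0.
rewrite big_ord_recr (_ : (fun n => _) = fun n => \sum_(i < m) u i n + u m n).
  exact: cvgD.
by apply/funext => n; rewrite big_ord_recr.
Qed.

(** * Derivatives of monomials and a remainder estimate *)
Section Dmon.
Variable K : numFieldType.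
Implicit Types (x w z v : K).

(** The [a]-th derivative of [x ^ j / j!]; the falling factorial makes it 0 when [j < a]. *)
Definition dmon (a j : nat) x := x ^+ (j - a) * (j ^_ a)%:R / j`!%:R.

Lemma ffactnD n a c : (n ^_ (a + c) = n ^_ a * (n - a) ^_ c)%N.
Proof.
elim: a n => [|a IH] n; first by rewrite subn0 ffactn0 mul1n.
case: n => [|n]; first by rewrite !ffact0n mul0n.
by rewrite addSn !ffactSS IH mulnA subSS.
Qed.

Lemma natfact_neq0 n : n`!%:R != 0 :> K.
Proof. by rewrite pnatr_eq0 -lt0n fact_gt0. Qed.

Lemma dmonD a j x w :
  dmon a j (x + w) = \sum_(c < j.+1) dmon (a + c) j x * (w ^+ c / c`!%:R).
Proof.
rewrite /dmon exprDn.
have [ja|aj] := ltnP j a.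
  rewrite ffact_small// mulr0 mul0r big1// => c _.
  by rewrite ffact_small ?mulr0 ?mul0r// (leq_trans ja)// leq_addr.
rewrite (big_ord_widen j.+1 (fun i => x ^+ (j - a - i) * w ^+ i *+ 'C(j - a, i))) ?ltnS ?leq_subr//.
rewrite big_mkcond !mulr_suml; apply: eq_bigr => c _.
case: ifPn => [_|]; last first.
  rewrite -leqNgt => h; rewrite !mul0r ffact_small ?mulr0 ?mul0r//.
  by move: h; rewrite ltn_subLR // addSn ltnS -ltnS => h; lia.
rewrite subnDA ffactnD natrM -mulr_natr -(bin_ffact (j - a)) natrM.
have := natfact_neq0 c; have := natfact_neq0 j => h1 h2.
by field; rewrite h1 h2.
Qed.

Lemma dmon0 j x : dmon 0 j x = x ^+ j / j`!%:R.
Proof. by rewrite /dmon subn0 ffactn0 mulr1. Qed.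

Lemma norm_dmon a j x : `|dmon a j x| = dmon a j `|x|.
Proof. by rewrite /dmon !normrM normrX normfV !normr_nat. Qed.

Lemma dmon_ge0 a j x : 0 <= x -> 0 <= dmon a j x.
Proof. by move=> x0; rewrite /dmon !mulr_ge0// ?exprn_ge0// invr_ge0. Qed.

Lemma dmon_le a j x w : 0 <= x -> x <= w -> dmon a j x <= dmon a j w.
Proof.
move=> x0 xw; rewrite /dmon ler_wpM2r ?invr_ge0// ler_wpM2r//.
by rewrite lerXn2r ?nnegrE// (le_trans x0).
Qed.

Lemma dmon_at0 a j : dmon a j 0 = (j == a)%:R.
Proof.
rewrite /dmon expr0n subn_eq0; have [ja|aj|->] := ltngtP j a.
- by rewrite ffact_small// mulr0 mul0r.
- by rewrite !mul0r.
- by rewrite mul1r ffactnn divff// natfact_neq0.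
Qed.

(** [dmon a j x * w ^ a / a!] is a single term of the expansion [dmonD] of [dmon 0 j (x + w)],
    whose terms are all nonnegative. Hence derivatives of a power series converge in the
    same open polydisk. *)
Lemma dmon_bound a j x w : 0 <= x -> 0 < w ->
  dmon a j x <= a`!%:R / w ^+ a * dmon 0 j (x + w).
Proof.
move=> x0 w0; have wa : 0 < w ^+ a by rewrite exprn_gt0.
rewrite mulrAC ler_pdivlMr// dmonD.
have [ja|aj] := ltnP j a.
  rewrite /dmon ffact_small// mulr0 !mul0r mulr_ge0 ?ler0n//.
  by apply: sumr_ge0 => i _; rewrite !mulr_ge0 ?invr_ge0// ?exprn_ge0// ltW.
rewrite (bigD1 (inord a)) //= add0n inordK ?ltnS// mulrDr.
set T := dmon a j x.
have -> : a`!%:R * (T * (w ^+ a / a`!%:R)) = T * w ^+ a.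
  by field; rewrite natfact_neq0.
rewrite lerDl mulr_ge0 ?ler0n//; apply: sumr_ge0 => i _.
by rewrite mulr_ge0 ?dmon_ge0// mulr_ge0 ?invr_ge0// exprn_ge0// ltW.
Qed.

(** The polynomial in [t] with values [dmon a j (z + v * t)]. *)
Definition pmon (a j : nat) z v : {poly K} :=
  \poly_(c < j.+1) (dmon (a + c) j z * (v ^+ c / c`!%:R)).

Lemma coef_pmon a j z v c : (pmon a j z v)`_c = dmon (a + c) j z * (v ^+ c / c`!%:R).
Proof.
rewrite coef_poly; case: ltnP => // h.
by rewrite /dmon ffact_small ?mulr0 ?mul0r// ltn_addl.
Qed.

Lemma norm_coef_pmon a j z v c : `|(pmon a j z v)`_c| = (pmon a j `|z| `|v|)`_c.
Proof.
by rewrite !coef_pmon [LHS]normrM norm_dmon [X in _ * X]normrM normrX normfV normr_nat.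
Qed.

Lemma horner_pmon a j z v t : (pmon a j z v).[t] = dmon a j (z + v * t).
Proof.
rewrite horner_poly dmonD; apply: eq_bigr => c _.
by rewrite exprMn; ring.
Qed.

(** Beyond degree [n], the ratio of [|e| ^ i] to [T ^ i] is at most [(|e| / T) ^ n]. Applied to
    partial sums of a series, the bound does not depend on their length and survives in the limit. *)
Lemma tail_le (p q : {poly K}) (e T : K) n :
  (forall i, `|p`_i| <= q`_i) -> `|e| <= T ->
  `|p.[e] - \sum_(i < n) p`_i * e ^+ i| * T ^+ n <= q.[T] * `|e| ^+ n.
Proof.
move=> pq eT; have T0 := le_trans (normr_ge0 e) eT.
have q0 i : 0 <= q`_i by rewrite (le_trans _ (pq i)).
pose m := (maxn (size p) (size q) + n)%N.
have E (s : {poly K}) x : (size s <= m)%N -> s.[x] = \sum_(i < m) s`_i * x ^+ i.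
  move=> sm; rewrite horner_coef (big_ord_widen m (fun i => s`_i * x ^+ i))// big_mkcond.
  by apply: eq_bigr => i _; case: ltnP => // h; rewrite nth_default ?mul0r.
have nm : (n <= m)%N by rewrite /m leq_addl.
have -> : p.[e] - \sum_(i < n) p`_i * e ^+ i
        = \sum_(i < m) (if (i < n)%N then 0 else p`_i * e ^+ i).
  rewrite E; last by rewrite /m; lia.
  apply/eqP; rewrite subr_eq; apply/eqP.
  have -> : \sum_(i < n) p`_i * e ^+ i
      = \sum_(i < m) (if (i < n)%N then p`_i * e ^+ i else 0).
    by rewrite (big_ord_widen m (fun i => p`_i * e ^+ i))// big_mkcond.
  rewrite -big_split; apply: eq_bigr => i _ /=.
  by case: ltnP; rewrite ?add0r ?addr0.
rewrite [q.[T]]E; last by rewrite /m; lia.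
apply: le_trans (_ : (\sum_(i < m) (if (i < n)%N then 0 else q`_i * `|e| ^+ i)) * T ^+ n <= _).
  rewrite ler_wpM2r ?exprn_ge0// (le_trans (ler_norm_sum _ _ _))// ler_sum// => i _.
  case: ifP => _; first by rewrite normr0.
  by rewrite normrM normrX ler_wpM2r ?exprn_ge0.
rewrite !mulr_suml ler_sum// => i _; case: ltnP => h.
  by rewrite mul0r !mulr_ge0 ?exprn_ge0.
rewrite -!mulrA ler_wpM2l// -(subnK h) !exprD -!mulrA [T ^+ n * `|e| ^+ n]mulrC.
by rewrite ler_wpM2r ?mulr_ge0 ?exprn_ge0// lerXn2r ?nnegrE.
Qed.

End Dmon.

(** * Taylor expansion of double power series *)
(** Completeness of the field, in the form in which double series use it. Keeping it as a
    property of an abstract field lets the estimates be proved away from the concrete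
    construction of the complex numbers. *)
Definition square_summable_cvg (K : numFieldType) := forall (t : nat -> nat -> K) (B : K),
  (forall n, \sum_(j < n) \sum_(k < n) `|t j k| <= B) ->
  exists l : K, \sum_(j < n) \sum_(k < n) t j k @[n --> \oo] --> l.

Section Taylor.
Variable C : numFieldType.
Variable G : nat -> nat -> C.

Definition psum (a b : nat) (z : C * C) (n : nat) : C :=
  \sum_(j < n) \sum_(k < n) G j k * (dmon a j z.1 * dmon b k z.2).

(** The derivative [d^(a+b) f / dx^a dy^b], obtained by differentiating termwise the series with
    coefficients [G]. It is a definition by a limit, meaningful inside the polydisk of convergence. *)
Definition dfn (a b : nat) (z : C * C) : C := lim (psum a b z n @[n --> \oo]).

(** The series converges absolutely on each closed bidisk of radius less than [r]. *)
Definition abs_bounded (r : C) := forall x : C, 0 <= x -> x < r ->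
  exists B : C, forall n,
    \sum_(j < n) \sum_(k < n) `|G j k| * (dmon 0 j x * dmon 0 k x) <= B.

(** [dmon_bound] with [w] half of the distance from [x] to [r]. *)
Lemma dbound r a b x : abs_bounded r -> 0 <= x -> x < r ->
  exists2 B : C, 0 <= B & forall n,
    \sum_(j < n) \sum_(k < n) `|G j k| * (dmon a j x * dmon b k x) <= B.
Proof.
move=> Gr x0 xr; pose w := (r - x) / 2.
have w0 : 0 < w by rewrite divr_gt0// subr_gt0.
have xw0 : 0 <= x + w by rewrite addr_ge0// ltW.
have xwr : x + w < r.
  have -> : r = x + w + w by rewrite /w; field.
  by rewrite ltrDl.
have [B GB] := Gr _ xw0 xwr.
pose A c : C := c`!%:R / w ^+ c.
have A0 c : 0 <= A c by rewrite /A divr_ge0 ?ler0n// exprn_ge0// ltW.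
have B0 : 0 <= B by have := GB 0%N; rewrite big_ord0.
have AB0 : 0 <= A a * A b := mulr_ge0 (A0 a) (A0 b).
exists (A a * A b * B); first exact: mulr_ge0.
move=> n; apply: le_trans (ler_wpM2l AB0 (GB n)).
rewrite mulr_sumr ler_sum// => j _; rewrite mulr_sumr ler_sum// => k _.
rewrite [leRHS]mulrCA ler_wpM2l// [leRHS]mulrACA ler_pM ?dmon_ge0//; exact: dmon_bound.
Qed.

Lemma psum_norm a b z x n : `|z.1| <= x -> `|z.2| <= x ->
  \sum_(j < n) \sum_(k < n) `|G j k * (dmon a j z.1 * dmon b k z.2)|
  <= \sum_(j < n) \sum_(k < n) `|G j k| * (dmon a j x * dmon b k x).
Proof.
move=> z1 z2; apply: ler_sum => j _; apply: ler_sum => k _.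
rewrite normrM ler_wpM2l// normrM !norm_dmon ler_pM ?dmon_ge0//; exact: dmon_le.
Qed.

Lemma dfn_cvg r a b z : square_summable_cvg C -> abs_bounded r -> `|z.1| < r -> `|z.2| < r ->
  psum a b z n @[n --> \oo] --> dfn a b z.
Proof.
move=> Cc Gr z1 z2.
have [x [z1x z2x xr]] : exists x : C, [/\ `|z.1| <= x, `|z.2| <= x & x < r].
  have [h|h] := real_leP (normr_real z.1) (normr_real z.2).
    by exists `|z.2|.
  by exists `|z.1|; split=> //; exact: ltW.
have x0 : 0 <= x by rewrite (le_trans _ z1x).
have [B B0 GB] := dbound a b Gr x0 xr.
have [l ul] := Cc (fun j k => G j k * (dmon a j z.1 * dmon b k z.2)) B
  (fun n => le_trans (psum_norm a b n z1x z2x) (GB n)).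
by rewrite /dfn; apply: cvgP ul.
Qed.

(** The homogeneous part of degree [i] in [h] of the Taylor expansion at [z]. *)
Definition dcoef (a b i : nat) (h z : C * C) : C :=
  \sum_(c < i.+1) h.1 ^+ c / c`!%:R * (h.2 ^+ (i - c) / (i - c)`!%:R)
    * dfn (a + c) (b + (i - c)) z.

(** For partial sums, restricted to the line through [z] in the direction [h / e], this is
    [tail_le]: the coefficients of a partial sum are dominated by those of the same sum with
    absolute values, and the latter is bounded at [T]. The constant [B] is uniform in [z], [h],
    [e] and [T], so that [h] may move along any curve. *)
Theorem taylor r x a b n : square_summable_cvg C -> abs_bounded r -> 0 <= x -> x < r ->
  exists2 B : C, 0 <= B & forall (z h : C * C) (e T : C),
    0 < e -> e <= T -> `|h.1| <= e -> `|h.2| <= e ->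
    `|z.1| + T <= x -> `|z.2| + T <= x ->
    `|dfn a b (z + h) - \sum_(i < n) dcoef a b i h z| * T ^+ n <= B * e ^+ n.
Proof.
move=> Cc Gr x0 xr; have [B B0 GB] := dbound a b Gr x0 xr; exists B => //.
move=> z h e T e0 eT h1 h2 z1 z2.
have T0 : 0 < T by exact: lt_le_trans eT.
have lt_r (y : C) : `|y| + T <= x -> `|y| < r.
  by move=> yx; rewrite (le_lt_trans _ xr)// (le_trans _ yx)// lerDl ltW.
have lt_r' (y k : C) : `|y| + T <= x -> `|k| <= e -> `|y + k| < r.
  move=> yx ke; rewrite (le_lt_trans _ xr)// (le_trans _ yx)//.
  by rewrite (le_trans (ler_normD _ _))// lerD// (le_trans ke).
(* the partial sums along the line, and their majorants *)
pose p N : {poly C} := \sum_(j < N) \sum_(k < N)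
  G j k *: (pmon a j z.1 (h.1 / e) * pmon b k z.2 (h.2 / e)).
pose q N : {poly C} := \sum_(j < N) \sum_(k < N)
  `|G j k| *: (pmon a j `|z.1| `|h.1 / e| * pmon b k `|z.2| `|h.2 / e|).
have pq N i : `|(p N)`_i| <= (q N)`_i.
  rewrite !coef_sum (le_trans (ler_norm_sum _ _ _))// ler_sum// => j _.
  rewrite !coef_sum (le_trans (ler_norm_sum _ _ _))// ler_sum// => k _.
  rewrite !coefZ normrM ler_wpM2l// !coefM (le_trans (ler_norm_sum _ _ _))//.
  apply: ler_sum => l _.
  by rewrite normrM !norm_coef_pmon.
have pE N : (p N).[e] = psum a b (z + h) N.
  rewrite /p /psum horner_sum; apply: eq_bigr => j _.
  rewrite horner_sum; apply: eq_bigr => k _.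
  by rewrite hornerZ hornerM !horner_pmon !divfK// gt_eqF.
have qT N : (q N).[T] <= B.
  apply: le_trans (GB N).
  rewrite /q horner_sum ler_sum// => j _; rewrite horner_sum ler_sum// => k _.
  rewrite hornerZ hornerM !horner_pmon ler_wpM2l//.
  have le1 (y : C) : `|y| <= e -> `|y / e| * T <= T.
    by move=> ye; rewrite ger_pMl// normrM normfV (gtr0_norm e0) ler_pdivrMr// mul1r.
  have ge0 (y u : C) : 0 <= `|y| + `|u / e| * T by rewrite addr_ge0// mulr_ge0// ltW.
  apply: ler_pM; rewrite ?dmon_ge0//.
    by apply: dmon_le => //; rewrite (le_trans _ z1)// lerD2l le1.
  by apply: dmon_le => //; rewrite (le_trans _ z2)// lerD2l le1.
have pc N i : (p N)`_i * e ^+ i = \sum_(c < i.+1) h.1 ^+ c / c`!%:R *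
   (h.2 ^+ (i - c) / (i - c)`!%:R) * psum (a + c) (b + (i - c)) z N.
  under eq_bigr => c _ do rewrite /psum mulr_sumr.
  rewrite exchange_big coef_sum mulr_suml; apply: eq_bigr => j _.
  under eq_bigr => c _ do rewrite mulr_sumr.
  rewrite exchange_big coef_sum mulr_suml; apply: eq_bigr => k _.
  rewrite coefZ coefM mulr_sumr mulr_suml; apply: eq_bigr => c _.
  rewrite !coef_pmon !exprMn !exprVn.
  have -> : e ^+ i = e ^+ c * e ^+ (i - c) by rewrite -exprD subnKC// -ltnS.
  field; rewrite !natfact_neq0 !expf_neq0 ?gt_eqF//.
have Tn0 : 0 <= T ^+ n by rewrite exprn_ge0// ltW.
rewrite -[T ^+ n]ger0_norm// -normrM.
apply: (@cvg_norm_le _ (fun N => (psum a b (z + h) N - \sum_(i < n) (p N)`_i * e ^+ i) * T ^+ n)).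
  apply: cvgMl; apply: cvgB.
    by apply: dfn_cvg Cc Gr _ _; apply: lt_r'.
  apply: (@cvg_sum_ord _ _ (fun i N => (p N)`_i * e ^+ i) (fun i => dcoef a b i h z)) => i.
  rewrite (funext (pc^~ i)); apply: (@cvg_sum_ord _ _
    (fun c N => h.1 ^+ c / c`!%:R * (h.2 ^+ (i - c) / (i - c)`!%:R) *
                psum (a + c) (b + (i - c)) z N)
    (fun c => h.1 ^+ c / c`!%:R * (h.2 ^+ (i - c) / (i - c)`!%:R) *
              dfn (a + c) (b + (i - c)) z)) => c.
  by apply: cvgMr; apply: dfn_cvg Cc Gr _ _; exact: lt_r.
move=> N; rewrite normrM (ger0_norm Tn0) -pE.
have eT' : `|e| <= T by rewrite gtr0_norm.
apply: le_trans (tail_le n (pq N) eT') _.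
by rewrite (gtr0_norm e0) ler_wpM2r// exprn_ge0// ltW.
Qed.

Lemma dfn_at0 a b : dfn a b 0 = G a b.
Proof.
apply: cvg_lim => //; apply: cvg_near_cst.
near=> n.
have an : (a < n)%N by near: n; exact: nbhs_infty_gt.
have bn : (b < n)%N by near: n; exact: nbhs_infty_gt.
rewrite /psum (bigD1 (Ordinal an)) //= [X in _ + X]big1 ?addr0; last first.
  move=> j /negPf ja; apply: big1 => k _.
  by rewrite dmon_at0; move: ja; rewrite -val_eqE /= => ->; rewrite mul0r mulr0.
rewrite (bigD1 (Ordinal bn)) //= [X in _ + X]big1 ?addr0; last first.
  move=> k /negPf ja.
  by rewrite [dmon b _ _]dmon_at0; move: ja; rewrite -val_eqE /= => ->; rewrite !mulr0.
by rewrite !dmon_at0 !eqxx !mulr1.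
Unshelve. all: by end_near. Qed.

End Taylor.

(** * Expansions along curves, and contact with a quadric *)
Section Curves.
Variable C : numFieldType.
Variable G : nat -> nat -> C.
Hypothesis Ccomplete : square_summable_cvg C.

(** [taylor] with [e] a multiple of [|t|]. *)
Lemma taylor_curve r a b n (z : C * C) (X Y : C -> C) : abs_bounded G r ->
  `|z.1| < r -> `|z.2| < r -> ord_ge 1 X -> ord_ge 1 Y ->
  ord_ge n (fun t => dfn G a b (z + (X t, Y t))
                   - \sum_(i < n) dcoef G a b i (X t, Y t) z).
Proof.
move=> Gr z1 z2 [B B0 BX] [D D0 DY].
have [x [z1x z2x xr]] : exists x : C, [/\ `|z.1| < x, `|z.2| < x & x < r].
  have mid (m : C) : m < r -> m < (m + r) / 2 < r.
    by move=> mr; rewrite midf_lt// midf_lt.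
  have [h|h] := real_leP (normr_real z.1) (normr_real z.2).
    have /andP[m1 m2] := mid _ z2.
    by exists ((`|z.2| + r) / 2); split=> //; exact: le_lt_trans m1.
  have /andP[m1 m2] := mid _ z1.
  by exists ((`|z.1| + r) / 2); split=> //; exact: lt_trans m1.
have x0 : 0 <= x by rewrite (le_trans _ (ltW z1x)).
have [T [T0 Tz1 Tz2]] : exists T : C, [/\ 0 < T, `|z.1| + T <= x & `|z.2| + T <= x].
  have [h|h] := real_leP (normr_real z.1) (normr_real z.2).
    exists (x - `|z.2|); rewrite subr_gt0 z2x; split=> //; rewrite -subr_ge0.
      have -> : x - (`|z.1| + (x - `|z.2|)) = `|z.2| - `|z.1| by ring.
      by rewrite subr_ge0.
    have -> : x - (`|z.2| + (x - `|z.2|)) = 0 by ring.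
    by [].
  exists (x - `|z.1|); rewrite subr_gt0 z1x; split=> //; rewrite -subr_ge0.
    have -> : x - (`|z.1| + (x - `|z.1|)) = 0 by ring.
    by [].
  have -> : x - (`|z.2| + (x - `|z.1|)) = `|z.1| - `|z.2| by ring.
  by rewrite subr_ge0 ltW.
have [A A0 HA] := taylor a b n Ccomplete Gr x0 xr.
pose k := B + D + 1.
have k0 : 0 < k by rewrite /k ltr_wpDl ?addr_ge0.
exists (A * k ^+ n / T ^+ n).
  by rewrite !mulr_ge0 ?invr_ge0 ?exprn_ge0// ltW.
near=> t.
have t0 : 0 < `|t| by rewrite normr_gt0; near: t; exact: nbhs_dnbhs_neq.
rewrite [leRHS]mulrAC -[X in _ <= X / _]mulrA -exprMn ler_pdivlMr ?exprn_gt0//.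
apply: HA => //.
- by rewrite mulr_gt0.
- near: t; apply: nbhs_dnbhs; apply/nbhs_ballP; exists (T / k) => /=; first by rewrite divr_gt0.
  by move=> t; rewrite /ball /= sub0r normrN => tT; rewrite -ler_pdivlMl// mulrC ltW.
- apply: le_trans (_ : B * `|t| <= _); first by rewrite -[`|t|]expr1; near: t.
  by rewrite ler_wpM2r// /k -addrA lerDl addr_ge0.
- apply: le_trans (_ : D * `|t| <= _); first by rewrite -[`|t|]expr1; near: t.
  by rewrite ler_wpM2r// /k addrAC lerDr addr_ge0.
Unshelve. all: by end_near. Qed.

End Curves.

Section Lines.
Variable C : numFieldType.

(** The coefficient of [t ^ i] in the restriction of a double series to the line [(t, t * y)]. *)
Definition line_coef (F : nat -> nat -> C) (y : C) (i : nat) : C :=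
  \sum_(c < i.+1) y ^+ (i - c) / (c`!%:R * (i - c)`!%:R) * F c (i - c)%N.

Definition shiftc (a b : nat) (F : nat -> nat -> C) (c d : nat) := F (a + c)%N (b + d)%N.

Lemma ord_ge_id_mul (y : C) : ord_ge 1 (fun t => t * y).
Proof. by apply: ord_ge_ext (ord_geMl y (ord_ge_pow C 1)) => t; rewrite expr1 mulrC. Qed.

Lemma ord_ge_id : ord_ge 1 (fun t : C => t).
Proof. by apply: ord_ge_ext (ord_ge_id_mul 1) => t; rewrite mulr1. Qed.

Lemma taylor_line G r a b (z : C * C) (y : C) : square_summable_cvg C ->
  abs_bounded G r -> `|z.1| < r -> `|z.2| < r ->
  expands (fun t => dfn G a b (z + (t, t * y)))
          (line_coef (shiftc a b (fun a b => dfn G a b z)) y).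
Proof.
move=> Cc Gr z1 z2 n.
apply: ord_ge_ext (taylor_curve Cc a b n Gr z1 z2 ord_ge_id (ord_ge_id_mul y)) => t.
congr (_ - _); apply: eq_bigr => i _; rewrite /dcoef /line_coef mulr_suml.
apply: eq_bigr => c _ /=; rewrite exprMn.
have -> : t ^+ i = t ^+ c * t ^+ (i - c) by rewrite -exprD subnKC// -ltnS.
rewrite /shiftc; field; rewrite !natfact_neq0//.
Qed.

(** Evaluation at 0, 1, -1 and 2. *)
Lemma cubic_eq0 (a b c d : C) :
  (forall y, a + b * y + c * y ^+ 2 + d * y ^+ 3 = 0) -> [/\ a = 0, b = 0, c = 0 & d = 0].
Proof.
move=> H.
have a0 : a = 0 by rewrite -[RHS](H 0); ring.
have h2 : 2 * c = 0 by transitivity ((a + b * 1 + c * 1 ^+ 2 + d * 1 ^+ 3)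
  + (a + b * (-1) + c * (-1) ^+ 2 + d * (-1) ^+ 3) - 2 * a); [ring|rewrite !H a0; ring].
have c0 : c = 0 by apply/eqP; move/eqP: h2; rewrite mulf_eq0 pnatr_eq0.
have h6 : 6 * d = 0 by transitivity ((a + b * 2 + c * 2 ^+ 2 + d * 2 ^+ 3)
  - 2 * (a + b * 1 + c * 1 ^+ 2 + d * 1 ^+ 3) + a - 2 * c); [ring|rewrite !H a0 c0; ring].
have d0 : d = 0 by apply/eqP; move/eqP: h6; rewrite mulf_eq0 pnatr_eq0.
by split=> //; rewrite -[RHS](H 1) a0 c0 d0; ring.
Qed.

(** Here [d t] is the increment of a function along [(t, t * y)] and [M] the linear part of an
    affine map that sends its graph to [u = x y] up to order 4. The coefficients of [t], [t ^ 2]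
    and [t ^ 3] in that relation vanish for all [y], and so do their coefficients in [y]. At third
    order the cubic form is the product of the quadratic form by the linear form [(r, s) / k]. *)
Lemma contact (M : 'M[C]_3) (F : nat -> nat -> C) : M \in unitmx ->
  (forall y, exists2 d : C -> C,
     ord_ge 4 (fun t => d t - \sum_(i < 4) line_coef F y i * t ^+ i + F 0%N 0%N)
   & ord_ge 4 (fun t => (M iu ix * t + M iu iy * (t * y) + M iu iu * d t)
       - (M ix ix * t + M ix iy * (t * y) + M ix iu * d t)
         * (M iy ix * t + M iy iy * (t * y) + M iy iu * d t))) ->
  let k := M iu iu in
  let p1 := M ix ix + M ix iu * F 1%N 0%N in let q1 := M ix iy + M ix iu * F 0%N 1%N in
  let p2 := M iy ix + M iy iu * F 1%N 0%N in let q2 := M iy iy + M iy iu * F 0%N 1%N in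
  let r := M iy iu * p1 + M ix iu * p2 in
  let s := M iy iu * q1 + M ix iu * q2 in
  [/\ [/\ k != 0, M iu ix = - k * F 1%N 0%N & M iu iy = - k * F 0%N 1%N],
      [/\ k * F 2%N 0%N = 2 * p1 * p2, k * F 1%N 1%N = p1 * q2 + p2 * q1 & k * F 0%N 2%N = 2 * q1 * q2],
      k * F 3%N 0%N = 3 * r * F 2%N 0%N /\ k * F 2%N 1%N = 2 * r * F 1%N 1%N + s * F 2%N 0%N
    & k * F 1%N 2%N = r * F 0%N 2%N + 2 * s * F 1%N 1%N /\ k * F 0%N 3%N = 3 * s * F 0%N 2%N].
Proof.
move=> uM H k p1 q1 p2 q2 r s.
pose d1 y := F 1%N 0%N + F 0%N 1%N * y.
pose d2 y := F 2%N 0%N / 2 + F 1%N 1%N * y + F 0%N 2%N / 2 * y ^+ 2.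
pose d3 y := F 3%N 0%N / 6 + F 2%N 1%N / 2 * y + F 1%N 2%N / 2 * y ^+ 2 + F 0%N 3%N / 6 * y ^+ 3.
pose c1 y := M iu ix + M iu iy * y + k * d1 y.
pose c2 y := k * d2 y - (p1 + q1 * y) * (p2 + q2 * y).
pose c3 y := k * d3 y - d2 y * (r + s * y).
have cs y : [/\ c1 y = 0, c2 y = 0 & c3 y = 0].
  have [d dO HO] := H y.
  pose D t := d1 y * t + d2 y * t ^+ 2 + d3 y * t ^+ 3.
  pose e t := d t - D t.
  have eO : ord_ge 4 e.
    apply: ord_ge_ext dO => t; rewrite /e /D !big_ord_recl big_ord0 /bump /=.
    rewrite /line_coef !big_ord_recl !big_ord0 /bump /=.
    rewrite !factS fact0 !subnn ?subn0 ?subSS ?subn0 /d1 /d2 /d3.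
    by field.
  pose xt t := (M ix ix + M ix iy * y) * t + M ix iu * D t.
  pose yt t := (M iy ix + M iy iy * y) * t + M iy iu * D t.
  pose x1 := M ix iu; pose y1 := M iy iu.
  pose ct (i : nat) := [:: 0; c1 y; c2 y; c3 y]`_i.
  suff O4 : ord_ge 4 (fun t => \sum_(i < 4) ct i * t ^+ i).
    by have c0 := ord_ge_poly_eq0 O4; split; [apply: (c0 1%N)|apply: (c0 2%N)|apply: (c0 3%N)].
  have O1 : ord_ge 4 (fun t => e t * (k - x1 * yt t - y1 * xt t - x1 * y1 * e t)).
    rewrite -[4%N]addn0; apply: ord_geM => //.
    have Ot : ord_ge 0 (fun t : C => t) by exact: ord_ge_leq ord_ge_id.
    have Op i : ord_ge 0 (fun t : C => t ^+ i) by exact: ord_ge_leq (ord_ge_pow C i).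
    have OD : ord_ge 0 D by apply: ord_geD; [apply: ord_geD|]; apply: ord_geMl.
    have Ox : ord_ge 0 xt by apply: ord_geD; apply: ord_geMl.
    have Oy : ord_ge 0 yt by apply: ord_geD; apply: ord_geMl.
    apply: ord_geB; [apply: ord_geB; [apply: ord_geB|]|].
    - exact: ord_ge_cst.
    - exact: ord_geMl.
    - exact: ord_geMl.
    - by apply: ord_geMl; apply: ord_ge_leq eO.
  pose X1 := p1 + q1 * y; pose Y1 := p2 + q2 * y.
  pose X2 := x1 * d2 y; pose Y2 := y1 * d2 y.
  pose X3 := x1 * d3 y; pose Y3 := y1 * d3 y.
  (* the terms of degree at least 4 in the product of the two polynomials *)
  have O2 : ord_ge 4 (fun t => t ^+ 4 * (X1 * Y3 + X2 * Y2 + X3 * Y1)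
      + (t ^+ 5 * (X2 * Y3 + X3 * Y2) + t ^+ 6 * (X3 * Y3))).
    have Op i c : (4 <= i)%N -> ord_ge 4 (fun t : C => t ^+ i * c).
      move=> i4; apply: ord_ge_leq i4 _.
      by apply: ord_ge_ext (ord_geMl c (ord_ge_pow C i)) => t; rewrite mulrC.
    by apply: ord_geD; [|apply: ord_geD]; apply: Op.
  apply: ord_ge_ext (ord_geD (ord_geB HO O1) O2) => t.
  rewrite !big_ord_recl big_ord0 /ct /= /bump /=.
  rewrite /X1 /Y1 /X2 /Y2 /X3 /Y3 /c1 /c2 /c3 /xt /yt /e /D /x1 /y1 /r /s /p1 /p2 /q1 /q2 /k /d1.
  by rewrite !(addn0, add1n); ring.
have [c1a c1b _ _] : [/\ M iu ix + k * F 1%N 0%N = 0, M iu iy + k * F 0%N 1%N = 0, (0 : C) = 0 & (0 : C) = 0].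
  by apply: cubic_eq0 => y; have [H1 _ _] := cs y; rewrite -[RHS]H1 /c1 /d1; ring.
have E1 : M iu ix = - k * F 1%N 0%N by apply/eqP; rewrite mulNr -addr_eq0 c1a.
have E2 : M iu iy = - k * F 0%N 1%N by apply/eqP; rewrite mulNr -addr_eq0 c1b.
have k0 : k != 0.
  apply/eqP => k0; have /matrixP /(_ iu iu) := mulmxV uM.
  rewrite !mxE (bigD1 ix) //= (bigD1 iy) //= (bigD1 iu) //= big1 ?addr0; last first.
    by move=> [[|[|[|]]] //].
  rewrite E1 E2 -/k k0 ?eqxx oppr0 !mul0r !addr0.
  by move=> /eqP; rewrite eq_sym oner_eq0.
have [c2a c2b c2c _] : [/\ k * F 2%N 0%N / 2 - p1 * p2 = 0, k * F 1%N 1%N - (p1 * q2 + p2 * q1) = 0,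
    k * F 0%N 2%N / 2 - q1 * q2 = 0 & (0 : C) = 0].
  by apply: cubic_eq0 => y; have [_ H1 _] := cs y; rewrite -[RHS]H1 /c2 /d2; ring.
have [c3a c3b c3c c3d] : [/\ k * F 3%N 0%N / 6 - r * F 2%N 0%N / 2 = 0,
    k * F 2%N 1%N / 2 - (r * F 1%N 1%N + s * F 2%N 0%N / 2) = 0,
    k * F 1%N 2%N / 2 - (r * F 0%N 2%N / 2 + s * F 1%N 1%N) = 0 & k * F 0%N 3%N / 6 - s * F 0%N 2%N / 2 = 0].
  by apply: cubic_eq0 => y; have [_ _ H1] := cs y; rewrite -[RHS]H1 /c3 /d2 /d3; field.
have mul (u v n : C) : n * (u - v) = 0 -> n != 0 -> u = v.
  by move=> /eqP; rewrite mulf_eq0 => /orP[/eqP->|]; rewrite ?eqxx// subr_eq0 => /eqP.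
split; split=> //; apply/eqP; rewrite -subr_eq0; apply/eqP.
- by transitivity (2 * 0 : C); [rewrite -c2a; field|rewrite mulr0].
- exact: c2b.
- by transitivity (2 * 0 : C); [rewrite -c2c; field|rewrite mulr0].
- by transitivity (6 * 0 : C); [rewrite -c3a; field|rewrite mulr0].
- by transitivity (2 * 0 : C); [rewrite -c3b; field|rewrite mulr0].
- by transitivity (2 * 0 : C); [rewrite -c3c; field|rewrite mulr0].
- by transitivity (6 * 0 : C); [rewrite -c3d; field|rewrite mulr0].
Qed.

End Lines.

(** * The third-order equations and their formal solutions *)
Section Uniqueness.
Variable C : numFieldType.
Implicit Types (g h : C -> C) (s : nat -> C) (G : nat -> nat -> C).

(** The result of eliminating the linear form [(r, s)] from the relations
    [F_xxx = 3 r F_xx], [F_xxy = 2 r F_xy + s F_xx], [F_xyy = r F_yy + 2 s F_xy] and [F_yyy = 3 s F_yy]. *)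
Definition apolar_pde (P : nat -> nat -> C) : Prop :=
  (4 * P 1%N 1%N ^+ 2 - P 2%N 0%N * P 0%N 2%N) * P 3%N 0%N
    = 3 * P 2%N 0%N * (2 * P 1%N 1%N * P 2%N 1%N - P 2%N 0%N * P 1%N 2%N) /\
  (4 * P 1%N 1%N ^+ 2 - P 2%N 0%N * P 0%N 2%N) * P 0%N 3%N
    = 3 * P 0%N 2%N * (2 * P 1%N 1%N * P 1%N 2%N - P 0%N 2%N * P 2%N 1%N).

(** A formal condition on [G], stated through functions [P a b] that have the derived series as
    expansions along the lines [(t, t * y)]. *)
Definition solves_pde G := forall y, exists2 P : nat -> nat -> C -> C,
  forall a b, expands (P a b) (line_coef (shiftc a b G) y)
  & \forall t \near 0^', apolar_pde (fun a b => P a b t).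

Lemma expands_bounded g s : expands g s -> ord_ge 0 g.
Proof.
by move=> /(_ 0); apply: ord_ge_ext => t; rewrite big_ord0 subr0.
Qed.

Lemma expands_sub_head g s : expands g s -> ord_ge 1 (fun t => g t - s 0).
Proof.
by move=> /(_ 1); apply: ord_ge_ext => t; rewrite big_ord1 expr0 mulr1.
Qed.

Lemma expands_sub n g h s s' : expands g s -> expands h s' ->
  (forall i, (i < n)%N -> s i = s' i) <-> ord_ge n (fun t => g t - h t).
Proof.
move=> gs hs; split=> [ss|gh i im].
  apply: ord_ge_ext (ord_geB (gs n) (hs n)) => t.
  under [in X in _ - X]eq_bigr => i _ do rewrite -ss//.
  by ring.
apply/eqP; rewrite -subr_eq0; apply/eqP.
apply: (ord_ge_poly_eq0 (n := n) (s := fun i => s i - s' i)) => //.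
apply: ord_ge_ext (ord_geD (ord_geB (hs n) (gs n)) gh) => t.
transitivity (\sum_(i < n) s i * t ^+ i - \sum_(i < n) s' i * t ^+ i); first by ring.
by rewrite -sumrB; apply: eq_bigr => j _; rewrite mulrBl.
Qed.

(** The equation reads [a = b * (...) / (4 d ^ 2 - b c)], where [b] vanishes at 0 and [d] is 1
    there: two solutions whose second derivatives agree to order [m.+1] and whose third
    derivatives agree to order [m] have values of [a] that agree to one order more. *)
Lemma pde_step m (a b c d e f a' b' c' d' e' f' : C -> C) :
  (\forall t \near 0^', (4 * d t ^+ 2 - b t * c t) * a t
     = 3 * b t * (2 * d t * e t - b t * f t)) ->
  (\forall t \near 0^', (4 * d' t ^+ 2 - b' t * c' t) * a' t
     = 3 * b' t * (2 * d' t * e' t - b' t * f' t)) ->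
  ord_ge 1 b -> ord_ge 1 b' -> ord_ge 1 (fun t => d t - 1) ->
  ord_ge 0 c -> ord_ge 0 d ->
  ord_ge 0 a' -> ord_ge 0 e' -> ord_ge 0 f' ->
  ord_ge m.+1 (fun t => b t - b' t) -> ord_ge m.+1 (fun t => c t - c' t) ->
  ord_ge m.+1 (fun t => d t - d' t) ->
  ord_ge m (fun t => a t - a' t) -> ord_ge m (fun t => e t - e' t) ->
  ord_ge m (fun t => f t - f' t) ->
  ord_ge m.+1 (fun t => a t - a' t).
Proof.
move=> H H' b1 b1' d1 c0 d0 a0 e0 f0 bb cc dd aa ee ff.
have b0 : ord_ge 0 b by exact: ord_ge_leq b1.
have b0' : ord_ge 0 b' by exact: ord_ge_leq b1'.
have d0' : ord_ge 0 d'.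
  have dd0 : ord_ge 0 (fun t => d t - d' t) by exact: ord_ge_leq dd.
  by apply: ord_ge_ext (ord_geB d0 dd0) => t; ring.
have M0 g h : ord_ge 0 g -> ord_ge 0 h -> ord_ge 0 (fun t => g t * h t) := @ord_geM _ 0 0 g h.
have Mm g h : ord_ge m.+1 g -> ord_ge 0 h -> ord_ge m.+1 (fun t => g t * h t).
  by move=> g1 h0; rewrite -[m.+1]addn0; exact: ord_geM.
have M1 g h : ord_ge 1 g -> ord_ge m h -> ord_ge m.+1 (fun t => g t * h t) := @ord_geM _ 1 m g h.
have N1 g h : ord_ge 1 g -> ord_ge 0 h -> ord_ge 1 (fun t => g t * h t) := @ord_geM _ 1 0 g h.
have d2 : ord_ge 1 (fun t => (d t - 1) * (d t + 1)).
  by apply: N1 => //; apply: ord_geD => //; exact: ord_ge_cst.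
(* four times the difference of the solutions, modulo the two equations *)
pose I t := - (4 * ((d t - 1) * (d t + 1) * (a t - a' t)))
  - 4 * ((d t - d' t) * ((d t + d' t) * a' t))
  + b t * c t * (a t - a' t) + (b t - b' t) * (c t * a' t) + (c t - c' t) * (b' t * a' t)
  + 6 * (b t * d t * (e t - e' t)) + 6 * ((b t - b' t) * (d t * e' t))
  + 6 * ((d t - d' t) * (b' t * e' t))
  - 3 * (b t * b t * (f t - f' t)) - 3 * ((b t - b' t) * ((b t + b' t) * f' t)).
have OI : ord_ge m.+1 I.
  by repeat (apply: ord_geB || apply: ord_geD || apply: ord_geN || apply: ord_geMl);
    first [apply: M1 => //; exact: N1 | apply: Mm => //; apply: M0 => //; exact: ord_geD].
apply: ord_ge_near (ord_geMl (4^-1) OI).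
near=> t.
have h : (4 * d t ^+ 2 - b t * c t) * a t = 3 * b t * (2 * d t * e t - b t * f t).
  by near: t.
have h' : (4 * d' t ^+ 2 - b' t * c' t) * a' t
    = 3 * b' t * (2 * d' t * e' t - b' t * f' t) by near: t.
have -> : I t = 4 * (a t - a' t)
   - ((4 * d t ^+ 2 - b t * c t) * a t - 3 * b t * (2 * d t * e t - b t * f t))
   + ((4 * d' t ^+ 2 - b' t * c' t) * a' t - 3 * b' t * (2 * d' t * e' t - b' t * f' t)).
  by rewrite /I; ring.
by rewrite h h' !subrr; field.
Unshelve. all: by end_near. Qed.

Lemma line_coef_eq (n i : nat) (F F' : nat -> nat -> C) y :
  (forall j k, (j + k < n)%N -> F j k = F' j k) -> (i < n)%N ->
  line_coef F y i = line_coef F' y i.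
Proof.
move=> FF' ni; apply: eq_bigr => c _; rewrite FF'// subnKC//.
by rewrite -ltnS.
Qed.

Lemma line_coef0 (F : nat -> nat -> C) y : line_coef F y 0 = F 0%N 0%N.
Proof. by rewrite /line_coef big_ord1 expr0 mulr1 invr1 !mul1r. Qed.

(** A polynomial in [y] that vanishes identically has zero coefficients. *)
Lemma line_coef_inj m (F F' : nat -> nat -> C) :
  (forall y, line_coef F y m = line_coef F' y m) ->
  forall j k, (j + k)%N = m -> F j k = F' j k.
Proof.
move=> H.
pose w d := (F (m - d)%N d - F' (m - d)%N d) / ((m - d)`!%:R * d`!%:R).
have Hw y : \sum_(d < m.+1) w d * y ^+ d = 0.
  have := H y; move/eqP; rewrite -subr_eq0 /line_coef -sumrB => /eqP Hy.
  rewrite -[RHS]Hy (reindex_inj rev_ord_inj) /=; apply: eq_bigr => c _.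
  have cm : (c <= m)%N by rewrite -ltnS.
  rewrite /w /= subSS subKn//.
  by field; rewrite !natfact_neq0.
have w0 d : (d < m.+1)%N -> w d = 0.
  move=> dm; apply: (ord_ge_poly_eq0 (n := m.+1)) => //.
  by apply: ord_ge_ext (@ord_ge0 C m.+1) => y; rewrite Hw.
move=> j k jk; have km : (k < m.+1)%N by rewrite -jk ltnS leq_addl.
have := w0 k km; rewrite /w -jk addnK => /eqP.
rewrite mulf_eq0 invr_eq0 mulf_eq0 !(negPf (natfact_neq0 _ _)) orbF orbF subr_eq0.
by move=> /eqP.
Qed.

(** The equations give the coefficients of [x ^ j y ^ k] with [j >= 3] or [k >= 3] in terms of
    those of smaller total degree, by [pde_step]; so the nine with [j, k <= 2] determine all. *)
Theorem solves_pde_uniq G G' : solves_pde G -> solves_pde G' ->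
  (forall j k, (j <= 2)%N -> (k <= 2)%N -> G j k = G' j k) ->
  G 2%N 0%N = 0 -> G 0%N 2%N = 0 -> G 1%N 1%N = 1 -> forall j k, G j k = G' j k.
Proof.
move=> SG SG' low G20 G02 G11.
suff H n j k : (j + k < n)%N -> G j k = G' j k by move=> j k; exact: (H (j + k).+1).
elim: n j k => [//|n IH] j k; rewrite ltnS leq_eqVlt => /orP[/eqP jk|]; last exact: IH.
have eqs a b i y : (i + (a + b) < n)%N ->
    line_coef (shiftc a b G) y i = line_coef (shiftc a b G') y i.
  move=> iab; apply: (@line_coef_eq (n - (a + b))); last lia.
  by move=> u v uv; rewrite /shiftc IH//; lia.
have small a b m g g' y : expands g (line_coef (shiftc a b G) y) ->
    expands g' (line_coef (shiftc a b G') y) -> (m + (a + b) <= n)%N ->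
    ord_ge m (fun t => g t - g' t).
  by move=> gs gs' mn; apply/(expands_sub _ gs gs') => i im; apply: eqs; lia.
have hd a b g y c : expands g (line_coef (shiftc a b G) y) -> G a b = c ->
    ord_ge 1 (fun t => g t - c).
  move=> gs <-; have := expands_sub_head gs.
  by rewrite line_coef0 /shiftc !addn0.
have hd' a b g y c : expands g (line_coef (shiftc a b G') y) -> G' a b = c ->
    ord_ge 1 (fun t => g t - c).
  move=> gs <-; have := expands_sub_head gs.
  by rewrite line_coef0 /shiftc !addn0.
have z1 g : ord_ge 1 (fun t => g t - 0) -> ord_ge 1 g.
  by apply: ord_ge_ext => t; rewrite subr0.
have [j3|j2] := leqP 3 j.
  pose m := (n - 3)%N; have nm : n = m.+3 by rewrite /m; lia.
  have H : forall u v, (u + v)%N = m -> shiftc 3 0 G u v = shiftc 3 0 G' u v.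
    apply: line_coef_inj => y; have [P PG pde] := SG y; have [P' PG' pde'] := SG' y.
    apply: (proj2 (expands_sub m.+1 (PG 3%N 0%N) (PG' 3%N 0%N))) => //.
    apply: (@pde_step m _ (P 2%N 0%N) (P 0%N 2%N) (P 1%N 1%N) (P 2%N 1%N) (P 1%N 2%N)
                        _ (P' 2%N 0%N) (P' 0%N 2%N) (P' 1%N 1%N) (P' 2%N 1%N) (P' 1%N 2%N)).
    - by apply: filterS pde => t [].
    - by apply: filterS pde' => t [].
    - exact/z1/(hd _ _ _ _ _ (PG 2%N 0%N)).
    - by apply/z1/(hd' _ _ _ _ _ (PG' 2%N 0%N)); rewrite -low.
    - exact: (hd _ _ _ _ _ (PG 1%N 1%N)).
    all: try by apply: expands_bounded; first [exact: PG|exact: PG'].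
    - by apply: (small _ _ _ _ _ _ (PG 2%N 0%N) (PG' 2%N 0%N)); lia.
    - by apply: (small _ _ _ _ _ _ (PG 0%N 2%N) (PG' 0%N 2%N)); lia.
    - by apply: (small _ _ _ _ _ _ (PG 1%N 1%N) (PG' 1%N 1%N)); lia.
    - by apply: (small _ _ _ _ _ _ (PG 3%N 0%N) (PG' 3%N 0%N)); lia.
    - by apply: (small _ _ _ _ _ _ (PG 2%N 1%N) (PG' 2%N 1%N)); lia.
    - by apply: (small _ _ _ _ _ _ (PG 1%N 2%N) (PG' 1%N 2%N)); lia.
  have := H (j - 3)%N k; rewrite /shiftc add0n subnKC//; apply; lia.
have [k3|k2] := leqP 3 k; last by apply: low; lia.
pose m := (n - 3)%N; have nm : n = m.+3 by rewrite /m; lia.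
have H : forall u v, (u + v)%N = m -> shiftc 0 3 G u v = shiftc 0 3 G' u v.
  apply: line_coef_inj => y; have [P PG pde] := SG y; have [P' PG' pde'] := SG' y.
  apply: (proj2 (expands_sub m.+1 (PG 0%N 3%N) (PG' 0%N 3%N))) => //.
  apply: (@pde_step m _ (P 0%N 2%N) (P 2%N 0%N) (P 1%N 1%N) (P 1%N 2%N) (P 2%N 1%N)
                      _ (P' 0%N 2%N) (P' 2%N 0%N) (P' 1%N 1%N) (P' 1%N 2%N) (P' 2%N 1%N)).
  - by apply: filterS pde => t [] _; rewrite [P 2%N 0%N t * _]mulrC.
  - by apply: filterS pde' => t [] _; rewrite [P' 2%N 0%N t * _]mulrC.
  - exact/z1/(hd _ _ _ _ _ (PG 0%N 2%N)).
  - by apply/z1/(hd' _ _ _ _ _ (PG' 0%N 2%N)); rewrite -low.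
  - exact: (hd _ _ _ _ _ (PG 1%N 1%N)).
  all: try by apply: expands_bounded; first [exact: PG|exact: PG'].
  - by apply: (small _ _ _ _ _ _ (PG 0%N 2%N) (PG' 0%N 2%N)); lia.
  - by apply: (small _ _ _ _ _ _ (PG 2%N 0%N) (PG' 2%N 0%N)); lia.
  - by apply: (small _ _ _ _ _ _ (PG 1%N 1%N) (PG' 1%N 1%N)); lia.
  - by apply: (small _ _ _ _ _ _ (PG 0%N 3%N) (PG' 0%N 3%N)); lia.
  - by apply: (small _ _ _ _ _ _ (PG 1%N 2%N) (PG' 1%N 2%N)); lia.
  - by apply: (small _ _ _ _ _ _ (PG 2%N 1%N) (PG' 2%N 1%N)); lia.
have := H j (k - 3)%N; rewrite /shiftc add0n subnKC//; apply; lia.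
Qed.

End Uniqueness.

(** * Dilations, and the equations at a point of contact *)
Section Scaling.
Variable C : numFieldType.

Lemma near0_scale (P : C -> Prop) m : m != 0 ->
  (\forall t \near 0^', P t) -> \forall t \near 0^', P (m * t).
Proof.
move=> m0; rewrite /dnbhs /within /= => /nbhs_ballP[e /= e0 He].
have m0' : 0 < `|m| by rewrite normr_gt0.
apply/nbhs_ballP; exists (e / `|m|) => /=; first by rewrite divr_gt0.
move=> t; rewrite /ball /= sub0r normrN => te t0; apply: He; last by rewrite mulf_neq0.
by rewrite /ball /= sub0r normrN normrM mulrC -ltr_pdivlMr.
Qed.

Lemma ord_ge_scale n (g : C -> C) m : m != 0 -> ord_ge n g -> ord_ge n (fun t => g (m * t)).
Proof.
move=> m0 [B B0 Bg]; exists (B * `|m| ^+ n); first by rewrite mulr_ge0// exprn_ge0.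
have := near0_scale m0 Bg; apply: filterS => t.
by rewrite normrM exprMn mulrA.
Qed.

(** The coefficients after the change of variables [(x, y, u) |-> (x / m, y, u / m)]. *)
Definition dilated m (G : nat -> nat -> C) j k := m ^+ j / m * G j k.

(** Both equations are homogeneous for the weight [a - 1] on [P a b]. *)
Lemma solves_pde_dilated m G : m != 0 -> solves_pde G -> solves_pde (dilated m G).
Proof.
move=> m0 SG y; have [P PG pde] := SG (y / m).
exists (fun a b t => m ^+ a / m * P a b (m * t)).
  move=> a b n.
  apply: ord_ge_ext (ord_geMl (m ^+ a / m) (ord_ge_scale m0 (PG a b n))) => t.
  rewrite mulrBr mulr_sumr; congr (_ - _); apply: eq_bigr => i _.
  rewrite /line_coef mulr_suml mulr_sumr mulr_suml; apply: eq_bigr => c _.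
  rewrite /shiftc /dilated exprMn exprVn exprMn.
  have -> : m ^+ i = m ^+ c * m ^+ (i - c) by rewrite -exprD subnKC// -ltnS.
  rewrite exprD; field.
  by rewrite !natfact_neq0 m0 expf_neq0.
have := near0_scale m0 pde; apply: filterS => t [h1 h2].
rewrite /apolar_pde !expr0; split.
  transitivity (m ^+ 2 * ((4 * P 1%N 1%N (m * t) ^+ 2
    - P 2%N 0%N (m * t) * P 0%N 2%N (m * t)) * P 3%N 0%N (m * t))); first by field.
  by rewrite h1; field.
transitivity (m ^- 1 * ((4 * P 1%N 1%N (m * t) ^+ 2
    - P 2%N 0%N (m * t) * P 0%N 2%N (m * t)) * P 0%N 3%N (m * t))); first by field.
by rewrite h2; field.
Qed.

End Scaling.

Section Osculation.
Variable C : numFieldType.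
Hypothesis Cc : square_summable_cvg C.

(** A normal form [G'] without cubic terms is [x y] up to order 4, so [contact] applies to the
    function that an affine map of linear part [M] takes to the function of [G']. *)
Lemma osculation (G G' : nat -> nat -> C) r r' (z : C * C) (M : 'M[C]_3) :
  abs_bounded G r -> `|z.1| < r -> `|z.2| < r ->
  abs_bounded G' r' -> 0 < r' -> M \in unitmx ->
  (forall j k, (j + k <= 3)%N -> G' j k = ((j, k) == (1, 1)%N)%:R) ->
  (forall y, \forall t \near 0^',
     let d := dfn G 0 0 (z + (t, t * y)) - dfn G 0 0 z in
     M iu ix * t + M iu iy * (t * y) + M iu iu * d =
     dfn G' 0 0 (M ix ix * t + M ix iy * (t * y) + M ix iu * d,
                 M iy ix * t + M iy iy * (t * y) + M iy iu * d)) ->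
  let F a b := dfn G a b z in
  let k := M iu iu in
  let p1 := M ix ix + M ix iu * F 1%N 0%N in let q1 := M ix iy + M ix iu * F 0%N 1%N in
  let p2 := M iy ix + M iy iu * F 1%N 0%N in let q2 := M iy iy + M iy iu * F 0%N 1%N in
  let r := M iy iu * p1 + M ix iu * p2 in
  let s := M iy iu * q1 + M ix iu * q2 in
  [/\ [/\ k != 0, M iu ix = - k * F 1%N 0%N & M iu iy = - k * F 0%N 1%N],
      [/\ k * F 2%N 0%N = 2 * p1 * p2, k * F 1%N 1%N = p1 * q2 + p2 * q1 & k * F 0%N 2%N = 2 * q1 * q2],
      k * F 3%N 0%N = 3 * r * F 2%N 0%N /\ k * F 2%N 1%N = 2 * r * F 1%N 1%N + s * F 2%N 0%N
    & k * F 1%N 2%N = r * F 0%N 2%N + 2 * s * F 1%N 1%N /\ k * F 0%N 3%N = 3 * s * F 0%N 2%N].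
Proof.
move=> Gr z1 z2 Gr' r'0 uM G'E H F; apply: contact => // y.
pose d t := dfn G 0 0 (z + (t, t * y)) - dfn G 0 0 z.
have dE n := @taylor_line C G r 0 0 z y Cc Gr z1 z2 n.
exists d.
  apply: ord_ge_ext (dE 4%N) => t; rewrite /d.
  rewrite -[line_coef _ _]/(line_coef F y) -[F 0%N 0%N]/(dfn G 0 0 z).
  by ring.
have d1 : ord_ge 1 d.
  apply: ord_ge_ext (dE 1%N) => t; rewrite /d big_ord1 line_coef0 expr0 mulr1.
  by [].
pose X t := M ix ix * t + M ix iy * (t * y) + M ix iu * d t.
pose Y t := M iy ix * t + M iy iy * (t * y) + M iy iu * d t.
have O1 a b c : ord_ge 1 (fun t => a * t + b * (t * y) + c * d t).
  apply: ord_geD; [apply: ord_geD|]; apply: ord_geMl => //.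
    exact: ord_ge_id.
  exact: ord_ge_id_mul.
have T := @taylor_curve C G' Cc r' 0 0 4 0 X Y Gr'.
have {}T := T _ _ (O1 _ _ _) (O1 _ _ _).
apply: ord_ge_near (T _ _); [|by rewrite normr0..].
near=> t.
have -> : M iu ix * t + M iu iy * (t * y) + M iu iu * d t = dfn G' 0 0 (X t, Y t).
  by near: t; exact: H.
rewrite add0r; congr (_ - _).
rewrite !big_ord_recl big_ord0 /dcoef !big_ord_recl !big_ord0 /= /bump /= !dfn_at0.
rewrite !G'E //=.
rewrite !(addn0, add1n, add0n) ?subn0 ?subnn ?subSS ?subn0 /=.
rewrite !fact0 !factS !fact0.
by rewrite !(mulr0, addr0, add0r, mulr1, muln1, expr1, divr1).
Unshelve. all: by end_near. Qed.

Lemma osculation_pde (F : nat -> nat -> C) k r s : k != 0 ->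
  k * F 3%N 0%N = 3 * r * F 2%N 0%N -> k * F 2%N 1%N = 2 * r * F 1%N 1%N + s * F 2%N 0%N ->
  k * F 1%N 2%N = r * F 0%N 2%N + 2 * s * F 1%N 1%N -> k * F 0%N 3%N = 3 * s * F 0%N 2%N ->
  apolar_pde F.
Proof.
move=> k0 h30 h21 h12 h03.
have E u v : k * u = v -> u = v / k by move=> <-; rewrite mulrC mulKf.
rewrite /apolar_pde (E _ _ h30) (E _ _ h21) (E _ _ h12) (E _ _ h03).
by split; field.
Qed.

End Osculation.

(** * Germs up to affine equivalence *)
Section MatrixTopology.
Variable K : numFieldType.

Lemma cvg_affine n (M : 'M[K]_n) (b p : 'cV[K]_n) :
  M *m w + b @[w --> p] --> M *m p + b.
Proof.
apply/(cvg_ballP (FF := nbhs_filter p)) => e e0.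
pose S := 1 + \sum_i \sum_j `|M i j|.
have S0 : 0 < S by rewrite ltr_pwDl// sumr_ge0// => i _; rewrite sumr_ge0.
apply/nbhs_ballP; exists (e / S) => /=; first by rewrite divr_gt0.
move=> w [_ pw]; split=> // i j; rewrite /ball /=.
have -> : (M *m p + b) i j - (M *m w + b) i j = \sum_k M i k * (p k j - w k j).
  rewrite !mxE opprD addrACA subrr addr0 -sumrB.
  by apply: eq_bigr => k _; rewrite mulrBr.
rewrite (le_lt_trans (ler_norm_sum _ _ _))//.
apply: (@le_lt_trans _ _ (\sum_k `|M i k| * (e / S))).
  by apply: ler_sum => k _; rewrite normrM ler_wpM2l// ltW//; exact: pw.
rewrite -mulr_suml mulrCA -[ltRHS]mulr1 ltr_pM2l// ltr_pdivrMr// mul1r.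
apply: (@le_lt_trans _ _ (\sum_i \sum_j `|M i j|)); last by rewrite ltrDr.
rewrite [leRHS](bigD1 i) //= lerDl sumr_ge0// => l _; exact: sumr_ge0.
Qed.

Lemma cvg_col3 (T : Type) (F : set_system T) (FF : Filter F) (w : T -> 'cV[K]_3) (l : 'cV[K]_3) :
  (forall i, w t i 0 @[t --> F] --> l i 0) -> w t @[t --> F] --> l.
Proof.
move=> wl; apply/(cvg_ballP (FF := FF)) => e e0.
have H i : \forall t \near F, ball (l i 0) e (w t i 0) by apply: (cvg_ball (wl i)).
have H3 : \forall t \near F, [/\ ball (l ix 0) e (w t ix 0), ball (l iy 0) e (w t iy 0)
   & ball (l iu 0) e (w t iu 0)].
  by near=> t; split; near: t; exact: H.
apply: filterS H3 => t [h0 h1 h2]; split=> // i j; rewrite [j]ord1.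
by case: i => [[|[|[|]]] //] Hi; [have -> : Ordinal Hi = ix by exact: val_inj
  |have -> : Ordinal Hi = iy by exact: val_inj|have -> : Ordinal Hi = iu by exact: val_inj].
Unshelve. all: by end_near. Qed.

End MatrixTopology.

Section Germs.
Variable R : realType.
Notation C := (Cplx R).
Implicit Types (S T U : surface R) (p q : 'cV[C]_3).

Lemma cvg_aeval (A : 'M[C]_3 * 'cV[C]_3) p : aeval A w @[w --> p] --> aeval A p.
Proof. exact: cvg_affine. Qed.

Lemma germ_equiv_sym S T p q : germ_equiv S p T q -> germ_equiv T q S p.
Proof.
move=> [[M b] [/= uM Ap near_p]].
exists (invmx M, - (invmx M *m b)); split => /=; first by rewrite unitmx_inv.
  by rewrite /aeval /= -Ap /aeval /= mulmxDr mulKmx// addrK.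
have AK w : aeval (M, b) (aeval (invmx M, - (invmx M *m b)) w) = w.
  by rewrite /aeval /= mulmxDr mulmxN !mulKVmx// subrK.
have cA := @cvg_aeval (invmx M, - (invmx M *m b)) q.
have pE : aeval (invmx M, - (invmx M *m b)) q = p.
  by rewrite -Ap /aeval /= mulmxDr mulKmx// addrK.
rewrite pE in cA.
have := cA (fun w => graph S w <-> graph T (aeval (M, b) w)) near_p.
apply: (filterS (Filter := nbhs_filter q)) => w /= [h1 h2].
by rewrite AK in h1 h2; split.
Qed.

Lemma germ_equiv_trans S T U p q r :
  germ_equiv S p T q -> germ_equiv T q U r -> germ_equiv S p U r.
Proof.
move=> [A [uA Ap nA]] [B [uB Bq nB]].
exists (B.1 *m A.1, B.1 *m A.2 + B.2).
have E w : aeval (B.1 *m A.1, B.1 *m A.2 + B.2) w = aeval B (aeval A w).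
  by rewrite /aeval /= mulmxDr mulmxA addrA.
split; [by rewrite unitmx_mul uB|by rewrite E Ap|].
have cA := @cvg_aeval A p; rewrite Ap in cA.
have nB' := cA (fun w => graph T w <-> graph U (aeval B w)) nB.
near=> w; rewrite E.
have h1 : graph S w <-> graph T (aeval A w) by near: w.
have h2 : graph T (aeval A w) <-> graph U (aeval B (aeval A w)) by near: w.
by rewrite h1.
Unshelve. all: by end_near. Qed.

(** The affine map of the germ serves for nearby points as well. *)
Lemma germ_equiv_near S T p q : germ_equiv S p T q ->
  \forall p' \near p, exists q', (graph S p' <-> graph T q') /\ germ_equiv S p' T q'.
Proof.
move=> [A [uA Ap nA]].
have /nbhs_interior := nA; apply: (filterS (Filter := nbhs_filter p)) => p' nA'.
exists (aeval A p'); split; first exact: (nbhs_singleton nA').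
by exists A; split.
Qed.

Lemma cvg_pt (T : Type) (F : set_system T) (FF : Filter F) (x y u : T -> C) (a b c : C) :
  x t @[t --> F] --> a -> y t @[t --> F] --> b -> u t @[t --> F] --> c ->
  pt (x t) (y t) (u t) @[t --> F] --> pt a b c.
Proof.
move=> xa yb uc; apply: cvg_col3 => i.
rewrite (_ : (fun t => _) = fun t => [:: x t; y t; u t]`_i); last first.
  by apply/funext => t; rewrite mxE.
rewrite [X in _ --> X]mxE.
case: i => -[|[|[|m]]] Hi /=; [exact: xa|exact: yb|exact: uc|discriminate Hi].
Qed.

Lemma cvg_graph_pt S z : dom S z -> local_surface S ->
  graph_pt S z' @[z' --> z] --> graph_pt S z.
Proof.
move=> Sz [_ dS _]; apply: cvg_pt; [exact: cvg_fst|exact: cvg_snd|].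
exact: (differentiable_continuous (dS _ Sz)).
Qed.

End Germs.

(** * Nearby points of a surface of branch B3 *)
Section Terms.
Variable K : numFieldType.

Lemma norm_term (g x : K) j k : 0 <= x ->
  `|g * (x ^+ j / j`!%:R) * (x ^+ k / k`!%:R)| = `|g| * (dmon 0 j x * dmon 0 k x).
Proof.
move=> x0; rewrite -!dmon0 -mulrA normrM; congr (_ * _).
by rewrite normrM !norm_dmon (ger0_norm x0).
Qed.

Lemma expansion_dfn (f : K * K -> K) (G : nat -> nat -> K) z :
  (\sum_(j < n) \sum_(k < n) G j k * (z.1 ^+ j / j`!%:R) * (z.2 ^+ k / k`!%:R)
     @[n --> \oo] --> f z) -> f z = dfn G 0 0 z.
Proof.
move=> fz; apply/esym; apply: cvg_lim => //.
have -> // : (fun n => psum G 0 0 z n) =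
  (fun n => \sum_(j < n) \sum_(k < n) G j k * (z.1 ^+ j / j`!%:R) * (z.2 ^+ k / k`!%:R)).
apply/funext => n; apply: eq_bigr => j _; apply: eq_bigr => k _.
by rewrite !dmon0 mulrA.
Qed.

Lemma cvg_pair_at (T : Type) (F : set_system T) (FF : Filter F) (f g : T -> K) (z : K * K) :
  f t @[t --> F] --> z.1 -> g t @[t --> F] --> z.2 -> (f t, g t) @[t --> F] --> z.
Proof. by case: z => a b fa gb; exact: (cvg_pair (G := nbhs a) (H := nbhs b) fa gb). Qed.

Lemma cvg_line (z : K * K) (y : K) : z + (t, t * y) @[t --> 0^'] --> z.
Proof.
have -> : (fun t => z + (t, t * y)) = (fun t => (z.1 + t, z.2 + t * y)) by apply/funext.
have id0 : t @[t --> (0 : K)^'] --> (0 : K) by exact: cvg_within.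
apply: cvg_pair_at.
  by rewrite -[X in _ --> X]addr0; apply: cvgD => //; exact: cvg_cst.
rewrite -[X in _ --> X]addr0 -[X in _ + X](mul0r y).
by apply: cvgD; [exact: cvg_cst|exact: cvgMl].
Qed.

Lemma near_line_lt (z : K * K) (y r : K) : `|z.1| < r -> `|z.2| < r ->
  \forall t \near 0^', `|(z + (t, t * y)).1| < r /\ `|(z + (t, t * y)).2| < r.
Proof.
move=> z1 z2.
have id0 : t @[t --> (0 : K)^'] --> (0 : K) by exact: cvg_within.
have c1 : z.1 + t @[t --> 0^'] --> z.1.
  by rewrite -[X in _ --> X]addr0; apply: cvgD => //; exact: cvg_cst.
have c2 : z.2 + t * y @[t --> 0^'] --> z.2.
  rewrite -[X in _ --> X]addr0 -[X in _ + X](mul0r y).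
  by apply: cvgD; [exact: cvg_cst|exact: cvgMl].
have n1 := cvgr_norm_lt _ c1 _ z1; have n2 := cvgr_norm_lt _ c2 _ z2.
by near=> t; split; near: t; [exact: n1|exact: n2].
Unshelve. all: by end_near. Qed.

Lemma cvg_sub0 (T : Type) (F : set_system T) (FF : Filter F) (f : T -> K) (l : K) :
  f t @[t --> F] --> l -> f t - l @[t --> F] --> 0.
Proof. by move=> fl; rewrite -(subrr l); apply: cvgB fl _; exact: cvg_cst. Qed.

Lemma near_lin_lt (a b c y : K) (d : K -> K) (r : K) :
  d t @[t --> 0^'] --> 0 -> 0 < r ->
  \forall t \near 0^', `|a * t + b * (t * y) + c * d t| < r.
Proof.
move=> d0 r0.
have id0 : t @[t --> (0 : K)^'] --> (0 : K) by exact: cvg_within.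
suff L : a * t + b * (t * y) + c * d t @[t --> 0^'] --> 0.
  by apply: (cvgr_norm_lt _ L); rewrite normr0.
rewrite [X in _ --> X](_ : 0 = a * 0 + b * (0 * y) + c * 0); last by rewrite mul0r !mulr0 !addr0.
apply: cvgD; [apply: cvgD|]; apply: cvgMr => //.
exact: cvgMl.
Qed.

End Terms.

Section Branch.
Variable R : realType.
Notation C := (Cplx R).
Implicit Types (S T : surface R) (p q : 'cV[C]_3) (G : nat -> nat -> C).

Lemma complexC : square_summable_cvg C.
Proof. exact: cvg_square_sums. Qed.

Lemma has_expansionP (f : C * C -> C) G : has_expansion f G ->
  exists2 r : C, 0 < r & abs_bounded G r /\
    forall z, `|z.1| < r -> `|z.2| < r -> f z = dfn G 0 0 z.
Proof.
move=> [r r0 H]; exists r => //; split.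
  move=> x x0 xr; have xr' : `|x| < r by rewrite ger0_norm.
  have [[B HB] _] := H x x xr' xr'; exists B => n.
  move: (HB n); congr (_ <= _).
  by apply: eq_bigr => j _; apply: eq_bigr => k _; rewrite norm_term.
move=> z z1 z2; apply: expansion_dfn.
have [_] := H z.1 z.2 z1 z2.
by rewrite -surjective_pairing.
Qed.

(** What the two branches have in common. *)
Definition in_B3 S := forall p, graph S p ->
  exists G, [/\ normal_form S p G, G 3%N 0%N = 0 & G 0%N 3%N = 0].

Lemma normal_form_fn0 T G : has_expansion (fn T) G -> normalized G -> fn T (0, 0) = 0.
Proof.
move=> /has_expansionP [r r0 [_ /(_ 0)]] h nG.
rewrite -[(0, 0)]/(0 : C * C) h ?normr0// dfn_at0.
by rewrite nG.
Qed.

Lemma graph_pt0 T G : has_expansion (fn T) G -> normalized G -> graph_pt T (0, 0) = 0.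
Proof.
move=> h nG; rewrite /graph_pt (normal_form_fn0 h nG) /pt.
by apply/matrixP => -[[|[|[|]]] //] ? ?; rewrite !mxE.
Qed.

(** Points of [T] near its base point correspond to points of [S], whose normal forms are also
    normal forms of [T] at the given points. *)
Lemma in_B3_near S p T G : in_B3 S -> local_surface T -> dom T (0, 0) ->
  has_expansion (fn T) G -> normalized G -> germ_equiv S p T 0 ->
  \forall z \near (0 : C * C), dom T z /\
    exists G', [/\ normal_form T (graph_pt T z) G', G' 3%N 0%N = 0 & G' 0%N 3%N = 0].
Proof.
move=> BS LT T0 TG nG /germ_equiv_sym /germ_equiv_near near_0.
have cT := cvg_graph_pt T0 LT.
rewrite (graph_pt0 TG nG) in cT.
have oT : open (dom T) by case: LT.
have H1 : \forall z \near (0 : C * C), dom T z by exact: open_nbhs_nbhs.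
have H2 := cT (fun q => exists q', (graph T q <-> graph S q') /\ germ_equiv T q S q') near_0.
near=> z.
have Tz : dom T z by near: z.
split=> //.
have [q' [TS e]] : exists q', (graph T (graph_pt T z) <-> graph S q') /\
   germ_equiv T (graph_pt T z) S q' by near: z.
have gq : graph S q' by apply/TS; exists z.
have [G' [[nG' [T' [LT' T'0 T'G e']]] g30 g03]] := BS _ gq.
exists G'; split=> //; split=> //; exists T'; split=> //.
exact: germ_equiv_trans e e'.
Unshelve. all: by end_near. Qed.

Lemma pt_inj (x y u x' y' u' : C) : pt x y u = pt x' y' u' -> [/\ x = x', y = y' & u = u'].
Proof.
move=> /matrixP H.
by split; [move: (H ix 0)|move: (H iy 0)|move: (H iu 0)]; rewrite !mxE.
Qed.

Lemma ptE (w : 'cV[C]_3) : w = pt (w ix 0) (w iy 0) (w iu 0).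
Proof.
apply/colP => -[[|[|[|]]] // Hi]; rewrite mxE /=; congr (w _ _); exact: val_inj.
Qed.

Lemma mulmx_pt (M : 'M[C]_3) (x y u : C) :
  M *m pt x y u = pt (M ix ix * x + M ix iy * y + M ix iu * u)
                     (M iy ix * x + M iy iy * y + M iy iu * u)
                     (M iu ix * x + M iu iy * y + M iu iu * u).
Proof.
apply/colP => i; rewrite mxE (bigD1 ix) //= (bigD1 iy) //= (bigD1 iu) //= big1 ?addr0; last first.
  by move=> [[|[|[|]]] //].
rewrite !mxE /= addrA.
by case: i => [[|[|[|]]] // Hi] /=; congr (M _ _ * _ + M _ _ * _ + M _ _ * _); exact: val_inj.
Qed.

Lemma cvg_line_fn T (z : C * C) (y : C) : local_surface T -> dom T z ->
  fn T (z + (t, t * y)) @[t --> 0^'] --> fn T z.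
Proof.
move=> [_ dT _] Tz; have c := differentiable_continuous (dT _ Tz).
have l := @cvg_line C z y.
exact: (cvg_comp (fun t => z + (t, t * y)) (fn T) l c).
Qed.

(** Follow a point of the graph of [T] along the line [(t, t * y)] from [z]: its image lies on the
    graph of [T']. *)
Lemma germ_contact T G r z T' G' (A : 'M[C]_3 * 'cV[C]_3) :
  local_surface T -> dom T z -> abs_bounded G r -> `|z.1| < r -> `|z.2| < r ->
  (forall z, `|z.1| < r -> `|z.2| < r -> fn T z = dfn G 0 0 z) ->
  has_expansion (fn T') G' -> aeval A (graph_pt T z) = 0 ->
  (\forall w \near graph_pt T z, graph T w <-> graph T' (aeval A w)) ->
  exists2 r', abs_bounded G' r' /\ 0 < r' & forall y, \forall t \near 0^',
     let d := dfn G 0 0 (z + (t, t * y)) - dfn G 0 0 z in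
     A.1 iu ix * t + A.1 iu iy * (t * y) + A.1 iu iu * d =
     dfn G' 0 0 (A.1 ix ix * t + A.1 ix iy * (t * y) + A.1 ix iu * d,
                 A.1 iy ix * t + A.1 iy iy * (t * y) + A.1 iy iu * d).
Proof.
move=> LT Tz Gr z1 z2 fTG /has_expansionP[r' r'0 [Gr' fT'G']] A0 nA.
exists r'; first by [].
move=> y.
pose d t := dfn G 0 0 (z + (t, t * y)) - dfn G 0 0 z.
have H1 : \forall t \near 0^', `|(z + (t, t * y)).1| < r /\ `|(z + (t, t * y)).2| < r.
  exact: near_line_lt.
have fE : \forall t \near 0^', fn T (z + (t, t * y)) - fn T z = d t.
  apply: filterS H1 => t [t1 t2]; rewrite /d -!fTG//.
have cg : graph_pt T (z + (t, t * y)) @[t --> 0^'] --> graph_pt T z.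
  exact: (cvg_comp _ _ (@cvg_line C z y) (cvg_graph_pt Tz LT)).
have H2 := cg (fun w => graph T w <-> graph T' (aeval A w)) nA.
have oT : open (dom T) by case: LT.
have H3 : \forall t \near 0^', dom T (z + (t, t * y)).
  by apply: (@cvg_line C z y); exact: open_nbhs_nbhs.
pose X t := A.1 ix ix * t + A.1 ix iy * (t * y) + A.1 ix iu * d t.
pose Y t := A.1 iy ix * t + A.1 iy iy * (t * y) + A.1 iy iu * d t.
have d0 : d t @[t --> 0^'] --> 0.
  have : fn T (z + (t, t * y)) - fn T z @[t --> 0^'] --> 0.
    by apply: cvg_sub0; exact: cvg_line_fn.
  by apply: cvg_trans; apply: near_eq_cvg; apply: filterS fE => t ->.
have H4 : \forall t \near 0^', `|X t| < r' /\ `|Y t| < r'.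
  have n1 := near_lin_lt (A.1 ix ix) (A.1 ix iy) (A.1 ix iu) y d0 r'0.
  have n2 := near_lin_lt (A.1 iy ix) (A.1 iy iy) (A.1 iy iu) y d0 r'0.
  by near=> t; split; near: t; [exact: n1|exact: n2].
near=> t; rewrite -/(d t) -/(X t) -/(Y t).
have dt : fn T (z + (t, t * y)) - fn T z = d t by near: t; exact: fE.
have [X1 Y1] : `|X t| < r' /\ `|Y t| < r' by near: t; exact: H4.
have gT : graph T (graph_pt T (z + (t, t * y))).
  by exists (z + (t, t * y)) => //; near: t; exact: H3.
have /(_ gT) : graph T (graph_pt T (z + (t, t * y))) ->
    graph T' (aeval A (graph_pt T (z + (t, t * y)))).
  have : graph T (graph_pt T (z + (t, t * y))) <->
    graph T' (aeval A (graph_pt T (z + (t, t * y)))) by near: t; exact: H2.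
  by case.
have -> : aeval A (graph_pt T (z + (t, t * y)))
   = pt (X t) (Y t) (A.1 iu ix * t + A.1 iu iy * (t * y) + A.1 iu iu * d t).
  rewrite -mulmx_pt -[LHS]subr0 -A0 /aeval opprD addrACA subrr addr0 -mulmxBr.
  congr (_ *m _); apply/colP => i; rewrite !mxE.
  case: i => -[|[|[|m]]] Hi /=; last by discriminate Hi.
  - by rewrite addrAC subrr add0r.
  - by rewrite addrAC subrr add0r.
  - exact: dt.
move=> [[x' y'] _ /pt_inj /= [ex ey ->]].
by rewrite -ex -ey -fT'G'.
Unshelve. all: by end_near. Qed.

End Branch.

(** * Normal forms without cubic terms *)
Section BranchPde.
Variable R : realType.
Notation C := (Cplx R).
Implicit Types (S T : surface R) (p q : 'cV[C]_3) (G : nat -> nat -> C).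

Definition quadric_coef (j k : nat) : C := ((j, k) == (1, 1)%N)%:R.

Lemma normalized_jets G : normalized G -> G 3%N 0%N = 0 -> G 0%N 3%N = 0 ->
  forall j k, (j + k <= 3)%N -> G j k = quadric_coef j k.
Proof.
move=> nG g30 g03 j k jk.
have [[-> ->]|h1] := eqVneq (j, k) (3, 0)%N; first by rewrite g30.
have [[-> ->]|h2] := eqVneq (j, k) (0, 3)%N; first by rewrite g03.
exact: nG.
Qed.

(** At each nearby point, [osculation] produces the linear form and [osculation_pde] eliminates it. *)
Lemma near_apolar_pde S p T G r : in_B3 S -> local_surface T -> dom T (0, 0) ->
  has_expansion (fn T) G -> normalized G -> germ_equiv S p T 0 ->
  0 < r -> abs_bounded G r ->
  (forall z, `|z.1| < r -> `|z.2| < r -> fn T z = dfn G 0 0 z) ->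
  \forall z \near (0 : C * C), apolar_pde (fun a b => dfn G a b z).
Proof.
move=> BS LT T0 TG nG e r0 Gr fTG.
have H1 := in_B3_near BS LT T0 TG nG e.
have c1 : z.1 @[z --> (0 : C * C)] --> (0 : C) by exact: cvg_fst.
have c2 : z.2 @[z --> (0 : C * C)] --> (0 : C) by exact: cvg_snd.
have n1 : \forall z \near (0 : C * C), `|z.1| < r.
  by apply: (cvgr_norm_lt _ c1); rewrite normr0.
have n2 : \forall z \near (0 : C * C), `|z.2| < r.
  by apply: (cvgr_norm_lt _ c2); rewrite normr0.
near=> z.
have z1 : `|z.1| < r by near: z; exact: n1.
have z2 : `|z.2| < r by near: z; exact: n2.
have [Tz [G' [[nG' [T' [_ _ T'G [A [uA A0 nA]]]]] g30 g03]]] : dom T z /\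
    exists G', [/\ normal_form T (graph_pt T z) G', G' 3%N 0%N = 0 & G' 0%N 3%N = 0].
  by near: z; exact: H1.
have [r' [Gr' r'0] H] := germ_contact LT Tz Gr z1 z2 fTG T'G A0 nA.
have [[k0 _ _] _ [h30 h21] [h12 h03]] := osculation (complexC (R := R)) Gr z1 z2 Gr' r'0 uA
  (normalized_jets nG' g30 g03) H.
exact: osculation_pde k0 h30 h21 h12 h03.
Unshelve. all: by end_near. Qed.

Lemma in_B3_solves_pde S p G : in_B3 S -> normal_form S p G -> solves_pde G.
Proof.
move=> BS [nG [T [LT T0 TG e]]].
have [r r0 [Gr fTG]] := has_expansionP TG.
have H := near_apolar_pde BS LT T0 TG nG e r0 Gr fTG.
move=> y; exists (fun a b t => dfn G a b (t, t * y)).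
  move=> a b n.
  have h0 : `|(0 : C * C).1| < r by rewrite normr0.
  have h0' : `|(0 : C * C).2| < r by rewrite normr0.
  have := @taylor_line C G r a b 0 y (complexC (R := R)) Gr h0 h0' n.
  apply: ord_ge_ext => t; rewrite add0r; congr (_ - _); apply: eq_bigr => i _.
  by congr (line_coef (shiftc a b _) _ _ * _); apply/funext => j; apply/funext => k; exact: dfn_at0.
have c := @cvg_line C 0 y.
have Hc := c (fun z => apolar_pde (fun a b => dfn G a b z)) H.
near=> t.
have : apolar_pde (fun a b => dfn G a b (0 + (t, t * y))) by near: t; exact: Hc.
by rewrite add0r.
Unshelve. all: by end_near. Qed.

(** The coefficients [G j k] with [j, k <= 2] of a normal form are fixed, except for [G 2 2]. *)
Lemma normal_form_uniq S p G S' p' G' : in_B3 S -> in_B3 S' ->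
  normal_form S p G -> normal_form S' p' G' -> G 2%N 2%N = G' 2%N 2%N ->
  forall j k, G j k = G' j k.
Proof.
move=> BS BS' nfG nfG' g22.
have nG := nfG.1; have nG' := nfG'.1.
apply: (solves_pde_uniq (in_B3_solves_pde BS nfG) (in_B3_solves_pde BS' nfG')); rewrite ?nG//.
by move=> [|[|[|j]]] [|[|[|k]]] // _ _; rewrite ?nG ?nG'.
Qed.

End BranchPde.

(** * Derivatives of the model functions *)
Section PairDerivatives.
Variable K : numFieldType.
Implicit Types (z v : K * K).

Lemma continuous_fst : continuous (fst : K * K -> K).
Proof. by move=> z; exact: cvg_fst. Qed.

Lemma continuous_snd : continuous (snd : K * K -> K).
Proof. by move=> z; exact: cvg_snd. Qed.

Lemma differentiable_fst z : differentiable (fst : K * K -> K) z.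
Proof. exact: (linear_differentiable _ continuous_fst). Qed.

Lemma differentiable_snd z : differentiable (snd : K * K -> K) z.
Proof. exact: (linear_differentiable _ continuous_snd). Qed.

Lemma is_derive_fst z v : is_derive z v (fst : K * K -> K) v.1.
Proof.
apply: DeriveDef; first exact/diff_derivable/differentiable_fst.
by rewrite deriveE ?diff_lin //; [exact: continuous_fst|exact: differentiable_fst].
Qed.

Lemma is_derive_snd z v : is_derive z v (snd : K * K -> K) v.2.
Proof.
apply: DeriveDef; first exact/diff_derivable/differentiable_snd.
by rewrite deriveE ?diff_lin //; [exact: continuous_snd|exact: differentiable_snd].
Qed.

Lemma differentiable_xy z : differentiable (fun z : K * K => z.1 * z.2) z.
Proof. exact: (differentiableM (@differentiable_fst z) (@differentiable_snd z)). Qed.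

Lemma is_derive_xy z v :
  is_derive z v (fun z : K * K => z.1 * z.2) (z.1 * v.2 + z.2 * v.1).
Proof. exact: (is_deriveM (is_derive_fst z v) (is_derive_snd z v)). Qed.

Lemma is_derive_mul (f g : K * K -> K) z v df dg : is_derive z v f df -> is_derive z v g dg ->
  is_derive z v (fun z => f z * g z) (f z * dg + g z * df).
Proof. by move=> F G; exact: (is_deriveM F G). Qed.

Lemma is_derive_inv (f : K * K -> K) z v df : is_derive z v f df -> f z != 0 ->
  is_derive z v (fun z => (f z)^-1) (- (f z) ^- 2 * df).
Proof.
move=> [F <-] f0; apply: DeriveDef; first exact: derivableV.
by rewrite deriveV.
Qed.

(** The difference quotient is the inverse of [s (w + h) + s w]. *)
Lemma is_derive_sqrt (s : K -> K) w : (\forall w' \near w, s w' ^+ 2 = w') ->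
  {for w, continuous s} -> s w != 0 -> is_derive w 1 s (2 * s w)^-1.
Proof.
move=> s2 sc sw0.
suff H : (fun h => h^-1 *: ((s \o shift w) (h *: 1) - s w)) @ 0^' --> (2 * s w)^-1.
  by apply: DeriveDef; [apply/cvg_ex; exists (2 * s w)^-1|exact: cvg_lim H].
have ch : h *: 1 + w @[h --> (0 : K)^'] --> w.
  rewrite -[X in _ --> X]add0r; apply: cvgD; last exact: cvg_cst.
  rewrite (_ : (fun h : K => h *: 1) = id); first exact: cvg_within.
  by apply/funext => h; rewrite /GRing.scale /= mulr1.
have cs : s (h *: 1 + w) @[h --> (0 : K)^'] --> s w by exact: (cvg_comp _ _ ch sc).
have c2 : (s (h *: 1 + w) + s w)^-1 @[h --> (0 : K)^'] --> (2 * s w)^-1.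
  apply: cvgV; first by rewrite mulf_neq0.
  have -> : 2 * s w = s w + s w by ring.
  by apply: cvgD => //; exact: cvg_cst.
apply: cvg_trans c2; apply: near_eq_cvg.
have n2 := ch (fun w' => s w' ^+ 2 = w') s2.
have sw2 : s w ^+ 2 = w by exact: nbhs_singleton s2.
near=> h.
have h0 : h != 0 by near: h; exact: nbhs_dnbhs_neq.
have E : s (h *: 1 + w) ^+ 2 = h *: 1 + w by near: h; exact: n2.
rewrite /= /shift /=.
have hE : (s (h *: 1 + w) + s w) * (s (h *: 1 + w) - s w) = h.
  rewrite mulrC -subr_sqr E sw2 addrK.
  by rewrite /GRing.scale /= mulr1.
have k0 : s (h *: 1 + w) + s w != 0.
  by apply: contra_neq h0 => k0; rewrite -hE k0 mul0r.
have k1 : s (h *: 1 + w) - s w != 0.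
  by apply: contra_neq h0 => k1; rewrite -hE k1 mulr0.
by rewrite -[X in X^-1 *: _]hE /GRing.scale /= invfM -mulrA mulVf// [RHS]mulr1.
Unshelve. all: by end_near. Qed.

Section SqrtSurface.
Variables (s : K -> K) (V : set (K * K)).
Hypothesis oV : open V.
Hypothesis sV : forall z, V z -> [/\ \forall w \near 1 - z.1 * z.2, s w ^+ 2 = w,
  {for 1 - z.1 * z.2, continuous s} & s (1 - z.1 * z.2) != 0].

Let q (z : K * K) := 1 - z.1 * z.2.
Let f (z : K * K) := 2 - 2 * s (q z).

Lemma is_derive_q z v : is_derive z v q (- (z.1 * v.2 + z.2 * v.1)).
Proof.
have H := is_deriveB (is_derive_cst (1 : K) z v) (is_derive_xy z v).
by apply: is_derive_eq H _; rewrite sub0r.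
Qed.

Lemma differentiable_q z : differentiable q z.
Proof. exact: (differentiableB (differentiable_cst (1 : K) z) (@differentiable_xy z)). Qed.

Lemma differentiable_sq z : V z -> differentiable (s \o q) z.
Proof.
move=> /sV[s2 sc s0]; apply: differentiable_comp (differentiable_q z) _.
by apply/derivable1_diffP; have [] := is_derive_sqrt s2 sc s0.
Qed.

Lemma is_derive_sq z v : V z ->
  is_derive z v (s \o q) (- (z.1 * v.2 + z.2 * v.1) / (2 * s (q z))).
Proof.
move=> Vz; have [s2 sc s0] := sV Vz.
have [ds vs] := is_derive_sqrt s2 sc s0.
have dq := differentiable_q z.
have [_ vq] := is_derive_q z v.
have dsd : differentiable s (q z) by apply/derivable1_diffP.
apply: DeriveDef; first exact/diff_derivable/differentiable_sq.
rewrite deriveE; last exact: differentiable_sq.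
rewrite (diff_comp dq dsd) /= diff1E// derive1E vs.
by rewrite -(deriveE _ dq) vq.
Qed.

Lemma is_derive_sqrt_surface z v : V z ->
  is_derive z v f ((z.1 * v.2 + z.2 * v.1) / s (q z)).
Proof.
move=> Vz; have [_ _ s0] := sV Vz.
have H := is_deriveB (is_derive_cst (2 : K) z v)
  (is_derive_mul (is_derive_cst (2 : K) z v) (is_derive_sq v Vz)).
apply: is_derive_eq H _; rewrite /cst /= -/(q z) in s0 *.
by field.
Qed.

Lemma differentiable_sqrt_surface z : V z -> differentiable f z.
Proof.
move=> Vz; have H := differentiableB (differentiable_cst (2 : K) z)
  (differentiableM (differentiable_cst (2 : K) z) (differentiable_sq Vz)).
exact: H.
Qed.

Lemma near_derive_sqrt_surface z v : V z ->
  \forall z \near z, (z.1 * v.2 + z.2 * v.1) / s (q z) = 'D_v f z.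
Proof.
move=> Vz; have : \forall z \near z, V z by exact: open_nbhs_nbhs.
apply: filterS => z' Vz'.
by have [_ ->] := is_derive_sqrt_surface v Vz'.
Qed.

(** With [s ^ 2 = 1 - x y], the Hessian is [- 1 / s ^ 4]. *)
Lemma hessian_sqrt_surface z : V z ->
  'D_(1, 0) ('D_(1, 0) f) z * 'D_(0, 1) ('D_(0, 1) f) z
  - ('D_(1, 0) ('D_(0, 1) f) z) ^+ 2 != 0.
Proof.
move=> Vz; have [s2 _ s0] := sV Vz.
rewrite -/(q z) in s0.
have D2 v w : 'D_w ('D_v f) z = (z.1 * v.2 + z.2 * v.1) * ((z.1 * w.2 + z.2 * w.1) / (2 * s (q z) ^+ 3))
    + (w.1 * v.2 + w.2 * v.1) / s (q z).
  rewrite -(near_eq_derive _ (near_derive_sqrt_surface v Vz)).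
  have c (k : K) := is_derive_cst k z w.
  have H1 := is_derive_mul (is_derive_fst z w) (c v.2).
  have H2 := is_derive_mul (is_derive_snd z w) (c v.1).
  have H := is_derive_mul (is_deriveD H1 H2) (is_derive_inv (is_derive_sq w Vz) s0).
  have [_ ->] := H.
  rewrite !addrfctE /cst /= -/(q z) /=.
  by field.
have sq2 : s (q z) ^+ 2 = 1 - z.1 * z.2 by exact: nbhs_singleton s2.
rewrite !D2 /=.
have -> : (z.1 * 0 + z.2 * 1) * ((z.1 * 0 + z.2 * 1) / (2 * s (q z) ^+ 3))
      + (1 * 0 + 0 * 1) / s (q z) = z.2 ^+ 2 / (2 * s (q z) ^+ 3) by field.
have -> : (z.1 * 1 + z.2 * 0) * ((z.1 * 1 + z.2 * 0) / (2 * s (q z) ^+ 3))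
      + (0 * 1 + 1 * 0) / s (q z) = z.1 ^+ 2 / (2 * s (q z) ^+ 3) by field.
have -> : z.2 ^+ 2 / (2 * s (q z) ^+ 3) * (z.1 ^+ 2 / (2 * s (q z) ^+ 3)) -
  ((z.1 * 1 + z.2 * 0) * ((z.1 * 0 + z.2 * 1) / (2 * s (q z) ^+ 3)) + (1 * 1 + 0 * 0) / s (q z)) ^+ 2
  = - (s (q z) ^+ 2 + z.1 * z.2) / s (q z) ^+ 4 by field.
by rewrite sq2 subrK mulNr mul1r oppr_eq0 invr_eq0 expf_neq0.
Qed.

End SqrtSurface.

Lemma near_derive_xy z v : \forall z \near z, (z.1 * v.2 + z.2 * v.1) = 'D_v (fun z => z.1 * z.2) z.
Proof. by apply: (@filterE _ _ (nbhs_filter z)) => z'; have [_ ->] := is_derive_xy z' v. Qed.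

Let f (z : K * K) := z.1 * z.2.

Lemma hessian_xy z :
  'D_(1, 0) ('D_(1, 0) f) z * 'D_(0, 1) ('D_(0, 1) f) z
  - ('D_(1, 0) ('D_(0, 1) f) z) ^+ 2 != 0.
Proof.
have D2 v w : 'D_w ('D_v f) z = w.1 * v.2 + w.2 * v.1.
  rewrite -(near_eq_derive _ (near_derive_xy z v)).
  have c (k : K) := is_derive_cst k z w.
  have [_ ->] := is_deriveD (is_derive_mul (is_derive_fst z w) (c v.2))
    (is_derive_mul (is_derive_snd z w) (c v.1)).
  by rewrite /cst /=; ring.
rewrite !D2 /= !(mulr0, mul0r, mulr1, addr0, add0r).
by rewrite oppr_eq0 expf_neq0 ?oner_eq0.
Qed.

End PairDerivatives.

(** * The power series of the square root *)
Section SqrtSeries.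
Variable K : numFieldType.

(** Iterates of the map [u |-> s + u ^ 2 / 4], whose fixed point that vanishes with [s] is
    [2 - 2 sqrt (1 - s)]. Their coefficients are nonnegative and stabilize, and their values
    converge geometrically for [|s| <= 1/4]. *)
Fixpoint sqrt_poly (n : nat) : {poly K} :=
  if n is m.+1 then 'X + (4^-1)%:P * sqrt_poly m ^+ 2 else 0.

Definition sqrt_coef (n : nat) : K := (sqrt_poly n)`_n.

Lemma sqrt_poly_ge0 n i : 0 <= (sqrt_poly n)`_i.
Proof.
elim: n i => [|n IH] i; first by rewrite coef0.
rewrite /= coefD coefX coefCM addr_ge0 ?ler0n// mulr_ge0 ?invr_ge0 ?ler0n//.
by rewrite expr2 coefM sumr_ge0// => j _; rewrite mulr_ge0.
Qed.

Lemma sqrt_polyX n : exists q, sqrt_poly n = 'X * q.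
Proof.
elim: n => [|n [q E]]; first by exists 0; rewrite mulr0.
by exists (1 + (4^-1)%:P * 'X * q ^+ 2); rewrite /= E; ring.
Qed.

(** The difference of two consecutive iterates is multiplied at each step by a quarter of their
    sum, which is divisible by ['X]. *)
Lemma sqrt_poly_step n : exists q, sqrt_poly n.+1 = sqrt_poly n + 'X^(n.+1) * q.
Proof.
elim: n => [|n [q E]]; first by exists 1; rewrite /= expr0n mulr0 !addr0 add0r expr1 mulr1.
have [a Ea] := sqrt_polyX n; have [b Eb] := sqrt_polyX n.+1.
exists ((4^-1)%:P * q * (a + b)).
rewrite -[LHS]/('X + (4^-1)%:P * sqrt_poly n.+1 ^+ 2).
rewrite -[X in _ = X + _]/('X + (4^-1)%:P * sqrt_poly n ^+ 2).
have -> : sqrt_poly n.+1 ^+ 2 = sqrt_poly n ^+ 2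
    + (sqrt_poly n.+1 - sqrt_poly n) * (sqrt_poly n + sqrt_poly n.+1) by ring.
by rewrite {1}E Ea Eb !exprS; ring.
Qed.

Lemma coef_sqrt_poly n i : (i <= n)%N -> (sqrt_poly n)`_i = sqrt_coef i.
Proof.
elim: n => [|n IH]; first by rewrite leqn0 => /eqP->.
rewrite leq_eqVlt => /orP[/eqP->//|]; rewrite ltnS => ni.
have [q ->] := sqrt_poly_step n.
by rewrite coefD coefXnM ltnS ni addr0 IH.
Qed.

Lemma sqrt_coef_ge0 i : 0 <= sqrt_coef i.
Proof. exact: sqrt_poly_ge0. Qed.

Lemma horner_sqrt_poly n s :
  (sqrt_poly n.+1).[s] = s + 4^-1 * (sqrt_poly n).[s] ^+ 2.
Proof. by rewrite /= hornerD hornerX hornerM hornerC horner_exp. Qed.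

Lemma sqrt_poly_at1 n : 0 <= (sqrt_poly n).[1] <= 2.
Proof.
elim: n => [|n /andP[h0 h2]]; first by rewrite horner0 lexx ler0n.
rewrite horner_sqrt_poly addr_ge0 ?mulr_ge0 ?exprn_ge0 ?invr_ge0 ?ler0n//=.
have -> : 2 = 1 + 4^-1 * 2 ^+ 2 :> K by field.
by rewrite lerD2l ler_wpM2l ?invr_ge0 ?ler0n// lerXn2r ?nnegrE ?ler0n.
Qed.

Lemma sum_sqrt_coef n s : 0 <= s -> s <= 1 -> \sum_(j < n) sqrt_coef j * s ^+ j <= 2.
Proof.
move=> s0 s1; have /andP[_ h] := sqrt_poly_at1 n; apply: le_trans h.
apply: le_trans (_ : \sum_(j < n) (sqrt_poly n)`_j <= _).
  apply: ler_sum => j _; rewrite coef_sqrt_poly; last exact: ltnW.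
  by rewrite ler_piMr ?sqrt_coef_ge0// exprn_ile1.
rewrite horner_coef; pose m := maxn n (size (sqrt_poly n)).
rewrite (big_ord_widen m (fun j => (sqrt_poly n)`_j)) ?leq_maxl//.
rewrite (big_ord_widen m (fun j => (sqrt_poly n)`_j * 1 ^+ j)) ?leq_maxr//.
rewrite !(big_mkcond (fun i : 'I_m => (i < _)%N)).
apply: ler_sum => j _; rewrite expr1n mulr1.
case: (ltnP j n) => jn; case: (ltnP j (size _)) => js //.
  by rewrite nth_default.
exact: sqrt_poly_ge0.
Qed.

Lemma half_small (x : K) : `|x| <= 2^-1 -> `|x| ^+ 2 <= 4^-1.
Proof.
move=> h; have -> : 4^-1 = 2^-1 ^+ 2 :> K by field.
by rewrite lerXn2r ?nnegrE ?invr_ge0 ?ler0n.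
Qed.

Lemma sqrt_poly_small n s : `|s| <= 4^-1 -> `|(sqrt_poly n).[s]| <= 2^-1.
Proof.
move=> s4; elim: n => [|n IH]; first by rewrite horner0 normr0 invr_ge0 ler0n.
rewrite horner_sqrt_poly (le_trans (ler_normD _ _))//.
have -> : 2^-1 = 4^-1 + 4^-1 * 1 :> K by field.
rewrite lerD// normrM normrX ger0_norm ?invr_ge0 ?ler0n//.
rewrite ler_wpM2l ?invr_ge0 ?ler0n// (le_trans (half_small IH))//.
by rewrite invf_le1 ?ltr0n// ler1n.
Qed.

Lemma sqrt_poly_approx n s g : `|s| <= 4^-1 -> `|g| <= 2^-1 -> g = s + 4^-1 * g ^+ 2 ->
  `|(sqrt_poly n).[s] - g| <= 4^-1 ^+ n.
Proof.
move=> s4 g2 gE; elim: n => [|n IH].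
  rewrite horner0 sub0r normrN expr0 (le_trans g2)//.
  by rewrite invf_le1 ?ltr0n// ler1n.
rewrite horner_sqrt_poly {1}gE.
have -> : s + 4^-1 * (sqrt_poly n).[s] ^+ 2 - (s + 4^-1 * g ^+ 2)
  = 4^-1 * (((sqrt_poly n).[s] - g) * ((sqrt_poly n).[s] + g)) by ring.
rewrite exprS normrM ger0_norm ?invr_ge0 ?ler0n// ler_wpM2l ?invr_ge0 ?ler0n//.
rewrite normrM -[leRHS]mulr1 ler_pM// (le_trans (ler_normD _ _))//.
have -> : 1 = 2^-1 + 2^-1 :> K by field.
by rewrite lerD// sqrt_poly_small.
Qed.

(** Compare the partial sum with the [n]-th iterate, which has the same coefficients up to degree
    [n], and the iterate with its limit. *)
Lemma sqrt_series_approx n s g : `|s| <= 4^-1 -> `|g| <= 2^-1 -> g = s + 4^-1 * g ^+ 2 ->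
  `|g - \sum_(j < n) sqrt_coef j * s ^+ j| <= 3 * 4^-1 ^+ n.
Proof.
move=> s4 g2 gE.
have s1 : `|s| <= 1 by rewrite (le_trans s4)// invf_le1 ?ltr0n// ler1n.
have T := @tail_le K (sqrt_poly n) (sqrt_poly n) s 1 n.
have -> : \sum_(j < n) sqrt_coef j * s ^+ j = \sum_(j < n) (sqrt_poly n)`_j * s ^+ j.
  by apply: eq_bigr => j _; rewrite coef_sqrt_poly// ltnW.
rewrite -(subrK (sqrt_poly n).[s] g) -addrA (le_trans (ler_normD _ _))//.
have -> : 3 * 4^-1 ^+ n = 4^-1 ^+ n + 2 * 4^-1 ^+ n :> K by ring.
rewrite lerD//; first by rewrite distrC sqrt_poly_approx.
have := T _ s1; rewrite expr1n mulr1 => H.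
apply: le_trans (H _) _; first by move=> i; rewrite ger0_norm// sqrt_poly_ge0.
have /andP[h0 h2] := sqrt_poly_at1 n.
apply: ler_pM => //.
by rewrite lerXn2r ?nnegrE ?invr_ge0 ?ler0n.
Qed.

Lemma sqrt_coef0 : sqrt_coef 0 = 0.
Proof. by rewrite /sqrt_coef coef0. Qed.

Lemma sqrt_coef1 : sqrt_coef 1 = 1.
Proof. by rewrite /sqrt_coef /= expr0n mulr0 addr0 coefX. Qed.

Lemma sqrt_coef2 : sqrt_coef 2 = 4^-1.
Proof.
rewrite /sqrt_coef /= expr0n mulr0 addr0 coefD coefX add0r coefCM coefXn eqxx.
by rewrite mulr1.
Qed.

(** The coefficients of [sum_j c j * (x y) ^ j] with respect to [x ^ j / j! * y ^ k / k!]. *)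
Definition diag_coef (c : nat -> K) (j k : nat) : K :=
  if j == k then c j * (j`!%:R) ^+ 2 else 0.

Lemma diag_row (V : nmodType) (F : nat -> nat -> V) n : (forall j k, j != k -> F j k = 0) ->
  \sum_(j < n) \sum_(k < n) F j k = \sum_(j < n) F j j.
Proof.
move=> F0; apply: eq_bigr => j _.
by rewrite (bigD1 j) //= big1 ?addr0// => k kj; rewrite F0// eq_sym.
Qed.

Lemma diag_sum c x y n :
  \sum_(j < n) \sum_(k < n) diag_coef c j k * (x ^+ j / j`!%:R) * (y ^+ k / k`!%:R)
  = \sum_(j < n) c j * (x * y) ^+ j.
Proof.
rewrite (diag_row (F := fun j k => diag_coef c j k * (x ^+ j / j`!%:R) * (y ^+ k / k`!%:R))).
  apply: eq_bigr => j _; rewrite /diag_coef eqxx exprMn.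
  by field; rewrite natfact_neq0.
by move=> j k /negPf jk; rewrite /diag_coef jk !mul0r.
Qed.

Lemma diag_abs_sum c x y n : (forall j, 0 <= c j) ->
  \sum_(j < n) \sum_(k < n) `|diag_coef c j k * (x ^+ j / j`!%:R) * (y ^+ k / k`!%:R)|
  = \sum_(j < n) c j * `|x * y| ^+ j.
Proof.
move=> c0; rewrite (diag_row (F := fun j k =>
  `|diag_coef c j k * (x ^+ j / j`!%:R) * (y ^+ k / k`!%:R)|)).
  apply: eq_bigr => j _; rewrite /diag_coef eqxx.
  have -> : c j * j`!%:R ^+ 2 * (x ^+ j / j`!%:R) * (y ^+ j / j`!%:R) = c j * (x * y) ^+ j.
    by rewrite exprMn; field; rewrite natfact_neq0.
  by rewrite normrM normrX ger0_norm.
by move=> j k /negPf jk; rewrite /diag_coef jk !mul0r normr0.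
Qed.

End SqrtSeries.

(** * The complex square root *)
Section Mx3.
Variable K : fieldType.

Definition mx3 (a b c d e f g h i : K) : 'M[K]_3 :=
  \matrix_(k, l) nth 0 (nth [::] [:: [:: a; b; c]; [:: d; e; f]; [:: g; h; i]] k) l.

(** The hypotheses say that the second list of entries is a right inverse. *)
Lemma mx3_mul_eq1 (a b c d e f g h i a' b' c' d' e' f' g' h' i' : K) :
  [/\ a * a' + b * d' + c * g' = 1, a * b' + b * e' + c * h' = 0
    & a * c' + b * f' + c * i' = 0] ->
  [/\ d * a' + e * d' + f * g' = 0, d * b' + e * e' + f * h' = 1
    & d * c' + e * f' + f * i' = 0] ->
  [/\ g * a' + h * d' + i * g' = 0, g * b' + h * e' + i * h' = 0
    & g * c' + h * f' + i * i' = 1] ->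
  mx3 a b c d e f g h i \in unitmx.
Proof.
move=> [h1 h2 h3] [h4 h5 h6] [h7 h8 h9].
suff /mulmx1_unit[//] : mx3 a b c d e f g h i *m mx3 a' b' c' d' e' f' g' h' i' = 1%:M.
apply/matrixP => -[[|[|[|k]]] kP] -[[|[|[|l]]] lP] //=;
  rewrite mxE !big_ord_recl big_ord0 !mxE /= addr0 addrA //.
Qed.

End Mx3.

Lemma continuous_of_expanding (K : numFieldType) (s : K -> K) (w k : K) : 0 < k ->
  (forall w', `|s w - s w'| * k <= `|w - w'|) -> {for w, continuous s}.
Proof.
move=> k0 H; apply/(@cvgrPdist_lt _ _ _ _ (nbhs_filter w)) => e e0; apply/nbhs_ballP.
exists (e * k) => /=; first exact: mulr_gt0.
by move=> w'; rewrite /ball /= => h; rewrite -(ltr_pM2r k0) (le_lt_trans (H _)).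
Qed.

Section ComplexSqrt.
Variable R : realType.
Notation C := (Cplx R).
Local Notation Re := (@complex.Re R).
Local Notation sqrtC' := (@sqrtc R : C -> C).

Lemma ReD (x y : C) : Re (x + y) = Re x + Re y.
Proof. by case: x y => [? ?] [? ?]. Qed.

Lemma ReN (x : C) : Re (- x) = - Re x.
Proof. by case: x. Qed.

Lemma Re1 : Re (1 : C) = 1. Proof. by []. Qed.

Lemma Re_sqrtc_ge0 (w : C) : 0 <= Re (sqrtC' w).
Proof. by case: w => a b /=; exact: sqrtr_ge0. Qed.

Lemma Re_sqrtc_gt0 (w : C) : 0 < Re w -> 0 < Re (sqrtC' w).
Proof.
case: w => a b /= a0; rewrite sqrtr_gt0 divr_gt0//.
by apply: ltr_wpDl => //; exact: sqrtr_ge0.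
Qed.

Lemma Re_gt0_neq0 (w : C) : 0 < Re w -> w != 0.
Proof. by move=> w0; apply/eqP => w00; move: w0; rewrite w00 /= ltxx. Qed.

Lemma sqrtc_sq (w : C) : sqrtC' w ^+ 2 = w.
Proof. exact: sqr_sqrtc. Qed.

(** The two square roots of a number are opposite. *)
Lemma sqrtc_uniq (s w : C) : s ^+ 2 = w -> 0 < Re s -> s = sqrtC' w.
Proof.
move=> sw s0; have : (s - sqrtC' w) * (s + sqrtC' w) = 0.
  by rewrite -subr_sqr sw sqrtc_sq subrr.
move/eqP; rewrite mulf_eq0 => /orP[|]; first by rewrite subr_eq0 => /eqP.
rewrite addr_eq0 => /eqP h; move: s0; rewrite h ReN oppr_gt0.
by rewrite ltNge Re_sqrtc_ge0.
Qed.

Lemma norm_ge_Re (w : C) : (Re w)%:C%C <= `|w|.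
Proof.
apply: le_trans (normc_ge_Re w); rewrite lecR; exact: ler_norm.
Qed.

Lemma Re_lt_norm (w : C) (e : R) : `|w| < e%:C%C -> Re w < e.
Proof. by move=> we; rewrite -ltcR; apply: le_lt_trans we; exact: norm_ge_Re. Qed.

(** [w - w'] is the product of the difference and the sum of the square roots, and the real part
    of this sum is at least that of [sqrtc w]. *)
Lemma continuous_sqrtc (w : C) : 0 < Re (sqrtC' w) -> {for w, continuous sqrtC'}.
Proof.
move=> s0.
have s0' : 0 < (Re (sqrtC' w))%:C%C :> C by rewrite ltcR.
apply: (continuous_of_expanding s0') => w'.
have -> : w - w' = (sqrtC' w - sqrtC' w') * (sqrtC' w + sqrtC' w').
  by rewrite -subr_sqr !sqrtc_sq.
rewrite normrM; apply: ler_wpM2l => //.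
apply: le_trans (norm_ge_Re _); rewrite lecR ReD lerDl; exact: Re_sqrtc_ge0.
Qed.

Lemma Re_one_sub_gt0 (z : C) : `|z| < 1 -> 0 < Re (1 - z).
Proof.
move=> z1; rewrite ReD ReN Re1 subr_gt0; apply: Re_lt_norm; exact: z1.
Qed.

(** [2 - 2 sqrt (1 - s) = 2 s / (1 + sqrt (1 - s))], with a denominator of real part at least 1. *)
Lemma sqrt_fn_le (s : C) : `|2 - 2 * sqrtC' (1 - s)| <= 2 * `|s|.
Proof.
set g := 2 - _; set e := 1 + sqrtC' (1 - s).
have ge : g * e = 2 * s.
  rewrite /g /e; transitivity (2 * (1 - sqrtC' (1 - s) ^+ 2)); first by ring.
  by rewrite sqrtc_sq; ring.
have e1 : 1 <= `|e|.
  apply: le_trans (norm_ge_Re _); rewrite -[1]/((1 : R)%:C%C) lecR ReD Re1 lerDl.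
  exact: Re_sqrtc_ge0.
apply: le_trans (_ : `|g| * `|e| <= _); first exact: ler_peMr.
by rewrite -normrM ge normrM normr_nat.
Qed.

Lemma sqrt_small (s : C) : `|s| <= 4^-1 -> `|2 - 2 * sqrtC' (1 - s)| <= 2^-1.
Proof.
move=> s4; apply: le_trans (sqrt_fn_le s) _.
have -> : 2^-1 = 2 * 4^-1 :> C by field.
by apply: ler_wpM2l => //; exact: ler0n.
Qed.

(** The surface [u = 2 - 2 sqrt (1 - x y)] lies on the quadric [u = x y + u ^ 2 / 4]. *)
Lemma sqrt_fixed (s : C) :
  2 - 2 * sqrtC' (1 - s) = s + 4^-1 * (2 - 2 * sqrtC' (1 - s)) ^+ 2.
Proof.
have := sqrtc_sq (1 - s); move: (sqrtC' (1 - s)) => t t2.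
transitivity (s + 1 - 2 * t + t ^+ 2); first by rewrite t2; ring.
by field.
Qed.

Lemma geometric_small (e : C) : 0 < e -> \forall n \near \oo, 3 * 4^-1 ^+ n < e.
Proof.
move=> e0.
have eE : e = (Re e)%:C%C by rewrite RRe_real// ger0_real// ltW.
have e0' : 0 < Re e by move: e0; rewrite ltcE => /andP[].
have c : 3 * (4^-1 : R) ^+ n @[n --> \oo] --> (0 : R).
  apply: (@cvg_geometric R 3 4^-1); rewrite ger0_norm ?invr_ge0 ?ler0n//.
  by rewrite invf_lt1 ?ltr0n// ltr1n.
have H := cvgr_lt _ c _ e0'.
near=> n; have h : 3 * (4^-1 : R) ^+ n < Re e by near: n; exact: H.
rewrite eE; have -> : 3 * 4^-1 ^+ n = (3 * (4^-1 : R) ^+ n)%:C%C :> C.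
  by rewrite rmorphM rmorphXn fmorphV !rmorph_nat.
by rewrite ltcR.
Unshelve. all: by end_near. Qed.

Definition sqrt_I : nat -> nat -> C := diag_coef (sqrt_coef C).

Lemma sqrt_has_expansion : has_expansion (@sqrt_fn R) sqrt_I.
Proof.
exists 2^-1; first by rewrite invr_gt0 ltr0n.
move=> x y x2 y2 t.
have s4 : `|x * y| <= 4^-1.
  have -> : 4^-1 = 2^-1 * 2^-1 :> C by field.
  by rewrite normrM; apply: ler_pM => //; exact: ltW.
split.
  exists 2 => n; rewrite /t /sqrt_I diag_abs_sum; last exact: sqrt_coef_ge0.
  apply: sum_sqrt_coef => //; apply: le_trans s4 _.
  by rewrite invf_le1 ?ltr0n// ler1n.
apply/cvgrPdist_lt => e e0; have H := geometric_small e0.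
near=> n; have h : 3 * 4^-1 ^+ n < e by near: n; exact: H.
rewrite /t /sqrt_I diag_sum; apply: le_lt_trans h.
exact: sqrt_series_approx s4 (sqrt_small s4) (sqrt_fixed _).
Unshelve. all: by end_near. Qed.

Lemma quadric_coefE : quadric_coef R = diag_coef (fun j => (j == 1%N)%:R).
Proof.
apply/funext => j; apply/funext => k; rewrite /quadric_coef /diag_coef xpair_eqE.
case: (eqVneq j k) => [<-|jk].
  by case: (eqVneq j 1%N) => [->|j1]; rewrite /= ?mul0r// expr1n mulr1.
case: (eqVneq j 1%N) jk => //= ->; by case: k => [|[|]].
Qed.

Lemma quadric_sum (u : C) n : (2 <= n)%N -> \sum_(j < n) (j == 1%N :> nat)%:R * u ^+ j = u.
Proof.
move=> n2; rewrite (bigD1 (Ordinal n2)) //= big1 ?addr0 ?mul1r ?expr1//.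
by move=> j /negPf; rewrite -val_eqE /= => ->; rewrite mul0r.
Qed.

Lemma quadric_cvg (x y : C) :
  \sum_(j < n) \sum_(k < n) quadric_coef R j k * (x ^+ j / j`!%:R) * (y ^+ k / k`!%:R)
    @[n --> \oo] --> x * y.
Proof.
apply: cvg_near_cst; near=> n; rewrite quadric_coefE diag_sum quadric_sum//.
by near: n; exact: nbhs_infty_ge.
Unshelve. all: by end_near. Qed.

Lemma quadric_has_expansion : has_expansion (@quadric_fn R) (quadric_coef R).
Proof.
exists 1; first exact: ltr01.
move=> x y x1 y1 t; split; last exact: quadric_cvg.
exists `|x * y| => n; rewrite /t quadric_coefE diag_abs_sum; last by move=> j; exact: ler0n.
have [n2|n2] := leqP 2 n; first by rewrite quadric_sum.
rewrite big1 // => j _.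
have -> : (j == 1%N :> nat) = false by apply/eqP => j1; have := ltn_ord j; rewrite j1; lia.
by rewrite mul0r.
Qed.

Lemma dfn_quadric (z : C * C) : dfn (quadric_coef R) 0 0 z = z.1 * z.2.
Proof.
exact/esym/(@expansion_dfn _ (fun z : C * C => z.1 * z.2))/quadric_cvg.
Qed.

End ComplexSqrt.

(** * The model quadrics are homogeneous *)
Section Reflection.
Variables (K : numFieldType) (x y s : K).
Let e := 1 + s.
Hypothesis e0 : e != 0.
Hypothesis s2 : s ^+ 2 = 1 - x * y.

Lemma reflection_xy : x * y = (2 - e) * e.
Proof.
have -> : x * y = 1 - s ^+ 2 by rewrite s2; ring.
by rewrite /e; ring.
Qed.

Lemma reflection_coef : e / 2 - x * y / (2 * e) - s = 0.
Proof. by rewrite reflection_xy; transitivity (e - 1 - s); [field|rewrite /e; ring]. Qed.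

Lemma reflection_square : e ^+ 2 / 4 + (x * y) ^+ 2 / (4 * e ^+ 2) + x * y / 2 = 1.
Proof. by rewrite reflection_xy; field. Qed.

Lemma reflection_unit :
  mx3 (- e / 2) (x ^+ 2 / (2 * e)) (- x / 2) (y ^+ 2 / (2 * e)) (- e / 2) (- y / 2)
      (- y) (- x) s \in unitmx.
Proof.
have c := reflection_coef; have q := reflection_square.
apply: (@mx3_mul_eq1 _ _ _ _ _ _ _ _ _ _ (- e / 2) (x ^+ 2 / (2 * e)) (- x / 2)
  (y ^+ 2 / (2 * e)) (- e / 2) (- y / 2) (- y) (- x) s); split.
- by rewrite -[RHS]q; field.
- by field.
- by transitivity (x / 2 * (e / 2 - x * y / (2 * e) - s)); [field|rewrite c mulr0].
- by field.
- by rewrite -[RHS]q; field.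
- by transitivity (y / 2 * (e / 2 - x * y / (2 * e) - s)); [field|rewrite c mulr0].
- by transitivity (y * (e / 2 - x * y / (2 * e) - s)); [field|rewrite c mulr0].
- by transitivity (x * (e / 2 - x * y / (2 * e) - s)); [field|rewrite c mulr0].
- by transitivity (x * y + s ^+ 2); [field|rewrite s2; ring].
Qed.

Lemma reflection_base :
  [/\ - e / 2 * x + x ^+ 2 / (2 * e) * y - x / 2 * (2 - 2 * s) + x = 0,
      y ^+ 2 / (2 * e) * x - e / 2 * y - y / 2 * (2 - 2 * s) + y = 0
    & - y * x - x * y + s * (2 - 2 * s) + (2 - 2 * s) = 0].
Proof.
have c := reflection_coef; split.
- by transitivity (- x * (e / 2 - x * y / (2 * e) - s)); [field|rewrite c mulr0].
- by transitivity (- y * (e / 2 - x * y / (2 * e) - s)); [field|rewrite c mulr0].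
- by transitivity (2 * (1 - x * y - s ^+ 2)); [ring|rewrite s2; ring].
Qed.

Lemma reflection_quad a b u :
  (- y * a - x * b + s * u + (2 - 2 * s) - 2) ^+ 2
  + 4 * (- e / 2 * a + x ^+ 2 / (2 * e) * b - x / 2 * u + x)
      * (y ^+ 2 / (2 * e) * a - e / 2 * b - y / 2 * u + y)
  = (u - 2) ^+ 2 + 4 * a * b.
Proof.
have c := reflection_coef; have q := reflection_square.
transitivity ((u - 2) ^+ 2 * (s ^+ 2 + x * y)
  + 4 * a * b * (e ^+ 2 / 4 + (x * y) ^+ 2 / (4 * e ^+ 2) + x * y / 2)
  + 2 * (u - 2) * (a * y + b * x) * (e / 2 - x * y / (2 * e) - s)); first by field.
by rewrite c q s2; ring.
Qed.

End Reflection.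

Section Models.
Variable R : realType.
Notation C := (Cplx R).
Local Notation Re := (@complex.Re R).
Local Notation sqrtC' := (@sqrtc R : C -> C).
Variable V : set (C * C).
Hypothesis oV : open V.
Hypothesis V0 : V (0, 0).

Lemma mx3_pt (a b c d e f g h i x y u : C) :
  mx3 a b c d e f g h i *m pt x y u =
  pt (a * x + b * y + c * u) (d * x + e * y + f * u) (g * x + h * y + i * u).
Proof. by rewrite mulmx_pt !mxE. Qed.

Lemma pt_add (x y u x' y' u' : C) : pt x y u + pt x' y' u' = pt (x + x') (y + y') (u + u').
Proof. by apply/colP => -[[|[|[|i]]] Hi]; rewrite !mxE. Qed.

Lemma ptx (x y u : C) : pt x y u ix 0 = x. Proof. by rewrite mxE. Qed.
Lemma pty (x y u : C) : pt x y u iy 0 = y. Proof. by rewrite mxE. Qed.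
Lemma ptu (x y u : C) : pt x y u iu 0 = u. Proof. by rewrite mxE. Qed.

Lemma graphE (f : C * C -> C) w :
  graph (Surface V f) w <-> V (w ix 0, w iy 0) /\ w iu 0 = f (w ix 0, w iy 0).
Proof.
split=> [[[x y] Vz ->]|[Vw fw]]; first by rewrite /graph_pt ptx pty ptu.
by exists (w ix 0, w iy 0) => //; rewrite /graph_pt /= -fw -ptE.
Qed.

Lemma cvg_coord (p : 'cV[C]_3) i : (w : 'cV[C]_3) i 0 @[w --> p] --> p i 0.
Proof. exact: (differentiable_continuous (differentiable_coord p i 0)). Qed.

Lemma near_dom (p : 'cV[C]_3) : V (p ix 0, p iy 0) ->
  \forall w \near p, V ((w : 'cV[C]_3) ix 0, w iy 0).
Proof.
move=> Vp.
have c := @cvg_pair_at C _ _ (nbhs_filter p) _ _ (p ix 0, p iy 0) (@cvg_coord p ix) (@cvg_coord p iy).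
by apply: c; exact: open_nbhs_nbhs.
Qed.

(** An affine map that preserves the equation [quad] of the surface and moves the point above
    [z] to the origin identifies the two germs. *)
Lemma germ_of_near (f : C * C -> C) (quad : 'cV[C]_3 -> Prop) (A : 'M[C]_3 * 'cV[C]_3) z :
  V z -> f (0, 0) = 0 ->
  (forall z, V z -> \forall w \near graph_pt (Surface V f) z,
     graph (Surface V f) w <-> quad w) ->
  A.1 \in unitmx -> aeval A (graph_pt (Surface V f) z) = 0 ->
  (forall w, quad w <-> quad (aeval A w)) ->
  germ_equiv (Surface V f) (graph_pt (Surface V f) z) (Surface V f) 0.
Proof.
move=> Vz f0 nq uA A0 qA; exists A; split=> //.
have g0 : graph_pt (Surface V f) (0, 0) = 0.
  by rewrite /graph_pt /= f0; apply/colP => -[[|[|[|i]]] Hi]; rewrite !mxE.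
have n0 := nq _ V0; rewrite g0 in n0.
have cA := @cvg_aeval R A (graph_pt (Surface V f) z); rewrite A0 in cA.
have n1 := cA (fun w => graph (Surface V f) w <-> quad w) n0.
have n2 := nq _ Vz.
near=> w.
have h1 : graph (Surface V f) w <-> quad w by near: w; exact: n2.
have h2 : graph (Surface V f) (aeval A w) <-> quad (aeval A w) by near: w; exact: n1.
by rewrite h1 h2.
Unshelve. all: by end_near. Qed.

Let Q := Surface V (@quadric_fn R).

Lemma quadric_local_surface : local_surface Q.
Proof.
split; [exact: oV|move=> z Vz..]; first exact: (@differentiable_xy C z).
exact: (@hessian_xy C z).
Qed.

(** The translations along the paraboloid are affine maps that preserve it. *)
Lemma quadric_germ z : V z -> germ_equiv Q (graph_pt Q z) Q 0.
Proof.
move=> Vz.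
pose A : 'M[C]_3 * 'cV[C]_3 :=
  (mx3 1 0 0 0 1 0 (- z.2) (- z.1) 1, pt (- z.1) (- z.2) (z.1 * z.2)).
have AE x y u : aeval A (pt x y u) =
    pt (x - z.1) (y - z.2) (u - z.2 * x - z.1 * y + z.1 * z.2).
  by rewrite /aeval mx3_pt pt_add; congr pt; ring.
apply: (@germ_of_near _ (fun w => w iu 0 = w ix 0 * w iy 0) A) => //.
- by rewrite /quadric_fn mulr0.
- move=> z' Vz'.
  have : \forall w \near graph_pt Q z', V ((w : 'cV[C]_3) ix 0, w iy 0).
    by apply: near_dom; rewrite /graph_pt ptx pty -surjective_pairing.
  apply: (filterS (Filter := nbhs_filter _)) => w Vw.
  by rewrite graphE; split=> [[]|].
- apply: (@mx3_mul_eq1 _ _ _ _ _ _ _ _ _ _ 1 0 0 0 1 0 z.2 z.1 1); split; ring.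
- rewrite /graph_pt AE /= /quadric_fn; apply/colP => -[[|[|[|i]]] Hi]; rewrite !mxE //=; ring.
- move=> w; rewrite [w]ptE AE !ptx !pty !ptu; split=> [->|h]; first by ring.
  have -> : w iu 0 = w iu 0 - z.2 * w ix 0 - z.1 * w iy 0 + z.1 * z.2
     + z.2 * w ix 0 + z.1 * w iy 0 - z.1 * z.2 by ring.
  by rewrite h; ring.
Qed.

Lemma quadric_normalized : normalized (quadric_coef R).
Proof. by []. Qed.

Lemma quadric_normal_form z : V z -> normal_form Q (graph_pt Q z) (quadric_coef R).
Proof.
move=> Vz; split; first exact: quadric_normalized.
exists Q; split; [exact: quadric_local_surface|exact: V0|exact: quadric_has_expansion|].
exact: quadric_germ.
Qed.

Hypothesis V1 : forall z, V z -> `|z.1 * z.2| < 1.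

Let S0 := Surface V (@sqrt_fn R).

Lemma Re_sqrt_gt0 z : V z -> 0 < Re (sqrtC' (1 - z.1 * z.2)).
Proof. by move=> /V1 h; apply/Re_sqrtc_gt0/Re_one_sub_gt0. Qed.

Lemma sqrt_branch z : V z -> [/\ \forall w \near 1 - z.1 * z.2, sqrtC' w ^+ 2 = w,
  {for 1 - z.1 * z.2, continuous sqrtC'} & sqrtC' (1 - z.1 * z.2) != 0].
Proof.
move=> /Re_sqrt_gt0 h; split.
- by apply: (@filterE _ _ (nbhs_filter _)) => w; exact: sqrtc_sq.
- exact: continuous_sqrtc.
- exact: Re_gt0_neq0.
Qed.

Lemma sqrt_local_surface : local_surface S0.
Proof.
split; [exact: oV|move=> z Vz..].
  exact: (@differentiable_sqrt_surface C sqrtC' V sqrt_branch z Vz).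
exact: (@hessian_sqrt_surface C sqrtC' V oV sqrt_branch z Vz).
Qed.

(** The quadric has two sheets over [(x, y)]; near a point of the graph, the sign of the real part of
    [2 - u] selects the one of the principal square root. *)
Lemma near_sqrt_graph z : V z -> \forall w \near graph_pt S0 z,
  graph S0 w <-> ((w : 'cV[C]_3) iu 0 - 2) ^+ 2 + 4 * w ix 0 * w iy 0 = 4.
Proof.
move=> Vz.
have n1 : \forall w \near graph_pt S0 z, V ((w : 'cV[C]_3) ix 0, w iy 0).
  by apply: near_dom; rewrite /graph_pt ptx pty -surjective_pairing.
set u0 := (graph_pt S0 z) iu 0.
have u0E : u0 = 2 - 2 * sqrtC' (1 - z.1 * z.2) by rewrite /u0 /graph_pt ptu.
have h0 := Re_sqrt_gt0 Vz; set s0 := sqrtC' _ in h0 u0E.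
have s0' : 0 < (Re s0)%:C%C :> C by rewrite ltcR.
have n2 := (@cvgrPdist_lt _ _ _ _ (nbhs_filter _) _ _).1 (@cvg_coord (graph_pt S0 z) iu) _ s0'.
near=> w.
have Vw : V (w ix 0, w iy 0) by near: w; exact: n1.
have w2 : `|u0 - w iu 0| < (Re s0)%:C%C by near: w; exact: n2.
rewrite graphE /sqrt_fn /=; set s := sqrtC' (1 - w ix 0 * w iy 0).
have s2 : s ^+ 2 = 1 - w ix 0 * w iy 0 by exact: sqrtc_sq.
split=> [[_ ->]|h].
  have -> : (2 - 2 * s - 2) ^+ 2 = 4 * s ^+ 2 by ring.
  by rewrite s2; ring.
split=> //.
(* the square root of [1 - x y] read on the coordinate [u] *)
pose r : C := (2 - w iu 0) / 2.
have r2 : r ^+ 2 = 1 - w ix 0 * w iy 0.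
  have -> : r ^+ 2 = ((w iu 0 - 2) ^+ 2 + 4 * w ix 0 * w iy 0) / 4 - w ix 0 * w iy 0.
    by rewrite /r; field.
  by rewrite h; field.
have rE : r = s0 + (u0 - w iu 0) / 2 by rewrite /r u0E; field.
have r0 : 0 < Re r.
  have : Re (- ((u0 - w iu 0) / 2)) < Re s0.
    apply: Re_lt_norm; rewrite normrN normrM; apply: le_lt_trans w2.
    rewrite ler_piMr// normfV normr_nat invf_le1 ?ltr0n// ler1n //.
  by rewrite rE ReD ReN -subr_gt0 opprK.
have : r = s by exact: sqrtc_uniq.
move=> <-; rewrite /r; field.
Unshelve. all: by end_near. Qed.

Lemma sqrt_fn0 : @sqrt_fn R (0, 0) = 0.
Proof.
have E : 1 = sqrtC' (1 - (0 : C) * 0).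
  by apply: sqrtc_uniq; [rewrite mulr0 subr0 expr1n|exact: ltr01].
have -> : @sqrt_fn R (0, 0) = 2 - 2 * sqrtC' (1 - (0 : C) * 0) by [].
by rewrite -E mulr1 subrr.
Qed.

(** The quadratic form [(u - 2) ^ 2 + 4 x y] takes the same value at the point above [z] and at the
    origin, so its orthogonal group moves one to the other. *)
Lemma sqrt_germ z : V z -> germ_equiv S0 (graph_pt S0 z) S0 0.
Proof.
move=> Vz; pose s := sqrtC' (1 - z.1 * z.2); pose x := z.1; pose y := z.2.
have s2 : s ^+ 2 = 1 - x * y by exact: sqrtc_sq.
pose e := 1 + s.
have e0 : e != 0.
  by apply: Re_gt0_neq0; rewrite ReD Re1 ltr_wpDr ?ltr01//; exact/ltW/Re_sqrt_gt0.
(* [w |-> - w + 2 B (w, v) / B (v, v) * v], minus the reflection along [v = w0 + w1], where [w0]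
   is the point above [z] and [w1] the origin, both seen from the centre [(0, 0, 2)] *)
pose A : 'M[C]_3 * 'cV[C]_3 :=
  (mx3 (- e / 2) (x ^+ 2 / (2 * e)) (- x / 2) (y ^+ 2 / (2 * e)) (- e / 2) (- y / 2)
       (- y) (- x) s, pt x y (2 - 2 * s)).
have AE a b u : aeval A (pt a b u) =
    pt (- e / 2 * a + x ^+ 2 / (2 * e) * b - x / 2 * u + x)
       (y ^+ 2 / (2 * e) * a - e / 2 * b - y / 2 * u + y)
       (- y * a - x * b + s * u + (2 - 2 * s)).
  by rewrite /aeval mx3_pt pt_add; congr pt; ring.
apply: (@germ_of_near _ (fun w => (w iu 0 - 2) ^+ 2 + 4 * w ix 0 * w iy 0 = 4) A) => //.
- exact: sqrt_fn0.
- exact: near_sqrt_graph.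
- exact: reflection_unit e0 s2.
- rewrite /graph_pt AE; have [-> -> ->] := reflection_base e0 s2.
  by apply/colP => -[[|[|[|i]]] Hi]; rewrite !mxE.
- by move=> w; rewrite [w]ptE AE !ptx !pty !ptu (reflection_quad e0 s2).
Qed.

Lemma sqrt_normalized : normalized (sqrt_I R).
Proof.
move=> [|[|[|[|j]]]] [|[|[|[|k]]]] //= _ _ _;
  rewrite /sqrt_I /diag_coef /= ?sqrt_coef0 ?sqrt_coef1 ?mul0r ?mul1r ?expr1n //.
Qed.

Lemma sqrt_normal_form z : V z -> normal_form S0 (graph_pt S0 z) (sqrt_I R).
Proof.
move=> Vz; split; first exact: sqrt_normalized.
exists S0; split; [exact: sqrt_local_surface|exact: V0|exact: sqrt_has_expansion|].
exact: sqrt_germ.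
Qed.

End Models.

(** * Equivalence with the models *)
Lemma dfn_dilated (K : numFieldType) (G I : nat -> nat -> K) (f : K * K -> K) m x y :
  m != 0 -> (forall j k, dilated m G j k = I j k) ->
  psum I 0 0 (m^-1 * x, y) n @[n --> \oo] --> f (m^-1 * x, y) ->
  dfn G 0 0 (x, y) = m * f (m^-1 * x, y).
Proof.
move=> m0 GI If; apply: cvg_lim => //.
have -> : (fun n => psum G 0 0 (x, y) n) = (fun n => m * psum I 0 0 (m^-1 * x, y) n).
  apply/funext => n; rewrite /psum mulr_sumr; apply: eq_bigr => j _.
  rewrite mulr_sumr; apply: eq_bigr => k _.
  rewrite -GI /dilated !dmon0 /= exprMn exprVn.
  by field; rewrite !natfact_neq0 m0 expf_neq0.
exact: cvgMr.
Qed.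

Lemma cvg_mull0 (K : numFieldType) (T : Type) (F : set_system T) (FF : Filter F)
  (f : T -> K) k : f t @[t --> F] --> 0 -> k * f t @[t --> F] --> 0.
Proof. by move=> f0; rewrite -[X in _ --> X](mulr0 k); exact: cvgMr. Qed.

(** [(a d - c b) ^ 2 = k ^ 2 - 4 a b c d] is nonzero, and the last two equations are linear in
    [p] and [q] with this determinant. *)
Lemma rank2_eq0 (K : numFieldType) (a b c d k p q : K) : k != 0 ->
  0 = 2 * a * c -> k = a * d + c * b -> 0 = 2 * b * d ->
  0 = 2 * (q * a + p * c) -> 0 = 2 * (q * b + p * d) -> p = 0 /\ q = 0.
Proof.
move=> k0 ac kE bd e1 e2.
have D0 : a * d - c * b != 0.
  suff : (a * d - c * b) ^+ 2 != 0 by rewrite expf_eq0.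
  suff -> : (a * d - c * b) ^+ 2 = k ^+ 2 by rewrite expf_neq0.
  transitivity (k ^+ 2 - 2 * a * c * (2 * b * d)); first by rewrite kE; ring.
  by rewrite -ac; ring.
have n2 : 2 != 0 :> K by rewrite pnatr_eq0.
split; apply: (mulfI (mulf_neq0 n2 D0)); rewrite mulr0.
  transitivity (a * (2 * (q * b + p * d)) - b * (2 * (q * a + p * c))); first by ring.
  by rewrite -e1 -e2 !mulr0 subrr.
transitivity (d * (2 * (q * a + p * c)) - c * (2 * (q * b + p * d))); first by ring.
by rewrite -e1 -e2 !mulr0 subrr.
Qed.

Lemma rank2_product (K : numFieldType) (a b c d k t y : K) :
  0 = 2 * a * c -> k = a * d + c * b -> 0 = 2 * b * d ->
  (a * t + b * (t * y) + 0) * (c * t + d * (t * y) + 0) = k * (t ^+ 2 * y).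
Proof.
move=> ac -> bd.
transitivity ((a * d + c * b) * (t ^+ 2 * y) + (2 * a * c) / 2 * t ^+ 2
  + (2 * b * d) / 2 * (t * y) ^+ 2); first by field.
by rewrite -ac -bd; ring.
Qed.

Lemma dfn_inj_near (K : numFieldType) (G G' : nat -> nat -> K) r r' :
  square_summable_cvg K -> 0 < r -> 0 < r' -> abs_bounded G r -> abs_bounded G' r' ->
  (forall y, \forall t \near 0^', dfn G 0 0 (0 + (t, t * y)) = dfn G' 0 0 (0 + (t, t * y))) ->
  forall j k, G j k = G' j k.
Proof.
move=> Kc r0 r'0 Gr Gr' H j k.
apply: (@line_coef_inj _ (j + k)) => // y.
have z1 (x : K) : 0 < x -> `|(0 : K * K).1| < x by rewrite normr0.
have z2 (x : K) : 0 < x -> `|(0 : K * K).2| < x by rewrite normr0.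
have T1 := taylor_line 0 0 y Kc Gr (z1 _ r0) (z2 _ r0).
have T2 := taylor_line 0 0 y Kc Gr' (z1 _ r'0) (z2 _ r'0).
have E0 (F : nat -> nat -> K) : shiftc 0 0 (fun a b => dfn F a b 0) = F.
  by apply/funext => a; apply/funext => b; exact: dfn_at0.
rewrite !E0 in T1 T2.
apply: (proj2 (expands_sub (j + k).+1 T1 T2)) => //.
apply: ord_ge_near (ord_ge0 K (j + k).+1); have := H y; apply: filterS => t ->.
by rewrite subrr.
Qed.

Section Equivalences.
Variable R : realType.
Notation C := (Cplx R).
Implicit Types (S T : surface R) (p q : 'cV[C]_3) (G : nat -> nat -> C).

Lemma near_scaled (P : C * C -> Prop) (a b : C) : (\forall z \near (0 : C * C), P z) ->
  \forall w \near (0 : 'cV[C]_3), P (a * (w : 'cV[C]_3) ix 0, b * w iy 0).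
Proof.
move=> nP.
have c i k : k * (w : 'cV[C]_3) i 0 @[w --> (0 : 'cV[C]_3)] --> (0 : C).
  apply: (@cvg_mull0 _ _ _ (nbhs_filter _)).
  have E : (0 : 'cV[C]_3) i 0 = 0 by rewrite mxE.
  by have := @cvg_coord R 0 i; rewrite E.
exact: (@cvg_pair_at C _ _ (nbhs_filter (0 : 'cV[C]_3)) _ _ 0 (c ix a) (c iy b)).
Qed.

Lemma near_bidisk (r : C) : 0 < r -> \forall z \near (0 : C * C), `|z.1| < r /\ `|z.2| < r.
Proof.
move=> r0; apply/nbhs_ballP; exists r => //= z [/= z1 z2].
by move: z1 z2; rewrite /ball /= !sub0r !normrN.
Qed.

Lemma has_expansion_psum (f : C * C -> C) G : has_expansion f G ->
  exists2 r : C, 0 < r & forall z, `|z.1| < r -> `|z.2| < r ->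
    psum G 0 0 z n @[n --> \oo] --> f z.
Proof.
move=> fG; have [r r0 [Gr fE]] := has_expansionP fG; exists r => // z z1 z2.
by rewrite fE//; exact: (dfn_cvg (@complexC R) Gr).
Qed.

(** The diagonal map [(x, y, u) |-> (x / m, y, u / m)] takes one graph to the other. *)
Lemma germ_of_dilated_coefs T G S I m : m != 0 -> (forall j k, dilated m G j k = I j k) ->
  open (dom T) -> dom T (0, 0) -> has_expansion (fn T) G ->
  open (dom S) -> dom S (0, 0) -> has_expansion (fn S) I -> germ_equiv T 0 S 0.
Proof.
move=> m0 GI oT T0 TG oS S0 SI.
have [r r0 [Gr fT]] := has_expansionP TG.
have [r' r'0 fS] := has_expansion_psum SI.
exists (mx3 m^-1 0 0 0 1 0 0 0 m^-1, 0); split.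
- apply: (@mx3_mul_eq1 _ _ _ _ _ _ _ _ _ _ m 0 0 0 1 0 0 0 m); split;
    rewrite ?(mulr0, mul0r, mulr1, mul1r, addr0, add0r) // mulVf //.
- by rewrite /aeval mulmx0 addr0.
have n1 := near_scaled 1 1 (open_nbhs_nbhs (conj oT T0)).
have n2 := near_scaled 1 1 (near_bidisk r0).
have n3 := near_scaled m^-1 1 (near_bidisk r'0).
have n4 := near_scaled m^-1 1 (open_nbhs_nbhs (conj oS S0)).
near=> w.
have : dom T (1 * (w : 'cV[C]_3) ix 0, 1 * w iy 0) by near: w; exact: n1.
have : `|1 * w ix 0| < r /\ `|1 * w iy 0| < r by near: w; exact: n2.
have : `|m^-1 * w ix 0| < r' /\ `|1 * w iy 0| < r' by near: w; exact: n3.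
have : dom S (m^-1 * w ix 0, 1 * w iy 0) by near: w; exact: n4.
rewrite !mul1r => Sw [x1 y1] [x2 y2] Tw.
have TE : fn T (w ix 0, w iy 0) = m * fn S (m^-1 * w ix 0, w iy 0).
  rewrite fT//; apply: dfn_dilated m0 GI _; exact: fS.
have -> : aeval (mx3 m^-1 0 0 0 1 0 0 0 m^-1, 0) w = pt (m^-1 * w ix 0) (w iy 0) (m^-1 * w iu 0).
  rewrite /aeval addr0 {1}[w]ptE mx3_pt.
  by congr pt; rewrite !mul0r ?mul1r ?addr0 ?add0r.
have -> : T = Surface (dom T) (fn T) by case: (T).
have -> : S = Surface (dom S) (fn S) by case: (S).
rewrite !graphE ptx pty ptu; split=> [[_ ->]|[_ h]]; split=> //.
  by rewrite TE mulKf.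
by rewrite TE -h mulVKf.
Unshelve. all: by end_near. Qed.

Definition bidisk : set (C * C) := ball (0 : C * C) 1.

Lemma open_bidisk : open bidisk.
Proof. by apply: ball_open; exact: ltr01. Qed.

Lemma bidisk0 : bidisk (0, 0).
Proof. exact: (ballxx _ ltr01). Qed.

Lemma bidisk_xy z : bidisk z -> `|z.1 * z.2| < 1.
Proof.
move=> [/= z1 z2]; move: z1 z2; rewrite /ball /= !sub0r !normrN => z1 z2.
by rewrite normrM mulr_ilt1.
Qed.

Lemma in_B3_sqrt (V : set (C * C)) : open V -> V (0, 0) ->
  (forall z, V z -> `|z.1 * z.2| < 1) -> in_B3 (Surface V (@sqrt_fn R)).
Proof.
move=> oV V0 V1 p [z Vz ->]; exists (sqrt_I R); split; first exact: sqrt_normal_form.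
  by rewrite /sqrt_I /diag_coef.
by rewrite /sqrt_I /diag_coef.
Qed.

Lemma in_B3_quadric (V : set (C * C)) : open V -> V (0, 0) ->
  in_B3 (Surface V (@quadric_fn R)).
Proof.
by move=> oV V0 p [z Vz ->]; exists (quadric_coef R); split; first exact: quadric_normal_form.
Qed.

Lemma sqrt_I22 : sqrt_I R 2%N 2%N = 1.
Proof. by rewrite /sqrt_I /diag_coef eqxx sqrt_coef2 -[2`!%N]/2%N; field. Qed.

Lemma sqrt_I_unique S p G : in_B3 S -> normal_form S p G -> G 2%N 2%N = 1 ->
  forall j k, G j k = sqrt_I R j k.
Proof.
move=> BS nf g22.
have nf0 := sqrt_normal_form open_bidisk bidisk0 bidisk_xy bidisk0.
apply: normal_form_uniq BS (in_B3_sqrt open_bidisk bidisk0 bidisk_xy) nf nf0 _.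
by rewrite g22 sqrt_I22.
Qed.

Lemma quadric_unique S p G : in_B3 S -> normal_form S p G -> G 2%N 2%N = 0 ->
  G = quadric_coef R.
Proof.
move=> BS nf g22; apply/funext => j; apply/funext => k.
have nf0 := quadric_normal_form open_bidisk bidisk0 bidisk0.
exact: (normal_form_uniq BS (in_B3_quadric open_bidisk bidisk0) nf nf0 g22 j k).
Qed.

(** The dilation with [m = 1 / G 2 2] makes the coefficient [(2, 2)] equal to 1. *)
Lemma sqrt_germ_equiv (V : set (C * C)) S p G : open V -> V (0, 0) ->
  in_B3 S -> normal_form S p G -> G 2%N 2%N != 0 ->
  germ_equiv S p (Surface V (@sqrt_fn R)) 0.
Proof.
move=> oV V0 BS nf g22.
have GI : forall j k, dilated (G 2%N 2%N)^-1 G j k = sqrt_I R j k.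
  have nf0 := sqrt_normal_form open_bidisk bidisk0 bidisk_xy bidisk0.
  have m0 : (G 2%N 2%N)^-1 != 0 by rewrite invr_eq0.
  have nG := nf.1; have nI := @sqrt_normalized R.
  have D0 j k : (j, k) != (1, 1)%N -> G j k = 0 -> sqrt_I R j k = 0 ->
      dilated (G 2%N 2%N)^-1 G j k = sqrt_I R j k.
    by move=> _ h1 ->; rewrite /dilated h1 mulr0.
  have E11 : dilated (G 2%N 2%N)^-1 G 1%N 1%N = sqrt_I R 1%N 1%N.
    by rewrite /dilated expr1 divff// mul1r nG// nI.
  have E22 : dilated (G 2%N 2%N)^-1 G 2%N 2%N = sqrt_I R 2%N 2%N.
    by rewrite sqrt_I22 /dilated expr2 mulfK// mulVf.
  apply: (solves_pde_uniq (solves_pde_dilated m0 (in_B3_solves_pde BS nf))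
    (in_B3_solves_pde (in_B3_sqrt open_bidisk bidisk0 bidisk_xy) nf0)).
  - move=> [|[|[|j]]] [|[|[|k]]] // _ _; try exact: E11; try exact: E22;
    by apply: D0 => //; rewrite ?nG ?nI.
  - by rewrite /dilated (nG 2%N 0%N)//= mulr0.
  - by rewrite /dilated (nG 0%N 2%N)//= mulr0.
  - by rewrite E11 nI.
have [_ [T [LT T0 TG e]]] := nf.
apply: germ_equiv_trans e _.
have oT : open (dom T) by case: LT.
have m0 : (G 2%N 2%N)^-1 != 0 by rewrite invr_eq0.
exact: (@germ_of_dilated_coefs T G (Surface V (@sqrt_fn R)) (sqrt_I R) _ m0 GI oT T0 TG oV V0
  (@sqrt_has_expansion R)).
Qed.

Lemma quadric_germ_equiv (V : set (C * C)) S p G : open V -> V (0, 0) ->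
  in_B3 S -> normal_form S p G -> G 2%N 2%N = 0 ->
  germ_equiv S p (Surface V (@quadric_fn R)) 0.
Proof.
move=> oV V0 BS nf g22; have GI := quadric_unique BS nf g22.
have [_ [T [LT T0 TG e]]] := nf.
apply: germ_equiv_trans e _.
have oT : open (dom T) by case: LT.
have D j k : dilated 1 G j k = quadric_coef R j k.
  by rewrite /dilated GI expr1n divr1 mul1r.
exact: (@germ_of_dilated_coefs T G (Surface V (@quadric_fn R)) (quadric_coef R) _
  (oner_neq0 _) D oT T0 TG oV V0 (@quadric_has_expansion R)).
Qed.

(** A normal form [G] of the germ of [u = x y], of whatever cubic part, comes with an affine map of
    linear part [A.1] to this germ. In [osculation] the coefficients [G 2 1] and [G 1 2] vanish,
    and so does the linear form [(r, s)]; then [x] and [y] are mapped to linear forms in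
    [x] and [y], and the function of [G] is exactly [x y]. *)
Lemma quadric_normal_form_rigid (V : set (C * C)) S p G : open V -> V (0, 0) ->
  germ_equiv S p (Surface V (@quadric_fn R)) 0 -> normal_form S p G ->
  forall j k, G j k = quadric_coef R j k.
Proof.
move=> oV V0 eQ [nG [T [LT T0 TG e]]].
have [A [uA A0 nA]] := germ_equiv_trans (germ_equiv_sym e) eQ.
have [r r0 [Gr fTG]] := has_expansionP TG.
have h0 : `|(0 : C * C).1| < r by rewrite normr0.
have h0' : `|(0 : C * C).2| < r by rewrite normr0.
have g0 : graph_pt T 0 = 0 := graph_pt0 TG nG.
have [] := @germ_contact R T G r 0 (Surface V (@quadric_fn R)) (quadric_coef R) A LT T0 Gr
  h0 h0' fTG (@quadric_has_expansion R); rewrite ?g0//.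
move=> r' [Gr' r'0] H.
have nQ := @normalized_jets R (quadric_coef R) (@quadric_normalized R) erefl erefl.
have [[k0 M20 M21] [h20 h11 h02] [_ h21] [h12 _]] :=
  osculation (@complexC R) Gr h0 h0' Gr' r'0 uA nQ H.
rewrite !dfn_at0 in M20 M21 h20 h11 h02 h21 h12.
rewrite !nG //= in M20 M21 h20 h11 h02 h21 h12.
rewrite !(mulr0, addr0, mulr1, mul0r, add0r) in M20 M21 h20 h11 h02 h21 h12.
have [m02 m12] := rank2_eq0 k0 h20 h11 h02 h21 h12.
apply: (dfn_inj_near (@complexC R) r0 r'0 Gr Gr') => y.
near=> t.
have E : let d := dfn G 0 0 (0 + (t, t * y)) - dfn G 0 0 0 in
  A.1 iu ix * t + A.1 iu iy * (t * y) + A.1 iu iu * d =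
  dfn (quadric_coef R) 0 0 (A.1 ix ix * t + A.1 ix iy * (t * y) + A.1 ix iu * d,
                            A.1 iy ix * t + A.1 iy iy * (t * y) + A.1 iy iu * d).
  by near: t; exact: (H y).
move: E => /=; set d := _ - dfn G 0 0 0 => E.
rewrite M20 M21 m02 m12 dfn_quadric !mul0r !add0r in E.
have {}E : A.1 iu iu * d = A.1 iu iu * (t ^+ 2 * y).
  by rewrite E; exact: rank2_product h20 h11 h02.
have G00 : G 0%N 0%N = 0 := nG 0%N 0%N isT isT isT.
have := mulfI k0 E; rewrite /d dfn_at0 G00 subr0 => ->.
by rewrite dfn_quadric add0r /= mulrA -expr2.
Unshelve. all: by end_near. Qed.

End Equivalences.

(** * Equations of the symmetry algebras *)
Section SpanLemmas.
Variables (K : fieldType) (V : vectType K).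
Implicit Types (a b c d v : V).

Lemma mem_span3 a b c v :
  v \in <<[:: a; b; c]>>%VS <-> exists k l m, v = k *: a + l *: b + m *: c.
Proof.
rewrite !span_cons span_nil addv0; split.
  move=> /memv_addP[_ /vlineP[k ->] [_ /memv_addP[_ /vlineP[l ->] [_ /vlineP[m ->] ->]] ->]].
  by exists k, l, m; rewrite addrA.
move=> [k [l [m ->]]]; rewrite -addrA.
by rewrite !memv_add ?memvZ ?memv_line.
Qed.

Lemma mem_span4 a b c d v :
  v \in <<[:: a; b; c; d]>>%VS <-> exists k l m n, v = k *: a + l *: b + m *: c + n *: d.
Proof.
rewrite span_cons; split.
  move=> /memv_addP[_ /vlineP[k ->] [w /mem_span3[l [m [n ->]]] ->]].
  by exists k, l, m, n; rewrite !addrA.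
move=> [k [l [m [n ->]]]]; rewrite -!addrA memv_add ?memvZ ?memv_line//.
by apply/mem_span3; exists l, m, n; rewrite addrA.
Qed.

Lemma mem_span2 a b v : v \in <<[:: a; b]>>%VS <-> exists k l, v = k *: a + l *: b.
Proof.
rewrite !span_cons span_nil addv0; split.
  by move=> /memv_addP[_ /vlineP[k ->] [_ /vlineP[l ->] ->]]; exists k, l.
by move=> [k [l ->]]; rewrite memv_add ?memvZ ?memv_line.
Qed.

End SpanLemmas.

Section GenericSymmetry.
Variable K : numFieldType.

(** Each substitution in [u = p t ^ 2 + u ^ 2 / 4] improves the approximation by two orders. *)
Lemma ord_ge_sq_branch (p : K) (u : K -> K) : ord_ge 2 u ->
  (\forall t \near 0^', u t = p * t ^+ 2 + u t ^+ 2 / 4) ->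
  ord_ge 6 (fun t => u t - (p * t ^+ 2 + p ^+ 2 / 4 * t ^+ 4)).
Proof.
move=> u2 uE.
have p2 : ord_ge 2 (fun t : K => p * t ^+ 2) by apply: ord_geMl; exact: ord_ge_pow.
have u4 : ord_ge 4 (fun t => u t - p * t ^+ 2).
  apply: ord_ge_near (ord_geMl 4^-1 (ord_geM u2 u2)).
  by apply: filterS uE => t E; rewrite {3}E; field.
apply: ord_ge_near (ord_geMl 4^-1 (ord_geM u4 (ord_geD u2 p2))).
by apply: filterS uE => t E; rewrite [in RHS]E; field.
Qed.

(** With [u = y t ^ 2 + u ^ 2 / 4] the tangency condition becomes linear in [u]; its coefficients of
    [t ^ 0, ..., t ^ 4] are polynomials in [y] that vanish identically. *)
Lemma sqrt_symmetry (m11 m12 m13 b1 m21 m22 m23 b2 m31 m32 m33 b3 : K) :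
  (forall y, exists u : K -> K, [/\ ord_ge 2 u,
     \forall t \near 0^', u t = y * t ^+ 2 + u t ^+ 2 / 4
   & \forall t \near 0^',
       t * y * (m11 * t + m12 * (t * y) + m13 * u t + b1)
       + t * (m21 * t + m22 * (t * y) + m23 * u t + b2)
       = (1 - u t / 2) * (m31 * t + m32 * (t * y) + m33 * u t + b3)]) ->
  [/\ b3 = 0, m33 = 0, m12 = 0 & m21 = 0] /\
  [/\ m11 = - m22, m31 = b2, m32 = b1, m13 = - b1 / 2 & m23 = - b2 / 2].
Proof.
move=> H.
pose q y := y * m13 + m23 + (m31 + m32 * y) / 2.
pose c (y : K) (i : nat) := [:: - b3; y * b1 + b2 - m31 - m32 * y;
   m21 + (m11 + m22 - m33 + b3 / 2) * y + m12 * y ^+ 2; q y * y;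
   (m33 + b3 / 2) * y ^+ 2 / 4]`_i.
have c0 y i : (i < 5)%N -> c y i = 0.
  move=> i5; apply: (ord_ge_poly_eq0 (n := 5)) => // {i i5}.
  have [u [u2 uE uS]] := H y.
  pose w t := u t - (y * t ^+ 2 + y ^+ 2 / 4 * t ^+ 4).
  have w5 : ord_ge 5 w := ord_ge_leq (isT : (5 <= 6)%N) (ord_ge_sq_branch u2 uE).
  have Ot : ord_ge 0 (fun t : K => t) by exact: ord_ge_leq (ord_ge_id K).
  have O1 : ord_ge 5 (fun t => w t * (m33 + b3 / 2 + q y * t)).
    rewrite -[5%N]addn0; apply: ord_geM => //.
    by apply: ord_geD; [exact: ord_ge_cst|exact: ord_geMl].
  have O2 : ord_ge 5 (fun t : K => q y * y ^+ 2 / 4 * t ^+ 5).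
    by apply: ord_geMl; exact: ord_ge_pow.
  apply: ord_ge_near (ord_geN (ord_geD O1 O2)).
  apply: filterS2 uE uS => t uE uS.
  have u2E : u t ^+ 2 - 4 * (u t - y * t ^+ 2) = 0 by rewrite {2}uE; field.
  have L : (t * y * (m11 * t + m12 * (t * y) + m13 * u t + b1)
       + t * (m21 * t + m22 * (t * y) + m23 * u t + b2)) -
       (1 - u t / 2) * (m31 * t + m32 * (t * y) + m33 * u t + b3) = 0 by rewrite uS subrr.
  transitivity ((t * y * (m11 * t + m12 * (t * y) + m13 * u t + b1)
       + t * (m21 * t + m22 * (t * y) + m23 * u t + b2)) -
       (1 - u t / 2) * (m31 * t + m32 * (t * y) + m33 * u t + b3)
     - (w t * (m33 + b3 / 2 + q y * t) + q y * y ^+ 2 / 4 * t ^+ 5)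
     - m33 / 2 * (u t ^+ 2 - 4 * (u t - y * t ^+ 2))).
    by rewrite L u2E; ring.
  rewrite !big_ord_recl big_ord0 /c /= /bump /= !(addn0, add1n) /w /q.
  by field.
have b30 : b3 = 0 by have := c0 0 0%N isT; rewrite /c /= => /eqP; rewrite oppr_eq0 => /eqP.
have [e1 e2 _ _] : [/\ b2 - m31 = 0, b1 - m32 = 0, (0 : K) = 0 & (0 : K) = 0].
  by apply: cubic_eq0 => y; rewrite -[RHS](c0 y 1%N isT) /c /=; ring.
have [e3 e4 e5 _] : [/\ m21 = 0, m11 + m22 - m33 + b3 / 2 = 0, m12 = 0 & (0 : K) = 0].
  by apply: cubic_eq0 => y; rewrite -[RHS](c0 y 2%N isT) /c /=; ring.
have [_ e6 e7 _] : [/\ (0 : K) = 0, m23 + m31 / 2 = 0, m13 + m32 / 2 = 0 & (0 : K) = 0].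
  by apply: cubic_eq0 => y; rewrite -[RHS](c0 y 3%N isT) /c /= /q; ring.
have [_ _ e8 _] : [/\ (0 : K) = 0, (0 : K) = 0, (m33 + b3 / 2) / 4 = 0 & (0 : K) = 0].
  by apply: cubic_eq0 => y; rewrite -[RHS](c0 y 4%N isT) /c /=; ring.
have m33E : m33 = 0.
  by transitivity (4 * ((m33 + b3 / 2) / 4) - b3 / 2); [field|rewrite e8 b30; ring].
have m31E : m31 = b2 by apply/esym/eqP; rewrite -subr_eq0 e1.
have m32E : m32 = b1 by apply/esym/eqP; rewrite -subr_eq0 e2.
split; split=> //.
- by transitivity (m11 + m22 - m33 + b3 / 2 - m22 + m33 - b3 / 2); [ring|rewrite e4 m33E b30; ring].
- by transitivity (m13 + m32 / 2 - m32 / 2); [ring|rewrite e7 m32E; ring].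
- by transitivity (m23 + m31 / 2 - m31 / 2); [ring|rewrite e6 m31E; ring].
Qed.

Lemma quadric_symmetry (m11 m12 m13 b1 m21 m22 m23 b2 m31 m32 m33 b3 : K) :
  (forall y, \forall t \near 0^',
       t * y * (m11 * t + m12 * (t * y) + m13 * (t * (t * y)) + b1)
       + t * (m21 * t + m22 * (t * y) + m23 * (t * (t * y)) + b2)
       = m31 * t + m32 * (t * y) + m33 * (t * (t * y)) + b3) ->
  [/\ b3 = 0, m12 = 0, m21 = 0, m13 = 0 & m23 = 0] /\
  [/\ m33 = m11 + m22, m31 = b2 & m32 = b1].
Proof.
move=> H.
pose c (y : K) (i : nat) := [:: - b3; y * b1 + b2 - m31 - m32 * y;
   m21 + (m11 + m22 - m33) * y + m12 * y ^+ 2; m23 * y + m13 * y ^+ 2]`_i.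
have c0 y i : (i < 4)%N -> c y i = 0.
  move=> i4; apply: (ord_ge_poly_eq0 (n := 4)) => // {i i4}.
  apply: ord_ge_near (ord_ge0 K 4); have := H y; apply: filterS => t E.
  rewrite !big_ord_recl big_ord0 /c /= /bump /= !(addn0, add1n).
  move/eqP: E; rewrite -subr_eq0 => /eqP E.
  by rewrite -[LHS]E; ring.
have b30 : b3 = 0 by have := c0 0 0%N isT; rewrite /c /= => /eqP; rewrite oppr_eq0 => /eqP.
have [e1 e2 _ _] : [/\ b2 - m31 = 0, b1 - m32 = 0, (0 : K) = 0 & (0 : K) = 0].
  by apply: cubic_eq0 => y; rewrite -[RHS](c0 y 1%N isT) /c /=; ring.
have [e3 e4 e5 _] : [/\ m21 = 0, m11 + m22 - m33 = 0, m12 = 0 & (0 : K) = 0].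
  by apply: cubic_eq0 => y; rewrite -[RHS](c0 y 2%N isT) /c /=; ring.
have [_ e6 e7 _] : [/\ (0 : K) = 0, m23 = 0, m13 = 0 & (0 : K) = 0].
  by apply: cubic_eq0 => y; rewrite -[RHS](c0 y 3%N isT) /c /=; ring.
split; split=> //; apply/esym/eqP; rewrite -subr_eq0 ?e1 ?e2 ?e4//.
Qed.

End GenericSymmetry.

(** * Affine vector fields in coordinates *)
Section Mx3Ops.
Variable K : fieldType.
Implicit Types a b c d e f g h i k : K.

Lemma mx3_ext (M N : 'M[K]_3) :
  M ix ix = N ix ix -> M ix iy = N ix iy -> M ix iu = N ix iu ->
  M iy ix = N iy ix -> M iy iy = N iy iy -> M iy iu = N iy iu ->
  M iu ix = N iu ix -> M iu iy = N iu iy -> M iu iu = N iu iu -> M = N.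
Proof.
move=> h1 h2 h3 h4 h5 h6 h7 h8 h9.
have E (k : 'I_3) : [\/ k = ix, k = iy | k = iu].
  by case: k => -[|[|[|k]]] kP //; [apply: Or31|apply: Or32|apply: Or33]; apply: val_inj.
by apply/matrixP => k l; case: (E k) => ->; case: (E l) => ->.
Qed.

Lemma mx3D a b c d e f g h i a' b' c' d' e' f' g' h' i' :
  mx3 a b c d e f g h i + mx3 a' b' c' d' e' f' g' h' i' =
  mx3 (a + a') (b + b') (c + c') (d + d') (e + e') (f + f') (g + g') (h + h') (i + i').
Proof. by apply: mx3_ext; rewrite !mxE. Qed.

Lemma mx3Z k a b c d e f g h i : k *: mx3 a b c d e f g h i =
  mx3 (k * a) (k * b) (k * c) (k * d) (k * e) (k * f) (k * g) (k * h) (k * i).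
Proof. by apply: mx3_ext; rewrite !mxE. Qed.

Lemma mx3N a b c d e f g h i : - mx3 a b c d e f g h i =
  mx3 (- a) (- b) (- c) (- d) (- e) (- f) (- g) (- h) (- i).
Proof. by apply: mx3_ext; rewrite !mxE. Qed.

Lemma mx3M a b c d e f g h i a' b' c' d' e' f' g' h' i' :
  mx3 a b c d e f g h i *m mx3 a' b' c' d' e' f' g' h' i' =
  mx3 (a * a' + b * d' + c * g') (a * b' + b * e' + c * h') (a * c' + b * f' + c * i')
      (d * a' + e * d' + f * g') (d * b' + e * e' + f * h') (d * c' + e * f' + f * i')
      (g * a' + h * d' + i * g') (g * b' + h * e' + i * h') (g * c' + h * f' + i * i').
Proof.
by apply: mx3_ext; rewrite mxE !big_ord_recl big_ord0 !mxE /= addr0 addrA.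
Qed.

Lemma mx3_eta (M : 'M[K]_3) : M = mx3 (M ix ix) (M ix iy) (M ix iu)
  (M iy ix) (M iy iy) (M iy iu) (M iu ix) (M iu iy) (M iu iu).
Proof. by apply: mx3_ext; rewrite !mxE. Qed.

End Mx3Ops.

Section AffineFields.
Variable R : realType.
Notation C := (Cplx R).
Local Notation affine := ('M[C]_3 * 'cV[C]_3)%type.

(** The field with components [a x + b y + c u + p], [d x + e y + f u + q] and
    [g x + h y + i u + r]. *)
Definition aff (a b c d e f g h i p q r : C) : affine := (mx3 a b c d e f g h i, pt p q r).

Lemma ptZ (k x y u : C) : k *: pt x y u = pt (k * x) (k * y) (k * u).
Proof. by apply/colP => -[[|[|[|i]]] Hi]; rewrite !mxE. Qed.

Lemma ptN (x y u : C) : - pt x y u = pt (- x) (- y) (- u).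
Proof. by apply/colP => -[[|[|[|i]]] Hi]; rewrite !mxE. Qed.

Lemma affN a b c d e f g h i p q r : - aff a b c d e f g h i p q r =
  aff (- a) (- b) (- c) (- d) (- e) (- f) (- g) (- h) (- i) (- p) (- q) (- r).
Proof. by rewrite /aff -mx3N -ptN. Qed.

Lemma affD a b c d e f g h i p q r a' b' c' d' e' f' g' h' i' p' q' r' :
  aff a b c d e f g h i p q r + aff a' b' c' d' e' f' g' h' i' p' q' r' =
  aff (a + a') (b + b') (c + c') (d + d') (e + e') (f + f') (g + g') (h + h') (i + i')
      (p + p') (q + q') (r + r').
Proof. by rewrite /aff -mx3D -pt_add. Qed.

Lemma affZ k a b c d e f g h i p q r : k *: aff a b c d e f g h i p q r =
  aff (k * a) (k * b) (k * c) (k * d) (k * e) (k * f) (k * g) (k * h) (k * i)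
      (k * p) (k * q) (k * r).
Proof. by rewrite /aff -mx3Z -ptZ. Qed.

Lemma aff_eta (X : affine) : X = aff (X.1 ix ix) (X.1 ix iy) (X.1 ix iu)
  (X.1 iy ix) (X.1 iy iy) (X.1 iy iu) (X.1 iu ix) (X.1 iu iy) (X.1 iu iu)
  (X.2 ix 0) (X.2 iy 0) (X.2 iu 0).
Proof. by rewrite /aff -mx3_eta -ptE -surjective_pairing. Qed.

Lemma aff_eval a b c d e f g h i p q r x y u :
  aeval (aff a b c d e f g h i p q r) (pt x y u) =
  pt (a * x + b * y + c * u + p) (d * x + e * y + f * u + q) (g * x + h * y + i * u + r).
Proof. by rewrite /aeval mx3_pt pt_add. Qed.

Lemma aff_bracket a b c d e f g h i p q r a' b' c' d' e' f' g' h' i' p' q' r' :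
  bracket (aff a b c d e f g h i p q r) (aff a' b' c' d' e' f' g' h' i' p' q' r') =
  aff (a' * a + b' * d + c' * g - (a * a' + b * d' + c * g'))
      (a' * b + b' * e + c' * h - (a * b' + b * e' + c * h'))
      (a' * c + b' * f + c' * i - (a * c' + b * f' + c * i'))
      (d' * a + e' * d + f' * g - (d * a' + e * d' + f * g'))
      (d' * b + e' * e + f' * h - (d * b' + e * e' + f * h'))
      (d' * c + e' * f + f' * i - (d * c' + e * f' + f * i'))
      (g' * a + h' * d + i' * g - (g * a' + h * d' + i * g'))
      (g' * b + h' * e + i' * h - (g * b' + h * e' + i * h'))
      (g' * c + h' * f + i' * i - (g * c' + h * f' + i * i'))
      (a' * p + b' * q + c' * r - (a * p' + b * q' + c * r'))
      (d' * p + e' * q + f' * r - (d * p' + e * q' + f * r'))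
      (g' * p + h' * q + i' * r - (g * p' + h * q' + i * r')).
Proof.
by rewrite /bracket /aff /= !mx3M !mx3_pt mx3N ptN mx3D pt_add.
Qed.

Lemma aff0 : 0 = aff 0 0 0 0 0 0 0 0 0 0 0 0.
Proof. by rewrite [LHS]aff_eta /= !mxE. Qed.

Lemma vfE (i : 'I_3) : vf R i =
  aff 0 0 0 0 0 0 0 0 0 (ix == i)%:R (iy == i)%:R (iu == i)%:R.
Proof.
rewrite [LHS]aff_eta /vf /= !mxE !eqxx !andbT.
by [].
Qed.

Lemma lvfE (i j : 'I_3) : lvf R i j =
  aff ((ix == j) && (ix == i))%:R ((ix == j) && (iy == i))%:R ((ix == j) && (iu == i))%:R
      ((iy == j) && (ix == i))%:R ((iy == j) && (iy == i))%:R ((iy == j) && (iu == i))%:R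
      ((iu == j) && (ix == i))%:R ((iu == j) && (iy == i))%:R ((iu == j) && (iu == i))%:R
      0 0 0.
Proof.
by rewrite [LHS]aff_eta /lvf /= !mxE.
Qed.

Lemma aff_inj a b c d e f g h i p q r a' b' c' d' e' f' g' h' i' p' q' r' :
  aff a b c d e f g h i p q r = aff a' b' c' d' e' f' g' h' i' p' q' r' ->
  [/\ a = a', c = c', f = f', e = e' & i = i'] /\ [/\ p = p' & q = q'].
Proof.
move=> [/matrixP H /matrixP H'].
move: (H ix ix) (H ix iu) (H iy iu) (H iy iy) (H iu iu) (H' ix 0) (H' iy 0).
by rewrite !mxE /= => -> -> -> -> -> -> ->.
Qed.

Definition se1 : affine := - lvf R ix ix + lvf R iy iy.
Definition se2 : affine := lvf R iu ix - 2 *: vf R ix - 2 *: lvf R iy iu.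
Definition se3 : affine := lvf R iu iy - 2 *: vf R iy - 2 *: lvf R ix iu.
Definition qe2 : affine := lvf R ix ix + lvf R iu iu.
Definition qe3 : affine := vf R ix + lvf R iy iu.
Definition qe4 : affine := vf R iy + lvf R ix iu.

Lemma se1E : se1 = aff (-1) 0 0 0 1 0 0 0 0 0 0 0.
Proof. by rewrite /se1 !lvfE affN affD /=; congr aff; ring. Qed.

Lemma se2E : se2 = aff 0 0 1 0 0 0 0 (-2) 0 (-2) 0 0.
Proof. by rewrite /se2 !lvfE !vfE !affZ !affN !affD /=; congr aff; ring. Qed.

Lemma se3E : se3 = aff 0 0 0 0 0 1 (-2) 0 0 0 (-2) 0.
Proof. by rewrite /se3 !lvfE !vfE !affZ !affN !affD /=; congr aff; ring. Qed.

Lemma qe2E : qe2 = aff 1 0 0 0 0 0 0 0 1 0 0 0.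
Proof. by rewrite /qe2 !lvfE affD /=; congr aff; ring. Qed.

Lemma qe3E : qe3 = aff 0 0 0 0 0 0 0 1 0 1 0 0.
Proof. by rewrite /qe3 lvfE vfE affD /=; congr aff; ring. Qed.

Lemma qe4E : qe4 = aff 0 0 0 0 0 0 1 0 0 0 1 0.
Proof. by rewrite /qe4 lvfE vfE affD /=; congr aff; ring. Qed.

Lemma sl2_comb k l m : k *: se1 + l *: se2 + m *: se3 =
  aff (- k) 0 l 0 k m (-2 * m) (-2 * l) 0 (-2 * l) (-2 * m) 0.
Proof. by rewrite se1E se2E se3E !affZ !affD; congr aff; ring. Qed.

Lemma solv_comb k l m n : k *: se1 + l *: qe2 + m *: qe3 + n *: qe4 =
  aff (l - k) 0 0 0 k 0 n m l m n 0.
Proof. by rewrite se1E qe2E qe3E qe4E !affZ !affD; congr aff; ring. Qed.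

Lemma trans_comb m n : m *: qe3 + n *: qe4 = aff 0 0 0 0 0 0 n m 0 m n 0.
Proof. by rewrite qe3E qe4E !affZ !affD; congr aff; ring. Qed.

Lemma brackets_sl2 :
  [/\ bracket se1 se2 = se2, bracket se1 se3 = - se3 & bracket se2 se3 = - 2 *: se1].
Proof.
split; rewrite ?se1E ?se2E ?se3E aff_bracket ?affZ ?affN; congr aff; ring.
Qed.

Lemma brackets_solv :
  [/\ [/\ bracket se1 qe3 = qe3, bracket se1 qe4 = - qe4 & bracket qe2 qe3 = - qe3],
      bracket se1 qe2 = 0, bracket qe2 qe4 = 0 & bracket qe3 qe4 = 0].
Proof.
split; [split|..]; rewrite ?aff0 ?se1E ?qe2E ?qe3E ?qe4E aff_bracket ?affN; congr aff; ring.
Qed.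

Lemma memL_sl2 X : X \in <<[:: se1; se2; se3]>>%VS <->
  exists k l m, X = aff (- k) 0 l 0 k m (-2 * m) (-2 * l) 0 (-2 * l) (-2 * m) 0.
Proof.
split=> [/mem_span3[k [l [m ->]]]|[k [l [m ->]]]]; last apply/mem_span3;
  exists k, l, m; by rewrite sl2_comb.
Qed.

Lemma memL_solv X : X \in <<[:: se1; qe2; qe3; qe4]>>%VS <->
  exists k l m n, X = aff (l - k) 0 0 0 k 0 n m l m n 0.
Proof.
split=> [/mem_span4[k [l [m [n ->]]]]|[k [l [m [n ->]]]]]; last apply/mem_span4;
  exists k, l, m, n; by rewrite solv_comb.
Qed.

Lemma one_eq0_absurd (x : C) : x = 0 -> 1 = x -> False.
Proof. by move=> -> /eqP; rewrite oner_eq0. Qed.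

Lemma dim_sl2 : \dim <<[:: se1; se2; se3]>>%VS = 3%N.
Proof.
suff /eqP -> : free [:: se1; se2; se3] by [].
rewrite !free_cons nil_free andbT; apply/and3P; split; apply/negP.
- move=> /mem_span2[k [l]]; rewrite se1E se2E se3E !affZ affD => /aff_inj[[_ _ _ h _] _].
  by apply: one_eq0_absurd h; ring.
- rewrite span_seq1 => /vlineP[k]; rewrite se2E se3E affZ => /aff_inj[[_ h _ _ _] _].
  by apply: one_eq0_absurd h; ring.
- rewrite span_nil memv0 => /eqP; rewrite se3E aff0 => /aff_inj[[_ _ h _ _] _].
  by apply: one_eq0_absurd h.
Qed.

Lemma dim_solv : \dim <<[:: se1; qe2; qe3; qe4]>>%VS = 4%N.
Proof.
suff /eqP -> : free [:: se1; qe2; qe3; qe4] by [].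
rewrite !free_cons nil_free andbT; apply/and4P; split; apply/negP.
- move=> /mem_span3[k [l [m]]]; rewrite se1E qe2E qe3E qe4E !affZ !affD.
  by move=> /aff_inj[[_ _ _ h _] _]; apply: one_eq0_absurd h; ring.
- move=> /mem_span2[k [l]]; rewrite qe2E qe3E qe4E !affZ affD => /aff_inj[[_ _ _ _ h] _].
  by apply: one_eq0_absurd h; ring.
- rewrite span_seq1 => /vlineP[k]; rewrite qe3E qe4E affZ => /aff_inj[_ [h _]].
  by apply: one_eq0_absurd h; ring.
- rewrite span_nil memv0 => /eqP; rewrite qe4E aff0 => /aff_inj[_ [_ h]].
  by apply: one_eq0_absurd h.
Qed.

Lemma derived_sub (L U : {vspace affine}) :
  (forall X Y, X \in L -> Y \in L -> bracket X Y \in U) -> (derived L <= U)%VS.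
Proof.
move=> H; apply/span_subvP => Z /allpairsP[[X Y] /= [/vbasis_mem hX /vbasis_mem hY ->]].
exact: H.
Qed.

(** The derived algebra is spanned by the commuting fields [e3] and [e4]. *)
Lemma solvable_solv : solvable_algebra <<[:: se1; qe2; qe3; qe4]>>%VS.
Proof.
set L := <<_>>%VS; exists 2%N; rewrite /=.
have D1 : (derived L <= <<[:: qe3; qe4]>>)%VS.
  apply: derived_sub => X Y /memL_solv[k [l [m [n ->]]]] /memL_solv[k' [l' [m' [n' ->]]]].
  apply/mem_span2; exists ((l' - k') * m - (l - k) * m'), (k' * n - k * n').
  by rewrite trans_comb aff_bracket; congr aff; ring.
apply/eqP; rewrite -subv0; apply: derived_sub => X Y hX hY.
have /mem_span2[m [n ->]] := subvP D1 _ hX.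
have /mem_span2[m' [n' ->]] := subvP D1 _ hY.
rewrite memv0 !trans_comb aff_bracket; apply/eqP.
by rewrite aff0; congr aff; ring.
Qed.

Definition mx2 (a b c d : C) : 'M[C]_2 := \matrix_(i, j) nth 0 (nth [::] [:: [:: a; b]; [:: c; d]] i) j.

(** The coordinate of a field of the algebra on [e1] is its entry [(y, y)], and those on [e2] and [e3]
    are read on the constant terms; [e1], [e2] and [e3] are mapped to [h / 2], [e] and [- f], where
    [h], [e], [f] is the standard basis of sl2. *)
Definition sl2_map (X : affine) : 'M[C]_2 :=
  mx2 (X.1 iy iy / 2) (- X.2 ix 0 / 2) (X.2 iy 0 / 2) (- X.1 iy iy / 2).

Lemma mx2_ext (M N : 'M[C]_2) : M 0 0 = N 0 0 -> M 0 1 = N 0 1 -> M 1 0 = N 1 0 ->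
  M 1 1 = N 1 1 -> M = N.
Proof.
move=> h1 h2 h3 h4.
have E (k : 'I_2) : k = 0 \/ k = 1.
  by case: k => -[|[|k]] kP //; [left|right]; apply: val_inj.
by apply/matrixP => k l; case: (E k) => ->; case: (E l) => ->.
Qed.

Lemma sl2_map_is_linear : linear sl2_map.
Proof.
by move=> k X Y; apply: mx2_ext; rewrite !mxE /=; field.
Qed.

HB.instance Definition _ :=
  GRing.isLinear.Build C affine 'M[C]_2 *:%R sl2_map sl2_map_is_linear.

Lemma sl2_map_aff k l m :
  sl2_map (aff (- k) 0 l 0 k m (-2 * m) (-2 * l) 0 (-2 * l) (-2 * m) 0) =
  mx2 (k / 2) l (- m) (- k / 2).
Proof. by apply: mx2_ext; rewrite !mxE /=; field. Qed.

Lemma isomorphic_sl2_sl2 : isomorphic_sl2 <<[:: se1; se2; se3]>>%VS.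
Proof.
have n2 : 2 != 0 :> C by rewrite pnatr_eq0.
pose phi : {linear affine -> 'M[C]_2} := sl2_map.
have phiE k l m :
  phi (aff (- k) 0 l 0 k m (-2 * m) (-2 * l) 0 (-2 * l) (-2 * m) 0) =
  mx2 (k / 2) l (- m) (- k / 2) := sl2_map_aff k l m.
exists phi; split.
- move=> X Y /memL_sl2[k [l [m ->]]] /memL_sl2[k' [l' [m' ->]]].
  rewrite !phiE => /matrixP H.
  move: (H 0 0) (H 0 1) (H 1 0); rewrite !mxE /= => e1 e2 e3.
  have -> : k = k' by transitivity (2 * (k / 2)); [field|rewrite e1; field].
  have -> : m = m' by apply: oppr_inj.
  by rewrite e2.
- move=> N; split=> [tN|[X /memL_sl2[k [l [m ->]]] <-]]; last first.
    by rewrite phiE /mxtrace !big_ord_recl big_ord0 !mxE /=; field.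
  exists (aff (- (2 * N 0 0)) 0 (N 0 1) 0 (2 * N 0 0) (- N 1 0)
    (-2 * - N 1 0) (-2 * N 0 1) 0 (-2 * N 0 1) (-2 * - N 1 0) 0).
    by apply/memL_sl2; exists (2 * N 0 0), (N 0 1), (- N 1 0).
  rewrite phiE.
  have N11 : N 1 1 = - N 0 0.
    move: tN; rewrite /mxtrace !big_ord_recl big_ord0 addr0.
    have -> : lift ord0 ord0 = 1 :> 'I_2 by apply: val_inj.
    by move=> /eqP; rewrite addrC addr_eq0 => /eqP.
  by apply: mx2_ext; rewrite !mxE /= ?N11; field.
- move=> X Y /memL_sl2[k [l [m ->]]] /memL_sl2[k' [l' [m' ->]]].
  by rewrite !phiE aff_bracket; apply: mx2_ext;
    rewrite !mxE !big_ord_recl !big_ord0 !mxE /=; field.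
Qed.

End AffineFields.

(** * The symmetry algebras *)
Section SymmetryAlgebras.
Variable R : realType.
Notation C := (Cplx R).
Local Notation sqrtC' := (@sqrtc R : C -> C).
Variable V : set (C * C).
Hypothesis oV : open V.
Hypothesis V0 : V (0, 0).

Let Q := Surface V (@quadric_fn R).

Lemma near_line_dom (y : C) : \forall t \near 0^', V (t, t * y).
Proof.
have c := @cvg_line C 0 y; have H := c V (open_nbhs_nbhs (conj oV V0)).
near=> t; have : V (0 + (t, t * y)) by near: t; exact: H.
by rewrite add0r.
Unshelve. all: by end_near. Qed.

Lemma quadric_tangent z (v : 'cV[C]_3) :
  tangent Q z v <-> z.1 * v iy 0 + z.2 * v ix 0 = v iu 0.
Proof.
have [_ E] := @is_derive_xy C z (v ix 0, v iy 0).
have {}E : 'D_(v ix 0, v iy 0) (fn Q) z = z.1 * v iy 0 + z.2 * v ix 0 := E.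
by rewrite /tangent E.
Qed.

Lemma quadric_symmetry_algebra :
  symmetry_algebra Q <<[:: se1 R; qe2 R; qe3 R; qe4 R]>>%VS.
Proof.
move=> X; split=> [H|/memL_solv[k [l [m [n ->]]]] z Vz]; last first.
  apply/quadric_tangent; rewrite /graph_pt aff_eval ptx pty ptu /= /quadric_fn; by ring.
rewrite [X]aff_eta in H *; move: H.
move: (X.1 ix ix) (X.1 ix iy) (X.1 ix iu) (X.1 iy ix) (X.1 iy iy) (X.1 iy iu)
      (X.1 iu ix) (X.1 iu iy) (X.1 iu iu) (X.2 ix 0) (X.2 iy 0) (X.2 iu 0).
move=> a b c d e f g h i p q r H.
have [|[-> -> -> -> ->] [-> -> ->]] := @quadric_symmetry C a b c p d e f q g h i r.
  move=> y; have nV := near_line_dom y; near=> t.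
  have Vt : V (t, t * y) by near: t; exact: nV.
  have /quadric_tangent := H _ Vt.
  by rewrite /graph_pt aff_eval ptx pty ptu /= /quadric_fn /= addrC.
by apply/memL_solv; exists e, (a + e), p, q; congr aff; ring.
Unshelve. all: by end_near. Qed.

Hypothesis V1 : forall z, V z -> `|z.1 * z.2| < 1.

Let S0 := Surface V (@sqrt_fn R).

Lemma sqrt_tangent z (v : 'cV[C]_3) : V z ->
  tangent S0 z v <->
  z.1 * v iy 0 + z.2 * v ix 0 = (1 - fn S0 z / 2) * v iu 0.
Proof.
move=> Vz; have [_ _ s0] := sqrt_branch V1 Vz.
have fE : 1 - fn S0 z / 2 = sqrtC' (1 - z.1 * z.2).
  rewrite -[fn S0 z]/(2 - 2 * sqrtC' (1 - z.1 * z.2)); by move: (sqrtC' _) => s; field.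
have [_ E] := @is_derive_sqrt_surface C sqrtC' V (sqrt_branch V1) z (v ix 0, v iy 0) Vz.
have {}E : 'D_(v ix 0, v iy 0) (fn S0) z =
  (z.1 * v iy 0 + z.2 * v ix 0) / sqrtC' (1 - z.1 * z.2) := E.
rewrite /tangent fE E; split=> [<-|->]; first by rewrite [RHS]mulrC divfK.
by rewrite mulrAC divff// mul1r.
Qed.

Lemma sqrt_fn_branch z : 
  fn S0 z = z.1 * z.2 + fn S0 z ^+ 2 / 4.
Proof.
by rewrite [X in _ + X]mulrC; exact: sqrt_fixed.
Qed.

Lemma sqrt_symmetry_algebra :
  symmetry_algebra S0 <<[:: se1 R; se2 R; se3 R]>>%VS.
Proof.
move=> X; split=> [H|/memL_sl2[k [l [m ->]]] z Vz]; last first.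
  apply/(sqrt_tangent _ Vz); rewrite /graph_pt aff_eval ptx pty ptu.
  by move: (fn S0 z) => u; field.
rewrite [X]aff_eta in H *; move: H.
move: (X.1 ix ix) (X.1 ix iy) (X.1 ix iu) (X.1 iy ix) (X.1 iy iy) (X.1 iy iu)
      (X.1 iu ix) (X.1 iu iy) (X.1 iu iu) (X.2 ix 0) (X.2 iy 0) (X.2 iu 0).
move=> a b c d e f g h i p q r H.
(* [u] is the function itself along a line through the origin *)
have [|[-> -> -> ->] [-> -> -> -> ->]] := @sqrt_symmetry C a b c p d e f q g h i r.
  move=> y; exists (fun t => fn S0 (t, t * y)); split.
  - exists (2 * `|y|); first by rewrite mulr_ge0// ler0n.
    apply: (@filterE _ _ _) => t.
    have -> : 2 * `|y| * `|t| ^+ 2 = 2 * `|t * (t * y)| by rewrite !normrM; ring.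
    exact: sqrt_fn_le.
  - apply: (@filterE _ _ _) => t; by rewrite {1}sqrt_fn_branch /=; ring.
  - have nV := near_line_dom y; near=> t.
    have Vt : V (t, t * y) by near: t; exact: nV.
    have /(sqrt_tangent _ Vt) := H _ Vt.
    by rewrite /graph_pt aff_eval ptx pty ptu -[_.1]/t -[_.2]/(t * y) => <-; rewrite addrC.
apply/memL_sl2; exists e, (- p / 2), (- q / 2); by congr aff; field.
Unshelve. all: by end_near. Qed.

(** The fields [e2] and [e3] project to multiples of [d/dx] and [d/dy] by [u - 2], which is nonzero. *)
Lemma sqrt_homogeneous : homogeneous S0.
Proof.
move=> z Vz v /(sqrt_tangent _ Vz) tv.
have [_ _ s0] := sqrt_branch V1 Vz.
have fE : fn S0 z = 2 - 2 * sqrtC' (1 - z.1 * z.2) by [].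
set u := fn S0 z in tv fE; set s := sqrtC' _ in s0 fE.
pose l := v ix 0 / (u - 2); pose m := v iy 0 / (u - 2).
have u2 : u - 2 != 0.
  have -> : u - 2 = - (2 * s) by rewrite fE; ring.
  by rewrite oppr_eq0 mulf_neq0 ?pnatr_eq0.
exists (aff (- 0) 0 l 0 0 m (-2 * m) (-2 * l) 0 (-2 * l) (-2 * m) 0).
  by apply/sqrt_symmetry_algebra/memL_sl2; exists 0, l, m.
rewrite /graph_pt aff_eval -/u [RHS]ptE; congr pt.
- by rewrite /l; field.
- by rewrite /m; field.
have -> : v iu 0 = (z.1 * v iy 0 + z.2 * v ix 0) / (1 - u / 2).
  rewrite tv mulrC mulKf//; have -> : 1 - u / 2 = s by rewrite fE; field.
  exact: s0.
have u2' : 2 - u != 0 by rewrite -opprB oppr_eq0.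
by rewrite /l /m; field; rewrite u2' u2.
Qed.

End SymmetryAlgebras.

(** * The classification *)
Lemma branch_B3_1_in_B3 (R : realType) (S : surface R) : branch_B3_1 S -> in_B3 S.
Proof. by move=> [_ H] p /H[G [nf g30 g03 _]]; exists G; split. Qed.

Lemma branch_B3_2_in_B3 (R : realType) (S : surface R) : branch_B3_2 S -> in_B3 S.
Proof. by move=> [_ H] p /H[G [nf g30 g03 _]]; exists G; split. Qed.

Theorem proposition1p5 (R : realType) :
  (* (a) *)
  ((exists I : nat -> nat -> Cplx R,
     [/\ forall j k : nat, (j + k <= 4)%N ->
           I j k = ((j, k) == (1, 1)%N)%:R + ((j, k) == (2, 2)%N)%:R,
         has_expansion (@sqrt_fn R) I,
         forall (S : surface R) p, branch_B3_1 S -> graph S p ->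
           normal_form S p I
       & forall (S : surface R) p G, branch_B3_1 S -> graph S p ->
           normal_form S p G -> G 2%N 2%N = 1 -> forall j k : nat, G j k = I j k])
   /\
   (forall V : set (Cplx R * Cplx R), open V ->
      V `<=` [set z | `|z.1 * z.2| < 1] -> V (0, 0) ->
      let S0 := Surface V (@sqrt_fn R) in
      let e1 := - lvf R ix ix + lvf R iy iy in
      let e2 := lvf R iu ix - 2 *: vf R ix - 2 *: lvf R iy iu in
      let e3 := lvf R iu iy - 2 *: vf R iy - 2 *: lvf R ix iu in
      let L := <<[:: e1; e2; e3]>>%VS in
      [/\ branch_B3_1 S0,
          forall (S : surface R) p, branch_B3_1 S -> graph S p ->
            germ_equiv S p S0 0,
          homogeneous S0,
          symmetry_algebra S0 L /\ \dim L = 3%N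
        & [/\ bracket e1 e2 = e2, bracket e1 e3 = - e3,
              bracket e2 e3 = - 2 *: e1 & isomorphic_sl2 L]]))
  /\
  (* (b) *)
  ((forall (S : surface R) p G, branch_B3_2 S -> graph S p ->
      normal_form S p G <-> forall j k : nat, G j k = ((j, k) == (1, 1)%N)%:R)
   /\
   (forall V : set (Cplx R * Cplx R), open V -> V (0, 0) ->
      let Q := Surface V (@quadric_fn R) in
      let e1 := - lvf R ix ix + lvf R iy iy in
      let e2 := lvf R ix ix + lvf R iu iu in
      let e3 := vf R ix + lvf R iy iu in
      let e4 := vf R iy + lvf R ix iu in
      let L := <<[:: e1; e2; e3; e4]>>%VS in
      [/\ branch_B3_2 Q,
          forall (S : surface R) p, branch_B3_2 S -> graph S p ->
            germ_equiv S p Q 0,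
          symmetry_algebra Q L /\ \dim L = 4%N
        & [/\ [/\ bracket e1 e3 = e3, bracket e1 e4 = - e4
                & bracket e2 e3 = - e3],
              [/\ bracket e1 e2 = 0, bracket e2 e4 = 0 & bracket e3 e4 = 0]
            & solvable_algebra L]])).
Proof.
split; split.
- exists (sqrt_I R); split.
  + move=> j k jk; rewrite /sqrt_I /diag_coef !xpair_eqE.
    have [kj|njk] := eqVneq j k; last first.
      by case: j k njk jk => [|[|[|j]]] [|[|[|k]]] //= _ _; rewrite ?addr0.
    move: jk; rewrite -kj => {kj}; case: j => [|[|[|j]]] jk /=; last by lia.
    * by rewrite sqrt_coef0 mul0r addr0.
    * by rewrite sqrt_coef1 mul1r expr1n addr0.
    * by rewrite sqrt_coef2 add0r -[2`!%N]/2%N; field.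
  + exact: sqrt_has_expansion.
  + move=> S p BS Sp; have [G [nf _ _ g22]] := BS.2 p Sp.
    split; first exact: sqrt_normalized.
    exists (Surface (@bidisk R) (@sqrt_fn R)); split.
    * exact: sqrt_local_surface (@open_bidisk R) (@bidisk_xy R).
    * exact: bidisk0.
    * exact: sqrt_has_expansion.
    * exact: sqrt_germ_equiv (@open_bidisk R) (@bidisk0 R) (branch_B3_1_in_B3 BS) nf g22.
  + move=> S p G BS _ nf g22; exact: sqrt_I_unique (branch_B3_1_in_B3 BS) nf g22.
- move=> V oV V1 V0 S0 e1 e2 e3 L; split.
  + split; first exact: sqrt_local_surface oV V1.
    move=> p [z Vz ->]; exists (sqrt_I R); split.
    * exact: sqrt_normal_form.
    * by rewrite /sqrt_I /diag_coef.
    * by rewrite /sqrt_I /diag_coef.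
    * by rewrite sqrt_I22 oner_eq0.
  + move=> S p BS Sp; have [G [nf _ _ g22]] := BS.2 p Sp.
    exact: sqrt_germ_equiv oV V0 (branch_B3_1_in_B3 BS) nf g22.
  + exact: sqrt_homogeneous.
  + split; [exact: sqrt_symmetry_algebra|exact: dim_sl2].
  + have [b12 b13 b23] := brackets_sl2 R; split=> //; exact: isomorphic_sl2_sl2.
- move=> S p G BS Sp; have [G' [nf' _ _ g22]] := BS.2 p Sp.
  have BS3 := branch_B3_2_in_B3 BS; split=> [nf|GE].
    exact: quadric_normal_form_rigid (@open_bidisk R) (@bidisk0 R)
      (quadric_germ_equiv (@open_bidisk R) (@bidisk0 R) BS3 nf' g22) nf.
  have -> : G = quadric_coef R by apply/funext => j; apply/funext => k; exact: GE.
  by rewrite -(quadric_unique BS3 nf' g22).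
- move=> V oV V0 Q e1 e2 e3 e4 L; split.
  + split; first exact: quadric_local_surface.
    by move=> p [z Vz ->]; exists (quadric_coef R); split=> //; exact: quadric_normal_form.
  + move=> S p BS Sp; have [G [nf _ _ g22]] := BS.2 p Sp.
    exact: quadric_germ_equiv oV V0 (branch_B3_2_in_B3 BS) nf g22.
  + split; [exact: quadric_symmetry_algebra|exact: dim_solv].
  + have [b b12 b24 b34] := brackets_solv R.
    split; [exact: b|split; [exact: b12|exact: b24|exact: b34]|exact: solvable_solv].
Qed.
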